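(* For every $\kappa_2>1$, there exists $\kappa_1>0$ such that, for any $m\ge 1$, $$\mathrm B^{\rm pol}_{\mathbb C,m}\le\kappa_1\exp\big(\kappa_2\sqrt{m\log m}\big).$$
   Context: For $m\ge1$, $\mathrm B^{\rm pol}_{\mathbb C,m}$ is the best (smallest) constant $D_m\ge 1$ such that, for any $n\ge1$ and any $m$-homogeneous polynomial $P(z)=\sum_{|\alpha|=m}a_\alpha z^\alpha$ on $\mathbb C^n$, $$\Big(\sum_{|\alpha|=m}|a_\alpha|^{\frac{2m}{m+1}}\Big)^{\frac{m+1}{2m}}\le D_m\|P\|_\infty,\qquad \|P\|_\infty=\sup_{z\in\mathbb D^n}|P(z)|,$$ where $\mathbb D$ is the open unit disk of $\mathbb C$. Such a finite constant exists (the polynomial Bohnenblust--Hille inequality). *)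

(* Defs.v *)
From mathcomp Require Import all_boot all_order all_algebra.
From mathcomp Require Import mpoly.
From mathcomp Require Import complex.
From mathcomp Require Import classical_sets reals ereal constructive_ereal exp.

Set Implicit Arguments.
Unset Strict Implicit.
Unset Printing Implicit Defensive.

Import Order.TTheory GRing.Theory Num.Theory.
Import Normc.

Local Open Scope classical_set_scope.
Local Open Scope ring_scope.
Local Open Scope complex_scope.

(* [normc z : R] is the modulus of [z : R[i]]; the norm [`|z|] of the library
   lives in [R[i]]. *)

Definition polydisk (R : realType) (n : nat) : set ('I_n -> R[i]) :=
  [set z | forall i, normc (z i) < 1].

Definition polydisk_norm (R : realType) (n : nat) (P : {mpoly R[i][n]}) :
    \bar R :=
  ereal_sup [set (normc P.@[z])%:E | z in @polydisk R n].

(* The bounded multi-indices ['X_{1..n < m.+1}] are those of degree at most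
   [m]; the filter leaves exactly the finitely many of degree [m]. *)
Definition BH_coef_norm (R : realType) (m n : nat) (P : {mpoly R[i][n]}) : R :=
  (\sum_(a : 'X_{1..n < m.+1} | mdeg a == m)
      normc P@_a `^ ((2 * m)%:R / m.+1%:R)) `^ (m.+1%:R / (2 * m)%:R).

Definition BH_pol_constant (R : realType) (m : nat) (D : R) : Prop :=
  1 <= D /\
  forall (n : nat) (P : {mpoly R[i][n]}), (1 <= n)%N -> P \is m.-homog ->
    ((BH_coef_norm m P)%:E <= D%:E * polydisk_norm P)%E.

(* The infimum is taken in [\bar R], where it is [+oo] if no constant is
   admissible: a finite upper bound on [B_pol R m] thus asserts that an
   admissible constant exists. *)
Definition B_pol (R : realType) (m : nat) : \bar R :=
  ereal_inf [set D%:E | D in BH_pol_constant (R := R) m].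

(* Main.v *)
Require Import Defs.
From mathcomp Require Import all_boot all_order all_algebra cyclic separable cyclotomic.
From mathcomp Require Import mpoly complex ring lra zify.
From mathcomp Require Import classical_sets reals ereal constructive_ereal sequences exp.

Set Implicit Arguments.
Unset Strict Implicit.
Unset Printing Implicit Defensive.

Import Order.TTheory GRing.Theory Num.Theory.
Import Normc.

Local Open Scope ring_scope.
Local Open Scope complex_scope.

(** Symmetrizing its coefficients, write an m-homogeneous polynomial as
    P(z) = \sum_t T(t) z_{t_1} ... z_{t_m}, a sum over m-tuples of indices with
    T symmetric; a coefficient of P is T(t) times the number arrangements t of
    distinct rearrangements of t.  As 2m/(m+1) <= 2, it is enough to bound the
    l^{2m/(m+1)} norm of the family sqrt(arrangements t) |T(t)|
    (coef_norm_le).  Let m = k + l.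

    - A symmetric family indexed by m-tuples has its l^{2m/(m+1)} norm bounded
      by the mixed norm that is l^2 in the last l entries and l^{2k/(k+1)} in
      the first k (symmetric_mixed_norm_le).  This case of an inequality of
      Blei is proved by entropy: normalize the powers of the family into a
      probability law on m-tuples, apply the inequality of Han to its
      marginals, and Gibbs' inequality twice.

    - Freeze the first k entries.  Up to arrangements, the l^2 norm in the last
      l entries is the L^2 norm on the torus of an l-homogeneous polynomial Q,
      and the L^2 norm exceeds the L^p norm by at most a power of e
      (tensor_hypercontractive).  For p = 2k/(k+1) this costs e^{(l+1)/(2k)} in
      the end.  It follows from the logarithmic Sobolev inequality for analytic
      polynomials f = \sum_n a_n z^n on the circle,
        mean |f|^2 ln |f|^2 <= W ln W + \sum_n n |a_n|^2,  W = \sum_n |a_n|^2,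
      proved up to an arbitrarily small multiple of W (circle_entropy) and
      passed to the torus by subadditivity of entropy (torus_entropy).

    - Once the mean over the torus is outside, fix a point z of the torus.
      What is left is the same problem for the symmetric tensor of order k
      obtained by evaluating the last l slots of T at z, and a crude constant
      e^{k/2+1} is good enough there (symmetric_tensor_BH).  The supremum of
      this tensor is compared to that of P by polarization (polarization).

    The result is the constant BH_bound k l (B_pol_le).  For k <= l it is at
    most exp((k/2) ln m + 2k + m/(2k) + 1) (BH_bound_le), and k of order
    sqrt(m / ln m) balances the first and the third term at a total of
    (1 + o(1)) sqrt(m ln m) (BH_bound_asymptotic).  The finitely many small m
    are absorbed in kappa1.

    The logarithmic Sobolev inequality is first proved for squares f = h^2
    (entropy_square_le).  There y^2 ln y^2 is bounded by a cubic polynomial, at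
    y = |h|^2 up to scaling, and the moments of |h|^2 up to the third are
    computed from its Fourier coefficients, which satisfy the energy bound
    autocorrelation_le_square.  Any f reduces to a square: roots inside the
    disk are reflected to the outside, which preserves |f| on the circle and
    decreases \sum_n n |a_n|^2 (reflect_roots), and a polynomial without roots
    in the open disk is approximated by squares of polynomials
    (exists_square_approx).  Means are taken over N-th roots of unity, with N
    above all the degrees involved, so that no integral is needed. *)

(** * Sums over tuples *)

Lemma big_tuple0 (V : nmodType) (I : finType) (F : seq I -> V) :
  \sum_(t : 0.-tuple I) F t = F [::].
Proof.
by rewrite (big_pred1 [tuple]) => [|t] //; apply/esym/eqP; exact: tuple0.
Qed.

Lemma big_tupleS (V : nmodType) (I : finType) k (F : seq I -> V) :
  \sum_(t : k.+1.-tuple I) F t = \sum_i \sum_(t : k.-tuple I) F (i :: t).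
Proof.
rewrite pair_big /= (reindex (fun p : I * k.-tuple I => [tuple of p.1 :: p.2])) //=.
exists (fun t : k.+1.-tuple I => (thead t, [tuple of behead t])).
  by move=> [i t] _ /=; congr pair; apply: val_inj.
by move=> t _ /=; rewrite [RHS]tuple_eta.
Qed.

Lemma big_tuple_cat (V : nmodType) (I : finType) k l (F : seq I -> V) :
  \sum_(t : (k + l).-tuple I) F t =
  \sum_(s : k.-tuple I) \sum_(r : l.-tuple I) F (s ++ r).
Proof.
elim: k F => [|k IH] F; first by rewrite (big_tuple0 (fun s => \sum_(r : l.-tuple I) F (s ++ r))).
rewrite (big_tupleS _ (fun s => \sum_(r : l.-tuple I) F (s ++ r))).
rewrite (big_tupleS (k + l)); apply: eq_bigr => i _.
exact: (IH (fun t => F (i :: t))).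
Qed.

(** * Entropy of exchangeable tuples *)

Section Entropy.
Variable R : realType.

Lemma ln_le_sub1 (x : R) : 0 < x -> ln x <= x - 1.
Proof.
by move=> x0; rewrite -{1}[x](subrKC 1) le_ln1Dx // ltrBrDl subrr.
Qed.

(** The tangent bound from which all entropy comparisons below follow; summed
    over two families of equal mass it is Gibbs' inequality.  The last hypothesis
    is absolute continuity, needed because ln 0 is 0 here. *)
Lemma mul_ln_le (s t : R) : 0 <= t -> 0 <= s -> (0 < t -> 0 < s) ->
  t * ln s <= t * ln t + s - t.
Proof.
rewrite le_eqVlt => /predU1P[<- s0 _|t0 s0 /(_ t0) s1].
  by rewrite !mul0r add0r subr0.
have := ln_le_sub1 (divr_gt0 s1 t0); rewrite ln_div ?posrE // => h.
have : t * (ln s - ln t) <= t * (s / t - 1) by rewrite ler_pM2l.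
rewrite mulrBr [t * (_ - 1)]mulrBr mulr1 mulrCA divff ?gt_eqF // mulr1; lra.
Qed.

Section Marginals.
Variables (I : finType) (m : nat) (pi : seq I -> R).
Hypothesis pi_ge0 : forall s, 0 <= pi s.
Hypothesis pi_sym : forall s t, perm_eq s t -> pi s = pi t.
Hypothesis pi_sum : \sum_(s : m.-tuple I) pi s = 1.

(** The law of the first size t entries of a random m-tuple of law pi; as pi is
    symmetric, the choice of the entries does not matter. *)
Definition marginal (t : seq I) := \sum_(r : (m - size t).-tuple I) pi (t ++ r).

Definition marginal_entropy j := - \sum_(t : j.-tuple I) marginal t * ln (marginal t).

Lemma marginal_ge0 t : 0 <= marginal t.
Proof. exact: sumr_ge0. Qed.

Lemma marginal_perm s t : perm_eq s t -> marginal s = marginal t.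
Proof.
move=> st; rewrite /marginal (perm_size st); apply: eq_bigr => r _.
by apply: pi_sym; rewrite perm_cat2r.
Qed.

Lemma marginal_cons t : (size t < m)%N -> marginal t = \sum_x marginal (x :: t).
Proof.
move=> tm; rewrite /marginal.
have -> : (m - size t = (m - (size t).+1).+1)%N by lia.
rewrite (big_tupleS _ (fun r => pi (t ++ r))); apply: eq_bigr => x _.
apply: eq_bigr => r _; apply: pi_sym.
exact: (permEl (perm_catCA t [:: x] r)).
Qed.

Lemma marginal_full (t : m.-tuple I) : marginal t = pi t.
Proof.
rewrite /marginal size_tuple subnn (big_tuple0 (fun r => pi (t ++ r))).
by rewrite cats0.
Qed.

Lemma marginal_cat k l (t : k.-tuple I) : m = (k + l)%N ->
  marginal t = \sum_(r : l.-tuple I) pi (t ++ r).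
Proof. by move=> mkl; rewrite /marginal size_tuple mkl addKn. Qed.

Lemma marginal_sum j : (j <= m)%N -> \sum_(t : j.-tuple I) marginal t = 1.
Proof.
move=> jm; rewrite -pi_sum -(subnKC jm) (big_tuple_cat j (m - j)).
by apply: eq_bigr => t _; rewrite /marginal size_tuple.
Qed.

Lemma marginal_gt0 x t : (size t < m)%N -> 0 < marginal (x :: t) -> 0 < marginal t.
Proof.
move=> tm h; rewrite (marginal_cons tm) (bigD1 x) //=.
by rewrite ltr_pwDl // sumr_ge0 // => y _; exact: marginal_ge0.
Qed.

Lemma entropy0 : marginal_entropy 0 = 0.
Proof.
rewrite /marginal_entropy (big_tuple0 (fun t => marginal t * ln (marginal t))).
have := marginal_sum (leq0n m); rewrite (big_tuple0 marginal) => ->.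
by rewrite ln1 mulr0 oppr0.
Qed.

(** Submodularity of entropy.  The law P(x, y, t) of j + 2 entries is compared by
    Gibbs' inequality to P(x, t) P(y, t) / P(t), which also has mass 1; by symmetry
    P(x, t) and P(y, t) have the same entropy. *)
Lemma entropy_concave j : (j.+2 <= m)%N ->
  marginal_entropy j.+2 + marginal_entropy j <= marginal_entropy j.+1 *+ 2.
Proof.
move=> jm.
pose P3 x y (t : seq I) := marginal (x :: y :: t).
pose P2 x (t : seq I) := marginal (x :: t).
pose P1 (t : seq I) := marginal t.
have sz (t : j.-tuple I) : size t = j by rewrite size_tuple.
have P3y x (t : j.-tuple I) : \sum_y P3 x y t = P2 x t.
  rewrite /P2 marginal_cons ?/= ?sz //; apply: eq_bigr => y _.
  by apply: marginal_perm; exact: (permEl (perm_catCA [:: x] [:: y] t)).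
have P3x y (t : j.-tuple I) : \sum_x P3 x y t = P2 y t.
  by rewrite /P2 marginal_cons ?/= ?sz.
have P2x (t : j.-tuple I) : \sum_x P2 x t = P1 t.
  by rewrite /P1 marginal_cons ?sz //; lia.
have key x y (t : j.-tuple I) :
    P3 x y t * (ln (P2 x t) + ln (P2 y t) - ln (P1 t)) <=
    P3 x y t * ln (P3 x y t) + P2 x t * P2 y t / P1 t - P3 x y t.
  have P3p : 0 < P3 x y t -> [/\ 0 < P2 x t, 0 < P2 y t & 0 < P1 t].
    move=> h; have h2 : 0 < P2 y t by apply: (marginal_gt0 _ h); rewrite /= sz.
    have h1 : 0 < P1 t by apply: (marginal_gt0 _ h2); rewrite sz; lia.
    split=> //; rewrite -P3y (bigD1 y) //=.
    by rewrite ltr_pwDl // sumr_ge0 // => z _; exact: marginal_ge0.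
  have := marginal_ge0 (x :: y :: t); rewrite -/(P3 x y t).
  rewrite le_eqVlt => /predU1P[<-|p3].
    by rewrite !mul0r add0r subr0 divr_ge0 ?mulr_ge0 ?marginal_ge0.
  have [px py p1] := P3p p3.
  rewrite -lnM ?posrE // -ln_div ?posrE ?mulr_gt0 //.
  apply: mul_ln_le => //; first exact: ltW.
    by rewrite divr_ge0 ?mulr_ge0 ?marginal_ge0.
  by move=> _; rewrite divr_gt0 // mulr_gt0.
have : \sum_(t : j.-tuple I) \sum_x \sum_y
    P3 x y t * (ln (P2 x t) + ln (P2 y t) - ln (P1 t)) <=
    \sum_(t : j.-tuple I) \sum_x \sum_y
  (P3 x y t * ln (P3 x y t) + P2 x t * P2 y t / P1 t - P3 x y t).
  apply: ler_sum => t _; apply: ler_sum => x _; apply: ler_sum => y _; exact: key.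
have -> : \sum_(t : j.-tuple I) \sum_x \sum_y
    P3 x y t * (ln (P2 x t) + ln (P2 y t) - ln (P1 t)) =
    - (marginal_entropy j.+1 *+ 2 - marginal_entropy j).
  have e1 : marginal_entropy j.+1 = - \sum_(t : j.-tuple I) \sum_x P2 x t * ln (P2 x t).
    rewrite /marginal_entropy (big_tupleS _ (fun t => marginal t * ln (marginal t))).
    by rewrite exchange_big.
  have -> : marginal_entropy j = - \sum_(t : j.-tuple I) P1 t * ln (P1 t) by [].
  rewrite e1 mulNrn opprB opprK addrC mulr2n -!big_split /= -sumrN -big_split /=.
  apply: eq_bigr => t _.
  transitivity (\sum_x \sum_y P3 x y t * ln (P2 x t) +
     \sum_x \sum_y P3 x y t * ln (P2 y t) - \sum_x \sum_y P3 x y t * ln (P1 t)).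
    rewrite -big_split /= -sumrB; apply: eq_bigr => x _.
    rewrite -big_split /= -sumrB; apply: eq_bigr => y _; ring.
  congr (_ + _ - _).
  - by apply: eq_bigr => x _; rewrite -mulr_suml P3y.
  - by rewrite exchange_big; apply: eq_bigr => y _; rewrite -mulr_suml P3x.
  - rewrite -P2x mulr_suml; apply: eq_bigr => x _.
    by rewrite -mulr_suml P3y.
have -> : \sum_(t : j.-tuple I) \sum_x \sum_y
  (P3 x y t * ln (P3 x y t) + P2 x t * P2 y t / P1 t - P3 x y t) =
  - marginal_entropy j.+2 + 1 - 1.
  have e3 : \sum_(t : j.-tuple I) \sum_x \sum_y P3 x y t * ln (P3 x y t) = - marginal_entropy j.+2.
    rewrite /marginal_entropy opprK (big_tupleS _ (fun t => marginal t * ln (marginal t))).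
    rewrite exchange_big; apply: eq_bigr => x _ /=.
    rewrite (big_tupleS _ (fun t => marginal (x :: t) * ln (marginal (x :: t)))).
    by rewrite exchange_big.
  have e2 : \sum_(t : j.-tuple I) \sum_x \sum_y P2 x t * P2 y t / P1 t = 1.
    rewrite -(@marginal_sum j); last by lia.
    apply: eq_bigr => t _; rewrite -/(P1 t).
    transitivity ((\sum_x P2 x t) * (\sum_y P2 y t) / P1 t).
      rewrite mulr_suml mulr_suml; apply: eq_bigr => x _.
      by rewrite mulr_sumr mulr_suml.
    rewrite !P2x; have [->|p1] := eqVneq (P1 t) 0; first by rewrite !mul0r.
    by rewrite mulfK.
  have e0 : \sum_(t : j.-tuple I) \sum_x \sum_y P3 x y t = 1.
    rewrite -(@marginal_sum j); last by lia.
    apply: eq_bigr => t _; rewrite -/(P1 t) -P2x; apply: eq_bigr => x _.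
    exact: P3y.
  rewrite -[X in _ - X]e0 -[X in _ + X - _]e2 -e3 -big_split -sumrB /=.
  apply: eq_bigr => t _; rewrite -big_split -sumrB /=.
  by apply: eq_bigr => x _; rewrite -big_split -sumrB /=.
lra.
Qed.

(** The inequality of Han: a concave sequence that vanishes at 0 has nonincreasing
    slopes from the origin. *)
Lemma entropy_han k : (0 < k <= m)%N ->
  k%:R * marginal_entropy m <= m%:R * marginal_entropy k.
Proof.
move=> /andP[k0 km].
have step j : (j < m)%N ->
   j%:R * marginal_entropy j.+1 <= j.+1%:R * marginal_entropy j.
  elim: j => [|j IH] jm; first by rewrite mul0r mul1r entropy0.
  have {}IH := IH (ltnW jm); have c := entropy_concave jm.
  have j0 : (0 : R) < j.+1%:R by rewrite ltr0n.
  have := ler_wpM2l (ltW j0) c.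
  move: IH; rewrite -[j.+2]addn1 -[j.+1]addn1 !natrD; move=> IH.
  rewrite mulr2n; lra.
have h l : (k + l <= m)%N ->
    k%:R * marginal_entropy (k + l) <= (k + l)%:R * marginal_entropy k.
  elim: l => [|l IH] hl; first by rewrite addn0.
  have kl : (k + l < m)%N by rewrite -addnS.
  have j0 : (0 : R) < (k + l)%:R by rewrite ltr0n addn_gt0 k0.
  rewrite addnS -(ler_pM2l j0); apply: (@le_trans _ _ (k%:R * ((k + l).+1%:R * marginal_entropy (k + l)))).
    by rewrite mulrCA ler_wpM2l ?ler0n // step.
  rewrite mulrCA [leRHS]mulrCA ler_wpM2l ?ler0n // IH //; exact: ltnW.
by rewrite -(subnKC km) h // subnKC.
Qed.

End Marginals.
End Entropy.

(** * A mixed norm inequality of Blei for symmetric families *)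

Section Blei.
Variable R : realType.

Lemma ler_powR_ln (x y u v : R) : 0 < x -> 0 < y -> u * ln x <= v * ln y -> x `^ u <= y `^ v.
Proof.
by move=> x0 y0 h; rewrite -ler_ln ?posrE ?powR_gt0 // !ln_powR.
Qed.

Lemma sumr_gt0P (T : finType) (F : T -> R) : (forall i, 0 <= F i) ->
  reflect (exists i, 0 < F i) (0 < \sum_i F i).
Proof.
move=> F0; rewrite lt0r sumr_ge0 // andbT psumr_neq0 //; apply: (iffP hasP).
  by move=> [i _ /= h]; exists i.
by move=> [i h]; exists i; rewrite ?mem_index_enum.
Qed.

(** Let pi be the law on m-tuples proportional to a^q, with q = 2m/(m+1), and let
    Hj be the entropy of its marginal on j entries.  Then Hm = ln Z - q E(ln a).
    Gibbs' inequality bounds Hm - Hk from above by comparing the conditional law of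
    the last l entries to a^2, and -Hk from below by comparing the marginal to
    A^{k/(k+1)}, where A is the inner sum of squares.  Eliminating E(ln A), the
    terms in Hk and Hm combine with the right sign by the inequality of Han. *)
Lemma symmetric_mixed_norm_le (I : finType) k l (a : seq I -> R) :
  (0 < k)%N -> (forall s, 0 <= a s) ->
  (forall s t, perm_eq s t -> a s = a t) ->
  (\sum_(s : (k + l).-tuple I) a s `^ ((2 * (k + l))%:R / (k + l).+1%:R))
     `^ ((k + l).+1%:R / (2 * (k + l))%:R) <=
  (\sum_(t : k.-tuple I) (\sum_(r : l.-tuple I) a (t ++ r) ^+ 2)
     `^ (k%:R / k.+1%:R)) `^ (k.+1%:R / (2 * k)%:R).
Proof.
move=> k0 a0 asym; set m := (k + l)%N.
have m0 : (0 < m)%N by rewrite /m; lia.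
have kR : (0 : R) < k%:R by rewrite ltr0n.
have mR : (0 : R) < m%:R by rewrite ltr0n.
have k1R : (0 : R) < k.+1%:R by rewrite ltr0n.
have m1R : (0 : R) < m.+1%:R by rewrite ltr0n.
set q := (2 * m)%:R / m.+1%:R; set th := k%:R / k.+1%:R.
have q0 : 0 < q by rewrite divr_gt0 // natrM mulr_gt0.
set Z := \sum_s _; set Y := \sum_(t : k.-tuple I) _.
have Z0 : 0 <= Z by apply: sumr_ge0 => s _; exact: powR_ge0.
move: Z0; rewrite le_eqVlt => /predU1P[<-|Zp].
  by rewrite powR0 ?powR_ge0 // mulf_neq0 ?invr_eq0 ?pnatr_eq0 ?muln_eq0 -?lt0n.
pose pi (s : seq I) := a s `^ q / Z.
have pi0 s : 0 <= pi s by rewrite divr_ge0 ?powR_ge0 // ltW.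
have pisym s t : perm_eq s t -> pi s = pi t by move=> /asym st; rewrite /pi st.
have pi1 : \sum_(s : m.-tuple I) pi s = 1 by rewrite -mulr_suml divff // gt_eqF.
have pia s : 0 < pi s -> 0 < a s.
  rewrite /pi => h; rewrite lt0r a0 andbT; apply: contraTneq h => ->.
  by rewrite powR0 ?gt_eqF // mul0r ltxx.
have lnpi s : pi s * ln (pi s) = pi s * (q * ln (a s) - ln Z).
  have := pi0 s; rewrite le_eqVlt => /predU1P[<-|p]; first by rewrite !mul0r.
  by rewrite {2}/pi ln_div ?posrE ?ln_powR // powR_gt0 // pia.
pose mk := marginal m pi.
have mkE (t : k.-tuple I) : mk t = \sum_(r : l.-tuple I) pi (t ++ r) by apply: marginal_cat.
pose A (t : seq I) := \sum_(r : l.-tuple I) a (t ++ r) ^+ 2.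
have A0 t : 0 <= A t by apply: sumr_ge0 => r _; exact: sqr_ge0.
have mk0 t : 0 <= mk t by apply: marginal_ge0.
have mkA (t : k.-tuple I) : 0 < mk t -> 0 < A t.
  rewrite mkE => /sumr_gt0P[//|r pr].
  apply/sumr_gt0P => [r'|]; first exact: sqr_ge0.
  by exists r; rewrite exprn_gt0 // pia.
have mk1 : \sum_(t : k.-tuple I) mk t = 1 by apply: marginal_sum => //; rewrite leq_addr.
have Yp : 0 < Y.
  have : 0 < \sum_(t : k.-tuple I) mk t by rewrite mk1.
  move=> /sumr_gt0P[//|t pt].
  apply/sumr_gt0P => [t'|]; first exact: powR_ge0.
  by exists t; rewrite powR_gt0 // mkA.
pose Hk := marginal_entropy m pi k; pose Hm := marginal_entropy m pi m.
have HkE : Hk = - \sum_(t : k.-tuple I) mk t * ln (mk t) by [].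
have HmE : Hm = - \sum_(s : m.-tuple I) pi s * ln (pi s).
  by congr (- _); apply: eq_bigr => s _; rewrite marginal_full.
pose Ea := \sum_(s : m.-tuple I) pi s * ln (a s).
pose EA := \sum_(t : k.-tuple I) mk t * ln (A t).
have Hma : Hm = ln Z - q * Ea.
  rewrite HmE /Ea mulr_sumr -[ln Z]mul1r -pi1 mulr_suml -sumrB -sumrN.
  by apply: eq_bigr => s _; rewrite lnpi; ring.
(* The marginal against the law proportional to A^th, whose mass is Y. *)
have gibbs2 : th * EA - ln Y <= - Hk.
  have : \sum_(t : k.-tuple I) mk t * ln (A t `^ th / Y) <=
    \sum_(t : k.-tuple I) (mk t * ln (mk t) + A t `^ th / Y - mk t).
    apply: ler_sum => t _; apply: mul_ln_le => //; first by rewrite divr_ge0 ?powR_ge0 ?ltW.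
    by move=> /mkA At; rewrite divr_gt0 ?powR_gt0.
  rewrite sumrB big_split /= mk1 -mulr_suml divff ?gt_eqF // addrK HkE opprK.
  have -> : \sum_(t : k.-tuple I) mk t * ln (A t `^ th / Y) = th * EA - ln Y.
    rewrite /EA mulr_sumr -[ln Y]mul1r -mk1 mulr_suml -sumrB; apply: eq_bigr => t _.
    have := mk0 t; rewrite le_eqVlt => /predU1P[<-|p]; first by rewrite !mul0r mulr0 subr0.
    by rewrite ln_div ?posrE ?ln_powR ?powR_gt0 ?mkA //; ring.
  by [].
(* The law against the marginal times the conditional law a^2 / A. *)
have gibbs1 : - Hk + 2 * Ea - EA <= - Hm.
  have EaE : Ea = \sum_(t : k.-tuple I) \sum_(r : l.-tuple I) pi (t ++ r) * ln (a (t ++ r)).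
    by rewrite /Ea (big_tuple_cat k l (fun s => pi s * ln (a s))).
  have HmE' : - Hm = \sum_(t : k.-tuple I) \sum_(r : l.-tuple I) pi (t ++ r) * ln (pi (t ++ r)).
    by rewrite HmE opprK (big_tuple_cat k l (fun s => pi s * ln (pi s))).
  rewrite HmE' HkE opprK EaE /EA mulr_sumr -big_split -sumrB /=; apply: ler_sum => t _.
  have := mk0 t; rewrite le_eqVlt => /predU1P[mt0|p].
    have pz (r : l.-tuple I) : pi (t ++ r) = 0.
      move: mt0; rewrite mkE => /esym/psumr_eq0P h; apply: h => //.
    rewrite -mt0 !mul0r add0r subr0.
    rewrite !big1 ?mulr0 // => r _; by rewrite pz mul0r.
  have Atp := mkA t p.
  have : \sum_(r : l.-tuple I) pi (t ++ r) * ln (mk t * a (t ++ r) ^+ 2 / A t) <=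
    \sum_(r : l.-tuple I) (pi (t ++ r) * ln (pi (t ++ r)) + mk t * a (t ++ r) ^+ 2 / A t - pi (t ++ r)).
    apply: ler_sum => r _; apply: mul_ln_le => //.
      by rewrite divr_ge0 // mulr_ge0 ?sqr_ge0.
    by move=> /pia h; rewrite divr_gt0 ?mulr_gt0 ?exprn_gt0.
  rewrite sumrB big_split /= -mulr_suml -mulr_sumr -/(A t) mulfK ?gt_eqF //.
  rewrite -mkE addrK; apply: le_trans; rewrite le_eqVlt; apply/orP; left; apply/eqP.
  rewrite {1}mkE {2}mkE mulr_sumr !mulr_suml -big_split -sumrB /=.
  apply: eq_bigr => r _.
  have := pi0 (t ++ r); rewrite le_eqVlt => /predU1P[<-|/pia pr]; first by rewrite !mul0r mulr0; ring.
  by rewrite ln_div ?posrE ?mulr_gt0 ?exprn_gt0 // lnM ?posrE ?exprn_gt0 // lnXn //; ring.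
have han : k%:R * Hm <= m%:R * Hk.
  by apply: entropy_han => //; rewrite k0 leq_addr.
have th0 : 0 < th by rewrite divr_gt0.
apply: ler_powR_ln => //.
(* In logarithms the inequality reads th * ln Z * (m+1)/m <= ln Y. *)
have goal : th * ln Z * (m.+1%:R / m%:R) <= ln Y.
  have h1 : th * (- Hk + 2 * Ea - EA) <= th * - Hm by rewrite ler_pM2l.
  have Eae : 2 * Ea = (ln Z - Hm) * (m.+1%:R / m%:R).
    rewrite Hma opprB addrCA subrr addr0 /q natrM; field.
    by rewrite !gt_eqF.
  have h2 : th * (Hm / m%:R) <= (1 - th) * Hk.
    have -> : 1 - th = k.+1%:R^-1.
      by rewrite /th -natr1; field; rewrite natr1 gt_eqF.
    rewrite /th -(ler_pM2l k1R) -(ler_pM2l mR).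
    have -> : m%:R * (k.+1%:R * (k%:R / k.+1%:R * (Hm / m%:R))) = k%:R * Hm.
      by field; rewrite !gt_eqF.
    have -> // : m%:R * (k.+1%:R * (k.+1%:R^-1 * Hk)) = m%:R * Hk.
    by field; rewrite gt_eqF.
  move: h1; rewrite Eae.
  have -> : m.+1%:R / m%:R = 1 + 1 / m%:R :> R by rewrite -natr1; field; rewrite gt_eqF.
  move=> h1; nra.
rewrite [in leLHS]natrM natrM; rewrite -(ler_pM2l (_ : 0 < 2 * th)); last by rewrite mulr_gt0.
rewrite (_ : 2 * th * (_ / (2 * m%:R) * _) = th * ln Z * (m.+1%:R / m%:R)); last first.
  by field; rewrite gt_eqF.
rewrite (_ : 2 * th * _ = ln Y) // /th; field; rewrite !gt_eqF //.
Qed.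
End Blei.

(** * A cubic majorant of the logarithmic energy *)

Section LogBound.
Variable R : realType.

Let log_major (u : R) := u / 3 + 1 / 2 - u^-1 + (u ^+ 2)^-1 / 6.

(** The gap g(u) between log_major u and ln u satisfies g(s^2) >= 2 g(s), because
    log_major (s^2) - 2 log_major s has the factor (s - 1)^4.  A crude lower bound
    - c (u - 1)^2 / u of g follows from ln u <= u - 1, and (u - 1)^2 / u is at least
    multiplied by 4 when u is squared.  Applying the crude bound to the root of
    order 2^n of u thus improves it by a factor 2^n. *)
Lemma ln_le_log_major (u : R) : 0 < u -> ln u <= log_major u.
Proof.
have approx n : forall u, 0 < u ->
    log_major u - ln u >= - (2 / 3 * ((u - 1) ^+ 2 / u) / 2 ^+ n).
  elim: n => [|n IH] v v0.
    rewrite expr0 divr1; have := ln_le_sub1 v0.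
    suff : log_major v - (v - 1) + 2 / 3 * ((v - 1) ^+ 2 / v) >= 0 by lra.
    have -> : log_major v - (v - 1) + 2 / 3 * ((v - 1) ^+ 2 / v) = (v - 1) ^+ 2 / (6 * v ^+ 2).
      by rewrite /log_major; field; rewrite gt_eqF.
    by rewrite divr_ge0 ?sqr_ge0 // mulr_ge0 // sqr_ge0.
  set s := Num.sqrt v; have s0 : 0 < s by rewrite sqrtr_gt0.
  have vs : v = s ^+ 2 by rewrite sqr_sqrtr // ltW.
  have h := IH s s0; move: h.
  have -> : ln v = 2 * ln s by rewrite vs lnXn // mulr_natl.
  have c1 : log_major v - 2 * log_major s >= 0.
    have -> : log_major v - 2 * log_major s = (s - 1) ^+ 4 * (2 * s ^+ 2 + 4 * s + 1) / (6 * s ^+ 4).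
      by rewrite /log_major vs; field; rewrite gt_eqF.
    apply: divr_ge0; last by rewrite mulr_ge0 // exprn_ge0 // ltW.
    by apply: mulr_ge0; [exact: exprn_even_ge0|nra].
  have c2 : (v - 1) ^+ 2 / v - 4 * ((s - 1) ^+ 2 / s) >= 0.
    have -> : (v - 1) ^+ 2 / v - 4 * ((s - 1) ^+ 2 / s) = (s - 1) ^+ 4 / s ^+ 2.
      by rewrite vs; field; rewrite gt_eqF.
    by rewrite divr_ge0 ?sqr_ge0 ?exprn_even_ge0.
  have p0 : (0 : R) < (2 ^+ n)^-1 by rewrite invr_gt0 exprn_gt0.
  rewrite (exprS 2 n) invfM.
  move: c1 c2 p0; set X := (v - 1) ^+ 2 / v; set Y := (s - 1) ^+ 2 / s.
  set q := (2 ^+ n)^-1 => c1 c2 p0 h.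
  have : q * (X - 4 * Y) >= 0 by rewrite mulr_ge0 // ltW.
  move: h; rewrite -![2 / 3 * _ * _]mulrA; lra.
move=> u0; rewrite -subr_ge0 leNgt; apply/negP => h.
set E := 2 / 3 * ((u - 1) ^+ 2 / u).
have E0 : 0 <= E by rewrite mulr_ge0 // divr_ge0 ?sqr_ge0 ?(ltW u0).
set d := - (log_major u - ln u); have d0 : 0 < d by rewrite oppr_gt0.
have [n hn] : exists n : nat, E / d < n%:R by exists (Num.bound (E / d)); rewrite archi_boundP // divr_ge0 // ltW.
have := approx n u u0; rewrite -/E lerNl -/d => hd.
rewrite ler_pdivlMr ?exprn_gt0 // leNgt in hd; apply: (negP hd).
rewrite ltr_pdivrMr // mulrC in hn; apply: lt_le_trans hn _.
rewrite ler_pM2l // -natrX ler_nat ltnW //; exact: ltn_expl.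
Qed.

(** The cubic agrees with v^2 ln v^2 to third order at v = 1.  Degree three is what
    can be averaged over the circle at v = |h|^2 through Fourier coefficients. *)
Lemma sqr_ln_sqr_le (v : R) : 0 <= v ->
  v ^+ 2 * ln (v ^+ 2) <= 2 / 3 * v ^+ 3 + v ^+ 2 - 2 * v + 1 / 3.
Proof.
rewrite le_eqVlt => /predU1P[<-|v0]; first by rewrite !expr0n /=; lra.
have h := ln_le_log_major v0.
have -> : ln (v ^+ 2) = 2 * ln v by rewrite lnXn // mulr_natl.
have : v ^+ 2 * (2 * ln v) <= v ^+ 2 * (2 * log_major v).
  by rewrite ler_pM2l ?exprn_gt0 // ler_pM2l.
move=> /le_trans; apply; rewrite le_eqVlt; apply/orP; left; apply/eqP.
by rewrite /log_major; field; rewrite gt_eqF.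
Qed.

End LogBound.

(** * Means over roots of unity *)

Section Circle.
Variable R : realType.
Local Notation C := R[i].

Lemma mulcJ (z : C) : z * (conjc z) = (normc z ^+ 2)%:C.
Proof. by case: z => a b; simpc; rewrite sqr_sqrtr ?addr_ge0 ?sqr_ge0 //; congr (_ +i* _); ring. Qed.

Lemma normcJ_real (z : C) : normc (conjc z) = normc z.
Proof. by case: z => a b /=; rewrite sqrrN. Qed.

Lemma normc_ge0 (z : C) : 0 <= normc z.
Proof. by case: z => a b; exact: sqrtr_ge0. Qed.

Lemma normcX (z : C) n : normc (z ^+ n) = normc z ^+ n.
Proof. by elim: n => [|n IH]; rewrite ?normc1 // !exprS normcM IH. Qed.

Lemma normc_real (x : R) : 0 <= x -> normc x%:C = x.
Proof. by move=> x0; rewrite /= expr0n addr0 sqrtr_sqr ger0_norm. Qed.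

Lemma ReD (x y : C) : complex.Re (x + y) = complex.Re x + complex.Re y.
Proof. by case: x; case: y. Qed.

Lemma Re_sum (T : Type) (r : seq T) (P : pred T) (F : T -> C) :
  complex.Re (\sum_(i <- r | P i) F i) = \sum_(i <- r | P i) complex.Re (F i).
Proof. by apply: (big_morph _ ReD). Qed.

Lemma Re_le_normc (z : C) : complex.Re z <= normc z.
Proof.
case: z => a b /=; apply: le_trans (ler_norm a) _.
by rewrite -sqrtr_sqr ler_sqrt ?addr_ge0 ?sqr_ge0 // lerDl sqr_ge0.
Qed.

Lemma normc_sum (T : Type) (r : seq T) (P : pred T) (F : T -> C) :
  normc (\sum_(i <- r | P i) F i) <= \sum_(i <- r | P i) normc (F i).
Proof.
elim/big_rec2: _ => [|i y z _ h]; first by rewrite normc0.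
by apply: le_trans (le_normcD _ _) _; rewrite lerD2l.
Qed.

Lemma normc_prod (T : Type) (r : seq T) (P : pred T) (F : T -> C) :
  normc (\prod_(i <- r | P i) F i) = \prod_(i <- r | P i) normc (F i).
Proof. by apply: (big_morph _ _ (normc1 R)) => x y; exact: normcM. Qed.

Lemma exists_prim_root N : (0 < N)%N -> exists w : C, N.-primitive_root w.
Proof.
move=> N0; have [rs] := closed_field_poly_normal ('X^N - 1 : {poly C}).
rewrite (monicP (monicXnsubC 1 N0)) scale1r => fac.
have /hasP[w _ prim_w] : has N.-primitive_root rs; last by exists w.
apply: has_prim_root => //.
- by apply/allP=> w; rewrite /root_of_unity fac root_prod_XsubC.
- by rewrite -separable_prod_XsubC -fac separable_Xn_sub_1 // pnatr_eq0 -lt0n.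
- by rewrite -ltnS -(size_prod_XsubC rs id) -fac size_XnsubC.
Qed.

Section Points.
Variables (N : nat) (w : C).
Hypothesis prim_w : N.-primitive_root w.

Let N_gt0 : (0 < N)%N := prim_order_gt0 prim_w.

Lemma normc_prim_root : normc w = 1.
Proof.
apply/eqP; rewrite -(pexpr_eq1 N_gt0) ?normc_ge0 // -normcX (prim_expr_order prim_w).
by rewrite normc1.
Qed.

Lemma normc_circle_point (x : nat) : normc (w ^+ x) = 1.
Proof. by rewrite normcX normc_prim_root expr1n. Qed.

Lemma circle_point_mulJ x : w ^+ x * conjc (w ^+ x) = 1.
Proof. by rewrite mulcJ normc_circle_point expr1n. Qed.

Lemma circle_orthogonality i j : (i < N)%N -> (j < N)%N ->
  \sum_(x < N) (w ^+ x) ^+ i * conjc ((w ^+ x) ^+ j) = if i == j then N%:R else 0.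
Proof.
move=> iN jN.
have w0 : w != 0 by rewrite (prim_root_eq0 prim_w) -lt0n.
pose q := w ^+ i / w ^+ j.
have E (x : 'I_N) : (w ^+ x) ^+ i * conjc ((w ^+ x) ^+ j) = q ^+ x.
  have cj : conjc ((w ^+ x) ^+ j) = ((w ^+ x) ^+ j)^-1.
    have h := circle_point_mulJ (x * j); rewrite exprM in h.
    by rewrite -[LHS]mul1r -(mulVf (_ : (w ^+ x) ^+ j != 0)) ?expf_neq0 // -mulrA h mulr1.
  by rewrite cj /q expr_div_n -!exprM ![(x * _)%N]mulnC.
rewrite (eq_bigr _ (fun x _ => E x)); case: eqVneq => [ij|ij].
  rewrite /q ij; rewrite (eq_bigr (fun=> 1)); last first.
    by move=> x _; rewrite divff ?expf_neq0 // expr1n.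
  by rewrite sumr_const card_ord.
have qN : q ^+ N = 1.
  by rewrite /q expr_div_n -!exprM ![(_ * N)%N]mulnC !exprM (prim_expr_order prim_w) !expr1n divr1.
have q1 : q != 1.
  apply: contra ij => /eqP; rewrite /q => h.
  have : w ^+ i == w ^+ j by rewrite -(divfK (_ : w ^+ j != 0) (w ^+ i)) ?expf_neq0 // h mul1r.
  by rewrite (eq_prim_root_expr prim_w) !modn_small.
have := subrX1 q N; rewrite qN subrr => /esym/eqP.
by rewrite mulf_eq0 subr_eq0 (negPf q1) /= => /eqP.
Qed.

Lemma parseval_bilinear (f g : {poly C}) : (size f <= N)%N -> (size g <= N)%N ->
  \sum_(x < N) f.[w ^+ x] * conjc (g.[w ^+ x]) = N%:R * \sum_(i < N) f`_i * conjc (g`_i).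
Proof.
move=> sf sg.
transitivity (\sum_(i < N) \sum_(j < N) (f`_i * conjc (g`_j)) *
   \sum_(x < N) (w ^+ x) ^+ i * conjc ((w ^+ x) ^+ j)).
  rewrite (eq_bigr (fun x : 'I_N => \sum_(i < N) \sum_(j < N)
    (f`_i * conjc (g`_j)) * ((w ^+ x) ^+ i * conjc ((w ^+ x) ^+ j)))); last first.
    move=> x _; rewrite (horner_coef_wide _ sf) (horner_coef_wide _ sg) rmorph_sum mulr_suml.
    apply: eq_bigr => i _; rewrite mulr_sumr; apply: eq_bigr => j _.
    by rewrite rmorphM /=; ring.
  rewrite exchange_big; apply: eq_bigr => i _ /=.
  rewrite exchange_big; apply: eq_bigr => j _ /=.
  by rewrite mulr_sumr.
rewrite mulr_sumr; apply: eq_bigr => i _.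
rewrite (bigD1 i) //= circle_orthogonality // eqxx big1 ?addr0 1?mulrC // => j ji.
by rewrite circle_orthogonality // ifN ?mulr0 // eq_sym.
Qed.

(** Stands for the mean over the unit circle: w is a primitive N-th root of unity,
    and the mean of z^n is exact for |n| < N. *)
Definition circle_mean (F : C -> R) := N%:R^-1 * \sum_(x < N) F (w ^+ x).

Lemma eq_circle_mean (F G : C -> R) : (forall z, normc z = 1 -> F z = G z) ->
  circle_mean F = circle_mean G.
Proof.
by move=> FG; congr (_ * _); apply: eq_bigr => x _; rewrite FG ?normc_circle_point.
Qed.

Lemma ler_circle_mean (F G : C -> R) : (forall z, normc z = 1 -> F z <= G z) ->
  circle_mean F <= circle_mean G.
Proof.
move=> FG; rewrite ler_wpM2l ?invr_ge0 ?ler0n //.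
by apply: ler_sum => x _; rewrite FG ?normc_circle_point.
Qed.

Lemma circle_meanD F G : circle_mean (fun z => F z + G z) = circle_mean F + circle_mean G.
Proof. by rewrite /circle_mean big_split mulrDr. Qed.

Lemma circle_meanZ a F : circle_mean (fun z => a * F z) = a * circle_mean F.
Proof. by rewrite /circle_mean -mulr_sumr mulrCA. Qed.

Lemma circle_mean_cst a : circle_mean (fun=> a) = a.
Proof.
by rewrite /circle_mean sumr_const card_ord -[a *+ N]mulr_natl mulKf // pnatr_eq0 -lt0n.
Qed.

Lemma circle_mean_Re_bilinear (f g : {poly C}) : (size f <= N)%N -> (size g <= N)%N ->
  circle_mean (fun z => complex.Re (f.[z] * conjc (g.[z]))) =
  \sum_(i < N) complex.Re (f`_i * conjc (g`_i)).
Proof.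
move=> sf sg; rewrite /circle_mean -!Re_sum parseval_bilinear //.
case: (\sum_(i < N) _) => a b /=.
have -> : (N%:R : C) = N%:R%:C by rewrite rmorph_nat.
by rewrite /= mul0r subr0 mulKf // pnatr_eq0 -lt0n.
Qed.

Lemma circle_mean_Re (f : {poly C}) : (size f <= N)%N ->
  circle_mean (fun z => complex.Re f.[z]) = complex.Re f`_0.
Proof.
move=> sf; have s1 : (size (1%:P : {poly C}) <= N)%N by rewrite size_polyC oner_eq0.
have := circle_mean_Re_bilinear sf s1.
rewrite (eq_circle_mean (G := fun z => complex.Re f.[z])); last first.
  by move=> z _; rewrite hornerC conjc1 mulr1.
move=> ->; have := N_gt0; case: (N) => // n _.
rewrite big_ord_recl big1 ?addr0 => [|i _]; first by rewrite coefC eqxx conjc1 mulr1.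
by rewrite coefC (_ : (lift ord0 i == 0 :> nat) = false) // conjc0 mulr0.
Qed.

Lemma parseval (f : {poly C}) : (size f <= N)%N ->
  circle_mean (fun z => normc f.[z] ^+ 2) = \sum_(i < N) normc f`_i ^+ 2.
Proof.
move=> sf; transitivity (\sum_(i < N) complex.Re (f`_i * conjc (f`_i))).
  by rewrite -circle_mean_Re_bilinear //; apply: eq_circle_mean => z _; rewrite mulcJ.
by apply: eq_bigr => i _; rewrite mulcJ.
Qed.

End Points.
End Circle.

(** * Fourier energy of the modulus of a square *)

(** The two factors of each term couple only through the common value of f x and
    g y, so that fixing this value separates the double sum. *)
Lemma big_fiber_product (A : comPzRingType) (T : finType) (S : nat)
    (f g : T -> nat) (a b : T -> A) (c : nat -> nat) :
  (forall x, f x < S)%N ->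
  \sum_x \sum_y ((f x == g y) * c (f x))%:R * (a x * b y) =
  \sum_(s < S) (c s)%:R *
    ((\sum_(x | f x == s) a x) * (\sum_(y | g y == s) b y)).
Proof.
move=> fS; rewrite (partition_big (fun x => Ordinal (fS x)) xpredT) //=.
apply: eq_bigr => s _; rewrite mulr_suml mulr_sumr; apply: eq_big => [x|x].
  by rewrite -val_eqE.
rewrite -val_eqE /= => /eqP ->; rewrite [X in _ = X]mulrA.
rewrite [in RHS]big_mkcond /= mulr_sumr; apply: eq_bigr => y _.
rewrite (eq_sym (nat_of_ord s)); case: eqP => _; first by rewrite mul1n; ring.
by rewrite mul0n mul0r mulr0.
Qed.

Section QuarticForm.
Variable R : realType.
Local Notation C := R[i].
Variables (K : nat) (h : nat -> C).
Local Notation T := ('I_K * 'I_K)%type.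

(** The coefficients of h^2 for the polynomial h = \sum_(i < K) h_i X^i. *)
Definition square_coef (s : nat) : C := \sum_(p : T | (p.1 + p.2)%N == s) h p.1 * h p.2.

(** For 0 < n, the n-th Fourier coefficient of |h|^2 on the circle.  At n = 0 the
    truncated subtraction collects all the pairs with p.1 <= p.2 instead; this
    value always comes with the weight 0 below. *)
Definition autocorrelation (n : nat) : C :=
  \sum_(p : T | (p.1 - p.2)%N == n) h p.1 * conjc (h p.2).

(* The quartic forms in h that are supported on i + j = k + l, with weights c;
   both energies are of this kind. *)
Let quad (c : nat -> nat -> nat -> nat -> nat) : C :=
  \sum_(p : T) \sum_(q : T)
   (((p.1 + p.2)%N == (q.1 + q.2)%N) * c p.1 p.2 q.1 q.2)%:R *
     (h p.1 * h p.2 * conjc (h q.1 * h q.2)).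

Let quad4 c : quad c = \sum_(i < K) \sum_(j < K) \sum_(k < K) \sum_(l < K)
   (((i + j)%N == (k + l)%N) * c i j k l)%:R *
     (h i * h j * conjc (h k * h l)).
Proof.
rewrite [RHS]pair_bigA; apply: eq_bigr => p _.
by rewrite [RHS]pair_bigA.
Qed.

Let quad_eq c c' :
  (forall i j k l, (i < K)%N -> (i + j = k + l)%N -> c i j k l = c' i j k l) -> quad c = quad c'.
Proof.
move=> cc; apply: eq_bigr => p _; apply: eq_bigr => q _; congr (_ * _); congr (_%:R).
by case: eqP => e; rewrite ?mul0n // (cc _ _ _ _ (ltn_ord _) e).
Qed.

Let quadD c c' : quad (fun i j k l => c i j k l + c' i j k l)%N = quad c + quad c'.
Proof.
rewrite -big_split; apply: eq_bigr => p _; rewrite -big_split; apply: eq_bigr => q _ /=.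
by rewrite mulnDr natrD mulrDl.
Qed.

Let quad_sum (I : finType) (c : I -> nat -> nat -> nat -> nat -> nat) :
  quad (fun i j k l => \sum_t c t i j k l)%N = \sum_t quad (c t).
Proof.
rewrite exchange_big; apply: eq_bigr => p _; rewrite exchange_big; apply: eq_bigr => q _ /=.
by rewrite big_distrr /= natr_sum mulr_suml.
Qed.

Let quad_degree : quad (fun i j _ _ => i + j)%N =
  \sum_(s < K + K) s%:R * (square_coef s * conjc (square_coef s)).
Proof.
have b (p : T) : (p.1 + p.2 < K + K)%N by have := ltn_ord p.1; have := ltn_ord p.2; lia.
apply: (etrans (@big_fiber_product _ _ (K + K) (fun p : T => p.1 + p.2)%N (fun p : T => p.1 + p.2)%N
  (fun p => h p.1 * h p.2) (fun p => conjc (h p.1 * h p.2)) id b)).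
by apply: eq_bigr => s _; rewrite [conjc (square_coef _)]rmorph_sum.
Qed.

Let quad_dist : quad (fun i j k l => (i - k) + (k - i))%N =
  2%:R * \sum_(n < K) n%:R * (autocorrelation n * conjc (autocorrelation n)).
Proof.
have b (p : T) : (p.1 - p.2 < K)%N by have := ltn_ord p.1; lia.
have b' (p : T) : (p.2 - p.1 < K)%N by have := ltn_ord p.2; lia.
rewrite quad4.
transitivity (\sum_(p : T) \sum_(q : T)
    (((p.1 - p.2)%N == (q.2 - q.1)%N) * (p.1 - p.2))%:R * ((h p.1 * conjc (h p.2)) * (h q.1 * conjc (h q.2)))
  + \sum_(p : T) \sum_(q : T)
    (((p.2 - p.1)%N == (q.1 - q.2)%N) * (p.2 - p.1))%:R * ((h p.1 * conjc (h p.2)) * (h q.1 * conjc (h q.2)))).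
  transitivity (\sum_(i < K) \sum_(k < K) \sum_(l < K) \sum_(j < K)
   (((i + j)%N == (k + l)%N) * ((i - k) + (k - i)))%:R *
     (h i * h j * conjc (h k * h l))).
    apply: eq_bigr => i _; rewrite exchange_big; apply: eq_bigr => k _.
    exact: exchange_big.
  rewrite -big_split [LHS]pair_bigA /=; apply: eq_bigr => -[i k] _ /=.
  rewrite -big_split exchange_big [LHS]pair_bigA /=; apply: eq_bigr => -[j l] _ /=.
  have -> : (((i + j)%N == (k + l)%N) * ((i - k) + (k - i)) =
      ((i - k)%N == (l - j)%N) * (i - k) + ((k - i)%N == (j - l)%N) * (k - i))%N.
    by do 3 case: eqP; lia.
  rewrite natrD rmorphM /= mulrDl; congr (_ * _ + _ * _); ring.
apply: (etrans (congr2 +%R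
  (@big_fiber_product _ _ K (fun p : T => p.1 - p.2)%N (fun p : T => p.2 - p.1)%N
    (fun p => h p.1 * conjc (h p.2)) (fun p => h p.1 * conjc (h p.2)) id b)
  (@big_fiber_product _ _ K (fun p : T => p.2 - p.1)%N (fun p : T => p.1 - p.2)%N
    (fun p => h p.1 * conjc (h p.2)) (fun p => h p.1 * conjc (h p.2)) id b'))).
have cE n : \sum_(p : T | (p.2 - p.1)%N == n) h p.1 * conjc (h p.2) = conjc (autocorrelation n).
  have swap_inj : injective (fun p : T => (p.2, p.1)) by move=> [? ?] [? ?] [-> ->].
  rewrite rmorph_sum /= (reindex_inj swap_inj) /=.
  by apply: eq_bigr => p _; rewrite rmorphM /= conjcK mulrC.
rewrite -big_split /= mulr_sumr; apply: eq_bigr => n _.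
rewrite cE -/(autocorrelation n); ring.
Qed.

Let quad_dist' : quad (fun i j k l => (i - l) + (l - i))%N =
  2%:R * \sum_(n < K) n%:R * (autocorrelation n * conjc (autocorrelation n)).
Proof.
rewrite -quad_dist !quad4; apply: eq_bigr => i _; apply: eq_bigr => j _.
rewrite exchange_big; apply: eq_bigr => k _; apply: eq_bigr => l _.
by rewrite (addnC l k) (mulrC (h l)).
Qed.

Let quad_tail (t : nat) :
  0 <= quad (fun i j k l => [&& t < i, t < j, t < k & t < l] : nat)%N.
Proof.
have b (p : T) : (p.1 + p.2 < K + K)%N by have := ltn_ord p.1; have := ltn_ord p.2; lia.
pose g i := if (t < i)%N then h i else 0.
have -> : quad (fun i j k l => [&& t < i, t < j, t < k & t < l] : nat)%N =
  \sum_(p : T) \sum_(q : T) (((p.1 + p.2)%N == (q.1 + q.2)%N) * 1)%:R * ((g p.1 * g p.2) * conjc (g q.1 * g q.2)).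
  apply: eq_bigr => p _; apply: eq_bigr => q _; rewrite /g muln1 natrM -mulrA; congr (_ * _).
  by do 4 case: ltnP => _; rewrite ?andbF ?mul0r ?mulr0 ?conjc0 ?mulr0 ?mul0r ?mul1r.
have -> := @big_fiber_product _ _ (K + K) (fun p : T => p.1 + p.2)%N (fun p : T => p.1 + p.2)%N
  (fun p => g p.1 * g p.2) (fun p => conjc (g p.1 * g p.2)) (fun=> 1%N) b.
apply: sumr_ge0 => s _; rewrite mul1r -[X in _ * X](rmorph_sum (@conjc R)) /=.
by rewrite mulcJ_ge0.
Qed.

(** Both sides are quartic forms in h over the indices with i + j = k + l.  The
    right side has weight i + j; expanding |ac_n|^2, half of the left side has weight
    |i - k| and the other half |i - l|.  There
    i + j - |i - k| - |i - l| = 2 min(i, j, k, l),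
    and this minimum is the sum over t of the indicators that all four indices
    exceed t.  Each indicator gives the sum of squares of the coefficients of the
    square of the tail of h. *)
Lemma autocorrelation_le_square :
  4 * (\sum_(n < K) n%:R * normc (autocorrelation n) ^+ 2) <=
  \sum_(s < K + K) s%:R * normc (square_coef s) ^+ 2.
Proof.
rewrite -lecR rmorphM !rmorph_sum /=.
rewrite (eq_bigr (fun n : 'I_K => n%:R * (autocorrelation n * conjc (autocorrelation n)))); last first.
  by move=> n _; rewrite rmorphM /= -mulcJ rmorph_nat.
rewrite [leRHS](eq_bigr (fun s : 'I_(K + K) => s%:R * (square_coef s * conjc (square_coef s)))); last first.
  by move=> n _; rewrite rmorphM /= -mulcJ rmorph_nat.
rewrite -quad_degree.
have -> : quad (fun i j _ _ => i + j)%N = quad (fun i j k l =>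
   (((i - k) + (k - i)) + ((i - l) + (l - i))) +
    (\sum_(t < K) ([&& t < i, t < j, t < k & t < l] : nat) +
     \sum_(t < K) ([&& t < i, t < j, t < k & t < l] : nat)))%N.
  apply: quad_eq => i j k l iK e.
  have -> : (\sum_(t < K) ([&& t < i, t < j, t < k & t < l] : nat) = minn i (minn j (minn k l)))%N.
    rewrite -(big_mkord xpredT (fun t => [&& t < i, t < j, t < k & t < l] : nat)%N).
    rewrite (@big_cat_nat _ _ _ (minn i (minn j (minn k l)))) //=; last by lia.
    rewrite big_nat (eq_bigr (fun=> 1%N)); last by move=> t; lia.
    rewrite -big_nat sum_nat_const_nat muln1 subn0 big_nat big1 ?addn0 // => t.
    by move=> ?; apply/eqP; rewrite eqb0; lia.
  lia.
have dec c1 c2 c3 : quad (fun i j k l => (c1 i j k l + c2 i j k l) + (c3 i j k l + c3 i j k l))%N =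
    quad c1 + quad c2 + (quad c3 + quad c3).
  exact: etrans (quadD _ _) (congr2 +%R (quadD _ _) (quadD _ _)).
rewrite (dec (fun i j k l => (i - k) + (k - i))%N (fun i j k l => (i - l) + (l - i))%N
  (fun i j k l => \sum_(t < K) ([&& t < i, t < j, t < k & t < l] : nat))%N).
have -> : quad (fun i j k l => \sum_(t < K) ([&& t < i, t < j, t < k & t < l] : nat))%N =
    \sum_(t < K) quad (fun i j k l => [&& t < i, t < j, t < k & t < l] : nat)%N.
  exact: (quad_sum (fun t : 'I_K => fun i j k l => [&& t < i, t < j, t < k & t < l] : nat)%N).
rewrite quad_dist quad_dist'.
have : 0 <= \sum_(t < K) quad (fun i j k l => [&& t < i, t < j, t < k & t < l] : nat)%N.
  by apply: sumr_ge0 => t _; exact: quad_tail.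
set S := \sum_(t < K) _; set U := \sum_(n < K) _ => S0.
have -> : (4 : R)%:C = 2%:R + 2%:R :> C by rewrite -natrD -(rmorph_nat (real_complex R)).
by rewrite -subr_ge0 (_ : _ - _ = S + S) ?addr_ge0 //; ring.
Qed.

End QuarticForm.

(** * The logarithmic Sobolev inequality for squares *)

Section SquareLSI.
Variable R : realType.
Local Notation C := R[i].

Definition xlnx (y : R) := y * ln y.

Section FixedPoly.
Variables (K : nat) (h : {poly C}).
Hypothesis sh : (size h <= K)%N.

(* On the circle, |h|^2 = mu + 2 Re X, where X has no constant term. *)
Let ac := autocorrelation K (fun i => h`_i).
Let X : {poly C} := \poly_(n < K) (if n == 0%N then 0 else ac n).
Let mu := \sum_(i < K) normc h`_i ^+ 2.

Lemma autocorrelation_polyP (z : C) : normc z = 1 ->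
  normc h.[z] ^+ 2 = mu + 2 * complex.Re X.[z].
Proof.
move=> z1; pose T (p : 'I_K * 'I_K) : C := h`_p.1 * conjc h`_p.2 * (z ^+ p.1 * conjc (z ^+ p.2)).
have zz n : z ^+ n * conjc (z ^+ n) = 1 by rewrite mulcJ normcX z1 !expr1n.
have E : normc h.[z] ^+ 2 = \sum_p complex.Re (T p).
  rewrite -Re_sum -[LHS]/(complex.Re (normc h.[z] ^+ 2)%:C) -mulcJ; congr complex.Re.
  transitivity (\sum_(i < K) \sum_(k < K) T (i, k)); last first.
    by rewrite pair_bigA; apply: eq_bigr => -[].
  rewrite (horner_coef_wide _ sh) rmorph_sum mulr_suml; apply: eq_bigr => i _.
  rewrite mulr_sumr; apply: eq_bigr => k _; rewrite rmorphM /T /=; ring.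
have XE : X.[z] = \sum_(p : 'I_K * 'I_K | (p.2 < p.1)%N) T p.
  have b (p : 'I_K * 'I_K) : (p.1 - p.2 < K)%N by have := ltn_ord p.1; lia.
  rewrite horner_poly (partition_big (fun p => Ordinal (b p)) xpredT) //=.
  apply: eq_bigr => n _; case: eqVneq => n0.
    rewrite mul0r big1 // => p; rewrite -val_eqE /= n0; lia.
  rewrite mulr_suml; apply: eq_big => p; first by rewrite -val_eqE /=; lia.
  move=> /eqP pn; rewrite /T; congr (_ * _).
  have -> : (p.1 = n + p.2 :> nat)%N by move: n0; rewrite -pn /=; lia.
  by rewrite exprD -mulrA zz mulr1.
have swap_inj : injective (fun p : 'I_K * 'I_K => (p.2, p.1)) by move=> [? ?] [? ?] [-> ->].
have swapT : \sum_(p : 'I_K * 'I_K | (p.1 < p.2)%N) complex.Re (T p) = complex.Re X.[z].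
  rewrite XE Re_sum (reindex_inj swap_inj); apply: eq_bigr => p _ /=.
  have -> : T (p.2, p.1) = conjc (T p) by rewrite /T /= !rmorphM /= !conjcK; ring.
  by case: (T p).
have diagT : \sum_(p : 'I_K * 'I_K | p.1 == p.2) complex.Re (T p) = mu.
  rewrite big_mkcond -(pair_bigA _ (fun i k => if i == k then complex.Re (T (i, k)) else 0)) /=.
  apply: eq_bigr => i _; rewrite -big_mkcond /= (big_pred1 i) => [|k]; last by rewrite eq_sym.
  by rewrite /T /= zz mulr1 mulcJ.
rewrite E (bigID (fun p : 'I_K * 'I_K => (p.1 < p.2)%N)) /= swapT.
rewrite [X in _ + X](bigID (fun p : 'I_K * 'I_K => p.1 == p.2)) /=.
have -> : \sum_(p : 'I_K * 'I_K | ~~ (p.1 < p.2)%N && (p.1 == p.2)) complex.Re (T p) = mu.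
  rewrite -diagT; apply: eq_bigl => p; case: eqP => [->|]; rewrite ?ltnn ?andbF //.
have -> : \sum_(p : 'I_K * 'I_K | ~~ (p.1 < p.2)%N && (p.1 != p.2)) complex.Re (T p) = complex.Re X.[z].
  rewrite XE Re_sum; apply: eq_bigl => p; rewrite -val_eqE /=; lia.
ring.
Qed.

Let Xcoef0 : X`_0 = 0.
Proof. by rewrite coef_poly; case: ifP. Qed.

Section Moments.
Variables (N : nat) (w : C).
Hypothesis prim_w : N.-primitive_root w.
Hypothesis KN : (3 * K <= N)%N.

Local Notation mean := (circle_mean N w).
Let sX : (size X <= K)%N. Proof. exact: size_poly. Qed.
Let s1 := \sum_(n < N) normc X`_n ^+ 2.
Let S1 := \sum_(n < N) n%:R * normc X`_n ^+ 2.
Let T := \sum_(n < N) complex.Re ((X * X)`_n * conjc X`_n).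

Let sX1 : (size X <= N)%N. Proof. by apply: leq_trans sX _; lia. Qed.
Let sX2 : (size (X * X)%R <= N)%N.
Proof. by apply: leq_trans (size_polyMleq _ _) _; move: sX; lia. Qed.
Let sX3 : (size (X * X * X)%R <= N)%N.
Proof.
apply: leq_trans (size_polyMleq _ _) _.
by have := size_polyMleq X X; move: sX; lia.
Qed.

Let mean1 : mean (fun z => complex.Re X.[z]) = 0.
Proof. by rewrite circle_mean_Re // Xcoef0. Qed.

Let mean2 : mean (fun z => complex.Re X.[z] ^+ 2) = s1 / 2.
Proof.
rewrite (eq_circle_mean prim_w (G := fun z => 2^-1 * complex.Re (X * X)%R.[z] + 2^-1 * normc X.[z] ^+ 2)).
  rewrite circle_meanD !circle_meanZ circle_mean_Re // parseval // coef0M Xcoef0 mul0r /=.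
  by rewrite mulr0 add0r mulrC.
move=> z _; rewrite hornerM; case: X.[z] => a b /=.
by rewrite sqr_sqrtr ?addr_ge0 ?sqr_ge0 //; field.
Qed.

Let mean3 : mean (fun z => complex.Re X.[z] ^+ 3) = 3 / 4 * T.
Proof.
rewrite (eq_circle_mean prim_w (G := fun z => 4^-1 * complex.Re (X * X * X)%R.[z] +
    3 / 4 * complex.Re ((X * X)%R.[z] * conjc X.[z]))).
  rewrite circle_meanD !circle_meanZ circle_mean_Re // circle_mean_Re_bilinear //.
  by rewrite !coef0M Xcoef0 !mul0r /= mulr0 add0r.
by move=> z _; rewrite !hornerM; case: X.[z] => a b /=; field.
Qed.

Let meanv : mean (fun z => normc h.[z] ^+ 2) = mu.
Proof.
rewrite (eq_circle_mean prim_w (G := fun z => mu + 2 * complex.Re X.[z])).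
  by rewrite circle_meanD circle_meanZ circle_mean_cst // mean1 mulr0 addr0.
exact: autocorrelation_polyP.
Qed.

Let meanv2 : mean (fun z => (normc h.[z] ^+ 2) ^+ 2) = mu ^+ 2 + 2 * s1.
Proof.
rewrite (eq_circle_mean prim_w (G := fun z => mu ^+ 2 + (4 * mu) * complex.Re X.[z] + 4 * complex.Re X.[z] ^+ 2)).
  rewrite !circle_meanD !circle_meanZ circle_mean_cst // mean1 mean2; lra.
by move=> z z1; rewrite autocorrelation_polyP //; ring.
Qed.

Let meanv3 : mean (fun z => (normc h.[z] ^+ 2) ^+ 3) = mu ^+ 3 + 6 * mu * s1 + 6 * T.
Proof.
rewrite (eq_circle_mean prim_w (G := fun z => mu ^+ 3 + (6 * mu ^+ 2) * complex.Re X.[z]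
   + (12 * mu) * complex.Re X.[z] ^+ 2 + 8 * complex.Re X.[z] ^+ 3)).
  rewrite !circle_meanD !circle_meanZ circle_mean_cst // mean1 mean2 mean3; lra.
by move=> z z1; rewrite autocorrelation_polyP //; ring.
Qed.

(* Coefficientwise Young inequality for the cubic term.  Since X has no constant
   term, only n - 1 of the products X_i X_(n-i) occur in (X^2)_n: hence S1 - s1. *)
Let T_le t : 0 < t -> T <= t * (S1 - s1) + s1 ^+ 2 / (4 * t).
Proof.
move=> t0; pose a n := normc X`_n ^+ 2.
have a0 n : 0 <= a n by exact: sqr_ge0.
have amgm (x y z : C) : complex.Re (x * y * conjc z) <= t * normc z ^+ 2 + normc x ^+ 2 * normc y ^+ 2 / (4 * t).
  apply: le_trans (Re_le_normc _) _; rewrite !normcM normcJ_real.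
  rewrite -subr_ge0 (_ : _ - _ = (2 * t * normc z - normc x * normc y) ^+ 2 / (4 * t)).
    by rewrite divr_ge0 ?sqr_ge0 // mulr_ge0 // ltW.
  by field; rewrite gt_eqF.
have r0 i j : 0 <= a i * a j / (4 * t).
  by apply: divr_ge0; [exact: mulr_ge0|rewrite mulr_ge0 // ltW].
have step : T <= \sum_(n < N) (t * (n%:R * a n - a n) + (\sum_(i < n.+1) a i * a (n - i)%N) / (4 * t)).
  apply: ler_sum => n _; rewrite coefM mulr_suml Re_sum.
  have [n0|n0] := posnP n.
    rewrite n0 big_ord1 Xcoef0 conjc0 mulr0 /= big_ord1 /a Xcoef0 normc0 expr0n /= !mulr0 subr0 mulr0 add0r.
    by rewrite mul0r.
  apply: (@le_trans _ _ (\sum_(i < n.+1) (t * (((0 < i)%N && (i < n)%N)%:R * a n) + a i * a (n - i)%N / (4 * t)))).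
    apply: ler_sum => i _.
    case: (posnP i) => [i0|i0].
      by have := r0 0%N (n - 0)%N; rewrite i0 Xcoef0 !mul0r /= mulr0 add0r.
    have [ni|ni] := ltnP i n; last first.
      have -> : (n - i = 0)%N by lia.
      by have := r0 i 0%N; rewrite Xcoef0 mulr0 mul0r andbF mul0r mulr0 add0r.
    by rewrite mul1r; exact: amgm.
  rewrite big_split /= -mulr_sumr -!mulr_suml -natr_sum.
  have -> : (\sum_(i < n.+1) ((0 < i)%N && (i < n)%N : nat) = n.-1)%N.
    case: (nat_of_ord n) n0 => // m _.
    rewrite big_ord_recr big_ord_recl /= ltnn addn0 add0n.
    rewrite (eq_bigr (fun=> 1%N)) ?sum1_card ?card_ord // => i _.
    by rewrite /bump /=; have := ltn_ord i; lia.
  rewrite lerD2r ler_pM2l // -subn1 natrB // mulrBl mul1r //.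
apply: le_trans step _; rewrite big_split /= -mulr_sumr sumrB -/S1 -/s1 lerD2l -mulr_suml.
rewrite ler_pM2r ?invr_gt0 ?mulr_gt0 //.
pose p : {poly R} := \poly_(n < N) a n.
have p1 : p.[1] = s1 by rewrite horner_poly; apply: eq_bigr => n _; rewrite expr1n mulr1.
have pc i : (i < N)%N -> p`_i = a i by move=> iN; rewrite coef_poly iN.
have spp : (size (p * p)%R <= N + N)%N.
  have sp : (size p <= N)%N by exact: size_poly.
  by apply: leq_trans (size_polyMleq _ _) _; move: sp; lia.
rewrite -p1 expr2 -hornerM (horner_coef_wide _ spp) big_split_ord /=.
rewrite (eq_bigr (fun n : 'I_N => (p * p)`_n * 1 ^+ n)); last first.
  move=> n _; rewrite expr1n mulr1 coefM; apply: eq_bigr => i _.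
  by rewrite !pc //; have := ltn_ord n; have := ltn_ord i; lia.
rewrite lerDl; apply: sumr_ge0 => n _; rewrite expr1n mulr1 coefM; apply: sumr_ge0 => i _.
by rewrite mulr_ge0 // coef_poly; case: ifP.
Qed.

(* The bound on the energy of |h|^2, with the sums extended to n < N. *)
Let S1_le : 4 * S1 <= \sum_(s < N) s%:R * normc (h ^+ 2)`_s ^+ 2.
Proof.
have hs : \sum_(s < N) s%:R * normc (h ^+ 2)`_s ^+ 2 =
   \sum_(s < K + K) s%:R * normc (square_coef K (fun i => h`_i) s) ^+ 2.
  have hc s : (h ^+ 2)`_s = square_coef K (fun i => h`_i) s.
    have -> : h ^+ 2 = \sum_(p : 'I_K * 'I_K) (h`_p.1 * h`_p.2) *: 'X^(p.1 + p.2).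
      have {1}-> : h = \sum_(i < K) h`_i *: 'X^i.
        rewrite -poly_def; apply/polyP => i; rewrite coef_poly; case: ltnP => // Ki.
        by rewrite nth_default // (leq_trans sh).
      rewrite expr2 mulr_suml -(pair_bigA _ (fun i j : 'I_K => (h`_i * h`_j) *: 'X^(i + j))) /=.
      apply: eq_bigr => i _; rewrite mulr_sumr; apply: eq_bigr => j _.
      by rewrite -scalerAl -scalerAr scalerA exprD.
    rewrite coef_sum /square_coef [RHS]big_mkcond; apply: eq_bigr => p _ /=.
    by rewrite coefZ coefXn eq_sym; case: eqP; rewrite ?mulr1 ?mulr0.
  have NE : N = (K + K + (N - (K + K)))%N by lia.
  rewrite NE big_split_ord /= [X in _ + X]big1 ?addr0; last first.
    move=> i _; rewrite nth_default ?normc0 ?expr0n ?mulr0 //.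
    rewrite expr2; apply: leq_trans (size_polyMleq _ _) _.
    exact: leq_trans (leq_pred _) (leq_trans (leq_add sh sh) (leq_addr _ _)).
  by apply: eq_bigr => s _; rewrite hc.
rewrite hs; apply: le_trans (autocorrelation_le_square _ _).
rewrite ler_pM2l //; have NE : N = (K + (N - K))%N by lia.
rewrite /S1 NE big_split_ord /= [X in _ + X]big1 ?addr0; last first.
  move=> i _; rewrite coef_poly ifF ?normc0 ?expr0n ?mulr0 //.
  by apply/negbTE; rewrite -leqNgt leq_addr.
apply: ler_sum => n _; rewrite coef_poly ltn_ord; case: eqP => [->|_ //].
by rewrite !mul0r.
Qed.

(** With v = |h|^2 and t = sqrt W, the cubic majorant of v^2 ln v^2 at v / t is
    averaged: the mean of v^3 is mu^3 + 6 mu s1 + 6 T, and T is bounded by the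
    energy S1, itself at most a quarter of the energy of h^2.  What remains is a
    polynomial inequality in nu = mu / t, which holds on [0, 1]. *)
Lemma entropy_square_le :
  mean (fun z => xlnx ((normc h.[z] ^+ 2) ^+ 2)) <=
  xlnx (mean (fun z => (normc h.[z] ^+ 2) ^+ 2)) +
  \sum_(s < N) s%:R * normc (h ^+ 2)`_s ^+ 2.
Proof.
set W := mean (fun z => (normc h.[z] ^+ 2) ^+ 2).
have mu0 : 0 <= mu by apply: sumr_ge0 => i _; exact: sqr_ge0.
have s10 : 0 <= s1 by apply: sumr_ge0 => i _; exact: sqr_ge0.
have WE : W = mu ^+ 2 + 2 * s1 by exact: meanv2.
have W0 : 0 <= W by rewrite WE; nra.
have S1W := S1_le; set D := \sum_(s < N) _ in S1W *.
move: W0; rewrite le_eqVlt => /predU1P[W0|Wp].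
  have D0 : 0 <= D by apply: sumr_ge0 => s _; rewrite mulr_ge0 ?ler0n ?sqr_ge0.
  rewrite -W0 /xlnx mul0r add0r; apply: le_trans D0.
  rewrite /circle_mean big1 ?mulr0 // => x _.
  move/esym/eqP: W0; rewrite /W /circle_mean mulf_eq0 invr_eq0 pnatr_eq0.
  have := prim_order_gt0 prim_w; rewrite lt0n => /negPf -> /=.
  rewrite psumr_eq0; last by move=> i _; exact: sqr_ge0.
  by move=> /allP/(_ x); rewrite mem_index_enum => /(_ isT)/eqP ->; rewrite mul0r.
set t := Num.sqrt W; have t0 : 0 < t by rewrite sqrtr_gt0.
have tW : t ^+ 2 = W by rewrite sqr_sqrtr // ltW.
have pw z : normc z = 1 -> xlnx ((normc h.[z] ^+ 2) ^+ 2) <=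
   (2 / 3 / t) * (normc h.[z] ^+ 2) ^+ 3 + (1 + ln W) * (normc h.[z] ^+ 2) ^+ 2
    + (- 2 * t) * normc h.[z] ^+ 2 + W / 3.
  move=> _; set v := normc h.[z] ^+ 2; have v0 : 0 <= v by exact: sqr_ge0.
  have := v0; rewrite le_eqVlt => /predU1P[<-|vp].
    by rewrite /xlnx !expr0n /= mul0r !mulr0 !add0r divr_ge0 // ltW.
  have := sqr_ln_sqr_le (divr_ge0 v0 (ltW t0)); set u := v / t.
  have vu : v = u * t by rewrite divfK // gt_eqF.
  have up : 0 < u by rewrite divr_gt0.
  have -> : ln (u ^+ 2) = ln (v ^+ 2) - ln W.
    by rewrite vu (exprMn 2 u t) tW [ln (_ * W)]lnM ?posrE ?exprn_gt0 // addrK.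
  rewrite -(ler_pM2l Wp) => hu; rewrite /xlnx.
  have e1 : W * (u ^+ 2 * (ln (v ^+ 2) - ln W)) = v ^+ 2 * ln (v ^+ 2) - v ^+ 2 * ln W.
    by rewrite vu -tW; ring.
  have e2 : W * (2 / 3 * u ^+ 3 + u ^+ 2 - 2 * u + 1 / 3) =
     2 / 3 / t * v ^+ 3 + v ^+ 2 - 2 * t * v + W / 3.
    by rewrite vu -tW; field; rewrite gt_eqF.
  rewrite e1 e2 in hu; lra.
apply: le_trans (ler_circle_mean prim_w pw) _.
rewrite !circle_meanD !circle_meanZ circle_mean_cst // meanv meanv3 -/W.
rewrite /xlnx.
have hT := T_le t0.
have : 4 / t * T <= 4 / t * (t * (S1 - s1) + s1 ^+ 2 / (4 * t)) by rewrite ler_pM2l // divr_gt0.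
have -> : 4 / t * (t * (S1 - s1) + s1 ^+ 2 / (4 * t)) = 4 * S1 - 4 * s1 + s1 ^+ 2 / W.
  by rewrite -tW; field; rewrite gt_eqF.
move=> hT'.
have -> : 2 / 3 / t * (mu ^+ 3 + 6 * mu * s1 + 6 * T) =
   2 / 3 / t * (mu ^+ 3 + 6 * mu * s1) + 4 / t * T by field; rewrite gt_eqF.
set nu := mu / t; have nu0 : 0 <= nu by rewrite divr_ge0 // ltW.
have muE : mu = nu * t by rewrite divfK // gt_eqF.
have s1E : s1 = W * (1 - nu ^+ 2) / 2.
  have -> : s1 = (W - mu ^+ 2) / 2 by rewrite WE; field.
  by rewrite muE -tW; field.
have nu1 : nu <= 1.
  have : 0 <= 1 - nu ^+ 2 by move: s10; rewrite s1E; nra.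
  nra.
have -> : 2 / 3 / t * (mu ^+ 3 + 6 * mu * s1) = W * (2 / 3 * nu ^+ 3 + 2 * nu * (1 - nu ^+ 2)).
  by rewrite s1E muE -tW; field; rewrite gt_eqF.
(* W = mu^2 + 2 s1 leaves nu as the only parameter after division by W. *)
have e4 : s1 ^+ 2 / W = W * ((1 - nu ^+ 2) ^+ 2 / 4).
  by rewrite s1E; field; rewrite gt_eqF.
have e5 : - 2 * t * mu = W * (- 2 * nu) by rewrite muE -tW; ring.
rewrite e5; rewrite e4 s1E in hT'.
have : W * ((1 - nu) ^+ 2 * (2 / 3 * (1 + 2 * nu) - (1 + nu) ^+ 2 / 4)) >= 0.
  rewrite mulr_ge0 ?(ltW Wp) // mulr_ge0 ?sqr_ge0 //; nra.
lra.
Qed.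

End Moments.
End FixedPoly.
End SquareLSI.

(** * Continuity of y ln y *)

Section XlnxContinuity.
Variable R : realType.

(** A modulus of continuity at small arguments, where the derivative is unbounded,
    comes from -y ln y <= 2 sqrt y; for a > b the derivative 1 + ln a is at most a,
    whence the term delta * a. *)
Lemma xlnx_continuous (a b delta : R) : 0 <= a -> 0 <= b -> `|a - b| <= delta ->
  xlnx a <= xlnx b + 2 * Num.sqrt delta + delta * a.
Proof.
move=> a0 b0 dab; have d0 : 0 <= delta by exact: le_trans dab.
have sd0 : 0 <= Num.sqrt delta by exact: sqrtr_ge0.
have [ab|ba] := leP a b; last first.
  suff : xlnx a <= xlnx b + delta * a by lra.
  have ap : 0 < a by exact: le_lt_trans ba.
  have dl : a - b <= delta by apply: le_trans dab; exact: ler_norm.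
  have la := ln_le_sub1 ap; rewrite /xlnx.
  have := mul_ln_le b0 a0 (fun=> ap) => h.
  have : (a - b) * ln a <= (a - b) * (a - 1) by rewrite ler_pM2l // subr_gt0.
  have : (a - b) * a <= delta * a by rewrite ler_pM2r.
  lra.
suff : xlnx a <= xlnx b + 2 * Num.sqrt delta.
  have : 0 <= delta * a by rewrite mulr_ge0.
  lra.
have sb : b - a <= delta by apply: le_trans dab; rewrite distrC ler_norm.
have [->|nab] := eqVneq a b; first by lra.
have s0 : 0 < b - a by rewrite subr_gt0 lt_neqAle nab.
have bp : 0 < b by lra.
have h1 : a * ln a <= a * ln b.
  move: a0; rewrite le_eqVlt => /predU1P[<-|ap]; first by rewrite !mul0r.
  by rewrite ler_pM2l // ler_ln.
have h2 : (b - a) * ln (b - a) <= (b - a) * ln b.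
  by rewrite ler_pM2l // ler_ln ?posrE //; lra.
set q := Num.sqrt (b - a); have q0 : 0 < q by rewrite sqrtr_gt0.
have q2 : b - a = q ^+ 2 by rewrite sqr_sqrtr // ltW.
have qd : q <= Num.sqrt delta by rewrite ler_sqrt.
have h3 : - (2 * q) <= (b - a) * ln (b - a).
  have -> : ln (b - a) = 2 * ln q by rewrite q2 lnXn // mulr_natl.
  have := ln_le_sub1 (_ : 0 < q^-1); rewrite invr_gt0 lnV ?posrE // => /(_ q0) h.
  have : q ^+ 2 * (- ln q) <= q ^+ 2 * (q^-1 - 1) by rewrite ler_pM2l // exprn_gt0.
  have -> : q ^+ 2 * (q^-1 - 1) = q - q ^+ 2 by field; rewrite gt_eqF.
  rewrite q2; have : 0 <= q ^+ 2 by exact: sqr_ge0.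
  lra.
rewrite /xlnx; move: h1 h2 h3; lra.
Qed.

End XlnxContinuity.

(** * Reflection of roots in the circle *)

Section Reflection.
Variable R : realType.
Local Notation C := R[i].

Definition dirichlet (n : nat) (p : {poly C}) : R := \sum_(i < n) i%:R * normc p`_i ^+ 2.

Lemma normc_sqrE (z : C) : normc z ^+ 2 = complex.Re z ^+ 2 + complex.Im z ^+ 2.
Proof. by case: z => a b; rewrite sqr_sqrtr // addr_ge0 ?sqr_ge0. Qed.

Lemma normc_reflect (z rho : C) : normc z = 1 -> normc (1 - conjc rho * z) = normc (z - rho).
Proof.
move=> z1; have -> : z - rho = z * conjc (1 - conjc rho * z).
  by rewrite rmorphB rmorph1 rmorphM /= conjcK mulrBr mulr1 mulrCA mulcJ z1 expr1n mulr1.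
by rewrite normcM z1 mul1r normcJ_real.
Qed.

(** The difference of the energies is (1 - |rho|^2) \sum_i |u_i|^2, by summation by
    parts. *)
Lemma dirichlet_reflect (u : {poly C}) (rho : C) m : normc rho <= 1 -> (size u <= m)%N ->
  dirichlet m.+1 (u * (1 - (conjc rho)%:P * 'X)) <= dirichlet m.+1 (u * ('X - rho%:P)).
Proof.
move=> rho1 su; rewrite /dirichlet !big_ord_recl !mul0r !add0r -subr_ge0 -sumrB.
pose a i := normc u`_i ^+ 2.
rewrite (eq_bigr (fun i : 'I_m => (1 - normc rho ^+ 2) * (i.+1%:R * (a i - a i.+1)))); last first.
  move=> i _; rewrite lift0 -mulrBr mulrCA; congr (_ * _).
  rewrite !mulrBr mulr1 [u * (_ * 'X)]mulrA ![u * _%:P]mulrC !coefB !coefMX !coefCM /= /a !normc_sqrE.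
  by case: (u`_i) (u`_i.+1) (rho) => [? ?] [? ?] [? ?] /=; ring.
rewrite -mulr_sumr mulr_ge0 //.
  by rewrite subr_ge0 expr_le1 ?normc_ge0.
have -> : \sum_(i < m) i.+1%:R * (a i - a i.+1) = \sum_(i < m) a i - m%:R * a m.
  elim: m {su} => [|m IH]; first by rewrite !big_ord0 mul0r subrr.
  by rewrite !big_ord_recr /= IH -natr1; ring.
rewrite {2}/a nth_default // normc0 expr0n mulr0 subr0.
by apply: sumr_ge0 => i _; exact: sqr_ge0.
Qed.

(** A factor X - r with |r| <= 1 is replaced by 1 - conj(r) X, which has the same
    modulus on the circle and less energy; one with |r| > 1 is only rescaled to
    1 - X / r.  The spectator g collects the factors already treated, and makes the
    induction on the list of roots possible. *)
Lemma reflect_roots (g : {poly C}) (rs : seq C) : exists (c : C) (bs : seq C),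
  [/\ size bs = size rs, all (fun b => normc b <= 1) bs,
     forall z, normc z = 1 -> normc (g * c%:P * \prod_(b <- bs) (1 - b%:P * 'X)).[z] =
                 normc (g * \prod_(r <- rs) ('X - r%:P)).[z] &
     forall n, (size g + size rs <= n)%N ->
       dirichlet n (g * c%:P * \prod_(b <- bs) (1 - b%:P * 'X)) <=
       dirichlet n (g * \prod_(r <- rs) ('X - r%:P))].
Proof.
elim: rs g => [|r rs IH] g.
  exists 1, [::]; split=> // [z _|n _]; first by rewrite !big_nil !mulr1.
  by rewrite !big_nil !mulr1.
have [r1|r1] := leP (normc r) 1.
  have [c [bs [sb b1 mb db]]] := IH (g * (1 - (conjc r)%:P * 'X)).
  exists c, (conjc r :: bs); split.
  - by rewrite /= sb.
  - by rewrite /= normcJ_real r1.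
  - move=> z z1; have := mb z z1; rewrite !big_cons.
    rewrite (_ : g * c%:P * _ = g * (1 - (conjc r)%:P * 'X) * c%:P * \prod_(b <- bs) (1 - b%:P * 'X)); last by ring.
    move=> ->; rewrite !hornerM !normcM mulrA; congr (_ * _ * _).
    by rewrite !hornerE normc_reflect.
  - move=> n; rewrite /= addnS => sn; rewrite !big_cons.
    rewrite (_ : g * c%:P * _ = g * (1 - (conjc r)%:P * 'X) * c%:P * \prod_(b <- bs) (1 - b%:P * 'X)); last by ring.
    have sl : (size (1 - (conjc r)%:P * 'X : {poly C})%R <= 2)%N.
      apply: leq_trans (size_polyD _ _) _; rewrite geq_max size_poly1 size_polyN /=.
      apply: leq_trans (size_polyMleq _ _) _; rewrite size_polyX size_polyC; case: (_ != 0) => //.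
    apply: le_trans (db n _) _.
      apply: leq_trans sn; rewrite -addSn leq_add2r.
      apply: leq_trans (size_polyMleq _ _) _.
      by rewrite -subn1 leq_subLR add1n -addn2 leq_add2l.
    case: n sn => // n; rewrite ltnS => sn.
    rewrite -mulrA [_ * \prod_(r <- rs) _]mulrC mulrA.
    rewrite [('X - _) * _]mulrC [leRHS](_ : _ = dirichlet n.+1 (g * \prod_(r0 <- rs) ('X - r0%:P) * ('X - r%:P))); last by rewrite mulrA.
    apply: dirichlet_reflect => //.
    apply: leq_trans (size_polyMleq _ _) _; rewrite size_prod_XsubC addnS /=; exact: sn.
have r0 : r != 0 by apply: contraTneq r1 => ->; rewrite normc0 ltr10.
have [c [bs [sb b1 mb db]]] := IH (g * ('X - r%:P)).
have E : g * (- r * c)%:P * \prod_(b <- r^-1 :: bs) (1 - b%:P * 'X) =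
    g * ('X - r%:P) * c%:P * \prod_(b <- bs) (1 - b%:P * 'X).
  rewrite big_cons mulrA; congr (_ * _).
  rewrite polyCM polyCN; have : r%:P * (r^-1)%:P = 1 :> {poly C} by rewrite -polyCM divff.
  set x := r%:P; set y := (r^-1)%:P => xy.
  rewrite (_ : g * _ * _ = g * c%:P * (x * y * 'X - x)); last by ring.
  by rewrite xy mul1r; ring.
exists (- r * c), (r^-1 :: bs); split.
- by rewrite /= sb.
- rewrite /= b1 andbT normcV invf_le1 ?(ltW r1) //; exact: lt_trans r1.
- by move=> z z1; rewrite E mb // big_cons mulrA.
- move=> n /= sn; rewrite E big_cons mulrA; apply: db.
  apply: leq_trans sn; rewrite addnS -addSn leq_add2r.
  apply: leq_trans (size_polyMleq _ _) _.
  by rewrite size_XsubC addn2.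
Qed.

End Reflection.

(** * Polynomial square roots on the disk *)

Section SquareRoots.
Variable R : realType.
Local Notation C := R[i].

(** The iteration w |-> (x + w^2) / 2, started at 0, increases for x in [0, 1] to its
    fixed point 1 - sqrt (1 - x). *)
Fixpoint sqrt_gap (k : nat) : {poly C} :=
  if k is k'.+1 then (2^-1)%:P * ('X + sqrt_gap k' ^+ 2) else 0.

(** The values of the same iteration at x = 1. *)
Fixpoint sqrt_gap1 (k : nat) : R :=
  if k is k'.+1 then (1 + sqrt_gap1 k' ^+ 2) / 2 else 0.

Lemma sqrt_gap1_bound k : 0 <= 1 - sqrt_gap1 k <= 2 / k.+2%:R.
Proof.
elim: k => [|k] /=; first by rewrite subr0 ler01 divff ?lexx ?pnatr_eq0.
move: (sqrt_gap1 k) => t /andP[t1 t2].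
have -> : 1 - (1 + t ^+ 2) / 2 = (1 - t) - (1 - t) ^+ 2 / 2 by field.
move: t1 t2; set e := 1 - t; set n : R := k.+2%:R => e0 en.
have n2 : 2 <= n by rewrite /n (ler_nat R 2).
have n0 : 0 < n by apply: lt_le_trans n2.
have -> : k.+3%:R = n + 1 by rewrite /n -natr1.
have q1 : 2 / n <= 1 by rewrite ler_pdivrMr ?mul1r.
have n1 : 0 < n + 1 by rewrite addr_gt0.
have e1 : e <= 1 by exact: le_trans q1.
apply/andP; split; first by clear -e0 e1; nra.
have h : e - e ^+ 2 / 2 <= 2 / n - (2 / n) ^+ 2 / 2.
  by move: (2 / n) q1 en => q q1 en; clear -e0 e1 q1 en; nra.
apply: le_trans h _; rewrite -subr_ge0.
have -> : 2 / (n + 1) - (2 / n - (2 / n) ^+ 2 / 2) = 2 / (n ^+ 2 * (n + 1)).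
  by field; rewrite !gt_eqF // addr_gt0.
by rewrite divr_ge0 // mulr_ge0 ?sqr_ge0 // ltW.
Qed.

Lemma sqrt_gap1_ge0 k : 0 <= sqrt_gap1 k.
Proof. by case: k => //= k; have := sqr_ge0 (sqrt_gap1 k); lra. Qed.

Lemma normc_half : normc (2^-1 : C) = 2^-1.
Proof.
by rewrite normcV -[2]/(2%:R) -(rmorph_nat (real_complex R)) normc_real ?ler0n.
Qed.

Lemma horner_sqrt_gapS k (x : C) :
  (sqrt_gap k.+1).[x] = 2^-1 * (x + (sqrt_gap k).[x] ^+ 2).
Proof. by rewrite [sqrt_gap k.+1]/= hornerM hornerC hornerD hornerX horner_exp. Qed.

(** The polynomials and their increments have nonnegative coefficients, so that the
    disk is dominated by the point 1. *)
Lemma sqrt_gap_bound k (x : C) : normc x <= 1 ->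
  normc (sqrt_gap k).[x] <= sqrt_gap1 k /\
  normc ((sqrt_gap k.+1).[x] - (sqrt_gap k).[x]) <= sqrt_gap1 k.+1 - sqrt_gap1 k.
Proof.
move=> x1; elim: k => [|k [IH1 IH2]].
  have e0 : (sqrt_gap 0).[x] = 0 by rewrite horner0.
  have e1 : (sqrt_gap 1).[x] = 2^-1 * x by rewrite hornerM hornerC expr0n addr0 hornerX.
  rewrite e0 e1 subr0 normc0 normcM normc_half; split=> //.
  by rewrite /= expr0n addr0 subr0 mul1r ler_piMr.
have := normc_ge0 (sqrt_gap k).[x].
split.
  rewrite horner_sqrt_gapS normcM normc_half [sqrt_gap1 _]/= mulrC ler_pM2r //.
  apply: le_trans (le_normcD _ _) _; apply: lerD => //.
  by rewrite normcX lerXn2r // nnegrE ?normc_ge0 ?sqrt_gap1_ge0.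
have E : (sqrt_gap k.+2).[x] - (sqrt_gap k.+1).[x] =
   2^-1 * (((sqrt_gap k.+1).[x] + (sqrt_gap k).[x]) * ((sqrt_gap k.+1).[x] - (sqrt_gap k).[x])).
  by rewrite horner_sqrt_gapS [X in _ - X = _]horner_sqrt_gapS; ring.
have -> : sqrt_gap1 k.+2 - sqrt_gap1 k.+1 =
   2^-1 * ((sqrt_gap1 k.+1 + sqrt_gap1 k) * (sqrt_gap1 k.+1 - sqrt_gap1 k)).
  have S j : sqrt_gap1 j.+1 = (1 + sqrt_gap1 j ^+ 2) / 2 by [].
  by rewrite S [X in _ - X = _]S; field.
have IH3 : normc (sqrt_gap k.+1).[x] <= sqrt_gap1 k.+1.
  rewrite -(subrK (sqrt_gap k).[x] (sqrt_gap k.+1).[x]).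
  by apply: le_trans (le_normcD _ _) _; move: IH1 IH2; lra.
rewrite E !normcM normc_half ler_pM2l //; apply: ler_pM; rewrite ?normc_ge0 //.
by apply: le_trans (le_normcD _ _) _; exact: lerD.
Qed.

(** For s = 1 - w_k, the error 1 - x - s^2 is -2 (w_{k+1} - w_k), an increment that is
    dominated by its value at 1 and hence of order 1/k, uniformly up to the boundary
    of the disk. *)
Lemma exists_sqrt_approx (eta : R) : 0 < eta -> exists s : {poly C},
  forall x, normc x <= 1 -> normc (1 - x - s.[x] ^+ 2) <= eta.
Proof.
move=> e0; have [k hk] : exists k : nat, 2 / eta < k%:R.
  by exists (Num.bound (2 / eta)); rewrite archi_boundP // divr_ge0 // ltW.
exists (1 - sqrt_gap k) => x x1.
have [h1 h2] := sqrt_gap_bound k x1.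
have -> : 1 - x - (1 - sqrt_gap k).[x] ^+ 2 = - (2 * ((sqrt_gap k.+1).[x] - (sqrt_gap k).[x])).
  have two : (2 : C) * 2^-1 = 1 by rewrite divff // pnatr_eq0.
  rewrite horner_sqrt_gapS mulrBr mulrA two hornerD hornerN hornerC; ring.
rewrite normcN normcM.
have -> : normc (2 : C) = 2 by rewrite -(rmorph_nat (real_complex R)) normc_real ?ler0n.
have /andP[t0 t1] := sqrt_gap1_bound k.
have k2 : (0 : R) < k.+2%:R by rewrite ltr0n.
have t2 : 1 - sqrt_gap1 k <= eta.
  apply: le_trans t1 _; rewrite ler_pdivrMr //.
  rewrite ltr_pdivrMr // in hk; rewrite mulrC; apply: le_trans (ltW hk) _.
  by rewrite ler_pM2r // ler_nat; lia.
have t3 := sqrt_gap1_ge0 k.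
move: h2; rewrite [sqrt_gap1 k.+1]/=; nra.
Qed.

Lemma prod_diff_le (T : Type) (bs : seq T) (x y : T -> C) (eta : R) : 0 <= eta <= 1 ->
  all (fun b => (normc (x b) <= 2) && (normc (x b - y b) <= eta)) bs ->
  normc (\prod_(b <- bs) x b - \prod_(b <- bs) y b) <= (size bs)%:R * 3 ^+ size bs * eta.
Proof.
move=> /andP[e0 e1].
have y3 b : (normc (x b) <= 2) && (normc (x b - y b) <= eta) -> normc (y b) <= 3.
  move=> /andP[x2 xy]; have -> : y b = x b - (x b - y b) by ring.
  by apply: le_trans (le_normcD _ _) _; rewrite normcN; lra.
elim: bs => [_|b bs IH /= /andP[xyb xybs]]; first by rewrite !big_nil subrr normc0 mul0r mul0r.
have {}IH := IH xybs; have /andP[x2 xy] := xyb.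
rewrite !big_cons; set X := \prod_(j <- bs) x j in IH *; set Y := \prod_(j <- bs) y j in IH *.
have Y3 : normc Y <= 3 ^+ size bs.
  rewrite /Y normc_prod; elim: (bs) xybs => [|c cs IHc] /=; first by rewrite big_nil.
  move=> /andP[/y3 c3 /IHc cs3]; rewrite big_cons exprS; apply: ler_pM => //; first exact: normc_ge0.
  by apply: prodr_ge0 => *; exact: normc_ge0.
have -> : x b * X - y b * Y = x b * (X - Y) + Y * (x b - y b) by ring.
apply: le_trans (le_normcD _ _) _; rewrite !normcM.
have p0 : (0 : R) <= 3 ^+ size bs by rewrite exprn_ge0.
have h1 : normc (x b) * normc (X - Y) <= 2 * ((size bs)%:R * 3 ^+ size bs * eta).
  by apply: ler_pM; rewrite ?normc_ge0.
have h2 : normc Y * normc (x b - y b) <= 3 ^+ size bs * eta.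
  by apply: ler_pM; rewrite ?normc_ge0.
apply: le_trans (lerD h1 h2) _.
rewrite -[(size bs).+1%:R]natr1 exprS; set n : R := (size bs)%:R; set P := 3 ^+ size bs.
have n0 : 0 <= n by rewrite ler0n.
have : 0 <= P * eta * (n + 2) by rewrite !mulr_ge0 //; lra.
lra.
Qed.

End SquareRoots.

(** * Approximation of polynomials by squares in modulus *)

Section SquareApproximation.
Variable R : realType.
Local Notation C := R[i].

Lemma bernoulli_sub (tau : R) n : 0 <= tau <= 1 -> 1 - (1 - tau) ^+ n <= n%:R * tau.
Proof.
move=> /andP[t0 t1]; elim: n => [|n IH]; first by rewrite expr0 subrr mul0r.
rewrite exprS -natr1; have p : 0 <= (1 - tau) ^+ n <= 1.
  by rewrite exprn_ge0 ?exprn_ile1 //; lra.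
move: p IH; move: ((1 - tau) ^+ n) => x /andP[x0 x1]; nra.
Qed.

Lemma bernoulli_add (tau : R) n : 0 <= tau -> 1 + n%:R * tau <= (1 + tau) ^+ n.
Proof.
move=> t0; elim: n => [|n IH]; first by rewrite expr0 mul0r addr0.
rewrite exprS -natr1; have n0 : (0 : R) <= n%:R by exact: ler0n.
have : (1 + tau) * (1 + n%:R * tau) <= (1 + tau) * (1 + tau) ^+ n by rewrite ler_pM2l // ltr_pwDl.
apply: le_trans; have : 0 <= n%:R * tau * tau by rewrite !mulr_ge0.
lra.
Qed.

(** Dilating a polynomial by 1 - tau turns its energy into a multiple of its L^2
    norm.  The proof uses (1 - tau)^n (1 + tau)^n <= 1 and 1 + n tau <= (1 + tau)^n. *)
Lemma dilation_weight (tau : R) n : 0 < tau <= 1 -> n%:R * ((1 - tau) ^+ n) ^+ 2 <= tau^-1.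
Proof.
move=> /andP[t0 t1]; have n0 : (0 : R) <= n%:R by exact: ler0n.
have x0 : 0 <= (1 - tau) ^+ n by rewrite exprn_ge0 // subr_ge0.
have x1 : (1 - tau) ^+ n <= 1 by rewrite exprn_ile1 //; lra.
have xy : (1 - tau) ^+ n * (1 + tau) ^+ n <= 1.
  rewrite -exprMn exprn_ile1 //; nra.
have y := bernoulli_add n (ltW t0).
move: ((1 - tau) ^+ n) ((1 + tau) ^+ n) x0 x1 xy y => x y x0 x1 xy h.
have h2 : x * (1 + n%:R * tau) <= 1 by apply: le_trans xy; exact: ler_wpM2l.
have : n%:R * tau * x <= 1 by lra.
rewrite -[tau^-1]mul1r ler_pdivlMr // => h3.
have : n%:R * tau * x ^+ 2 <= n%:R * tau * x.
  by rewrite ler_wpM2l ?mulr_ge0 ?(ltW t0) // expr2 ler_piMl.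
lra.
Qed.

Lemma coef_comp_scale (p : {poly C}) (r : C) n : (p \Po (r%:P * 'X))`_n = r ^+ n * p`_n.
Proof.
rewrite comp_polyE coef_sum.
rewrite (eq_bigr (fun i : 'I_(size p) => if i == n :> nat then r ^+ n * p`_n else 0)); last first.
  move=> i _; rewrite exprMn -polyC_exp coefZ coefCM coefXn eq_sym.
  by case: eqP => [->|_]; rewrite ?mulr1 ?mulr0 1?mulrC.
rewrite -big_mkcond /=; have [np|np] := ltnP n (size p).
  by rewrite (big_pred1 (Ordinal np)) // => i; rewrite -val_eqE.
rewrite nth_default // mulr0 big1 //.
Qed.

Lemma size_comp_scale (p : {poly C}) (r : C) : (size (p \Po (r%:P * 'X))%R <= size p)%N.
Proof. by apply/leq_sizeP => j hj; rewrite coef_comp_scale nth_default ?mulr0. Qed.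

Lemma horner_comp_scale (p : {poly C}) (r x : C) : (p \Po (r%:P * 'X)).[x] = p.[r * x].
Proof. by rewrite horner_comp hornerM hornerC hornerX. Qed.

Lemma size_prod_le (bs : seq C) (F : C -> {poly C}) S :
  (forall b, size (F b) <= S.+1)%N -> (size (\prod_(b <- bs) F b)%R <= (size bs * S).+1)%N.
Proof.
move=> FS; elim: bs => [|b bs IH]; first by rewrite big_nil size_poly1.
rewrite big_cons /=; apply: leq_trans (size_polyMleq _ _) _.
rewrite -subn1 leq_subLR add1n mulSn; apply: leq_trans (leq_add (FS b) IH) _.
by rewrite addSn addnS.
Qed.

(** Bessel's inequality, which also contains the estimate of Cauchy for a single
    coefficient. *)
Lemma sum_coef_sqr_le (e : {poly C}) (M : R) N : 0 <= M ->
  (forall z, normc z = 1 -> normc e.[z] <= M) -> \sum_(n < N) normc e`_n ^+ 2 <= M ^+ 2.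
Proof.
move=> M0 eM; pose N' := (maxn N (size e)).+1.
have [w prim_w] := exists_prim_root R (ltn0Sn (maxn N (size e))).
have se : (size e <= N')%N by rewrite /N'; lia.
have NN : (N <= N')%N by rewrite /N'; lia.
apply: (@le_trans _ _ (\sum_(n < N') normc e`_n ^+ 2)).
  rewrite (big_ord_widen N' (fun n => normc e`_n ^+ 2) NN).
  rewrite [leLHS]big_mkcond /=; apply: ler_sum => i _.
  by case: ifP => // _; exact: sqr_ge0.
rewrite -(parseval prim_w se) -(circle_mean_cst prim_w (M ^+ 2)).
apply: (ler_circle_mean prim_w) => z /eM h.
by rewrite lerXn2r // nnegrE normc_ge0.
Qed.

(** If |f| <= d + 1 and the modulus of h^2 is within B tau of that of f, where
    B = (d+1) d + 1 and tau <= 1, then |f|^2 and |h|^4 differ by at most this multiple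
    of tau. *)
Definition square_approx_factor (d : nat) : R :=
  (d.+1%:R * d%:R + 1) * (2 * d.+1%:R + (d.+1%:R * d%:R + 1)).

(** After reflection f becomes G = c \prod_b (1 - b X) with all |b| <= 1, so that
    polynomial square roots of 1 - x at x = b z give h1 with h1^2 close to G on the
    whole disk.  Uniform closeness does not control the energy; it does after the
    dilation by 1 - tau, by dilation_weight.  The degree bound K depends on d and tau
    only, so that one N serves for all f. *)
Lemma exists_square_approx d (tau : R) : 0 < tau <= 1 -> exists K : nat, (d < K)%N /\
  forall f : {poly C}, (size f <= d.+1)%N -> \sum_(i < d.+1) normc f`_i ^+ 2 = 1 ->
  exists h : {poly C}, [/\ (size h <= K)%N,
    forall z, normc z = 1 ->
      `| normc f.[z] ^+ 2 - (normc h.[z] ^+ 2) ^+ 2 | <= square_approx_factor d * tau &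
    forall N, (K <= N)%N -> dirichlet N (h ^+ 2) <=
       dirichlet d.+1 f + (d.+1%:R * (3 * d%:R) + 1) * tau].
Proof.
move=> /andP[t0 t1].
have t0' := ltW t0.
(* The accuracy of each square root for which the product over at most d roots
   is accurate to tau. *)
pose eta := tau / (d%:R * 3 ^+ d + 1).
have den : (1 : R) <= d%:R * 3 ^+ d + 1 by rewrite lerDr mulr_ge0 ?exprn_ge0.
have den0 : (0 : R) < d%:R * 3 ^+ d + 1 by exact: lt_le_trans den.
have e0 : 0 < eta by rewrite divr_gt0.
have e1 : eta <= 1 by rewrite ler_pdivrMr // mul1r (le_trans t1).
have [s sP] := exists_sqrt_approx e0.
exists (d + d * size s).+2; split; first by rewrite ltnS leqW // leq_addr.
move=> f sf W1.
have f0 : f != 0.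
  apply/eqP => f0; move/esym/eqP: W1; rewrite big1 ?oner_eq0 // => i _.
  by rewrite f0 coef0 normc0 expr0n.
have [rs frs] := closed_field_poly_normal f.
have srs : (size rs <= d)%N.
  by move: sf; rewrite frs size_scale ?lead_coef_eq0 // size_prod_XsubC.
have [c [bs [sbs b1 fG DG]]] := reflect_roots (lead_coef f)%:P rs.
have fE : f = (lead_coef f)%:P * \prod_(r <- rs) ('X - r%:P) by rewrite mul_polyC.
rewrite -fE in fG DG.
have sbd : (size bs <= d)%N by rewrite sbs.
set c0 := lead_coef f * c.
set G := (lead_coef f)%:P * c%:P * \prod_(b <- bs) (1 - b%:P * 'X) in fG DG.
have GE : G = c0%:P * \prod_(b <- bs) (1 - b%:P * 'X) by rewrite /G -polyCM.
have DGf : dirichlet d.+1 G <= dirichlet d.+1 f.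
  apply: DG; apply: (@leq_trans (1 + d)%N); last by rewrite add1n.
  by apply: leq_add => //; rewrite size_polyC; case: (_ != 0).
have sG : (size G <= d.+1)%N.
  rewrite GE mul_polyC; apply: leq_trans (size_scale_leq _ _) _.
  apply: leq_trans (size_prod_le (S := 1) bs _) _; last by rewrite muln1.
  move=> b; apply: leq_trans (size_polyD _ _) _; rewrite geq_max size_poly1 size_polyN /=.
  by rewrite mul_polyC; apply: leq_trans (size_scale_leq _ _) _; rewrite size_polyX.
have [w prim_w] := exists_prim_root R (ltn0Sn d).
have WG : \sum_(i < d.+1) normc G`_i ^+ 2 = 1.
  rewrite -W1 -(parseval prim_w sG) -(parseval prim_w sf).
  by apply: (eq_circle_mean prim_w) => z /fG ->.
have Gi i : normc G`_i <= 1.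
  have [id|di] := ltnP i d.+1; last by rewrite nth_default ?normc0 ?(leq_trans sG).
  rewrite -(@expr_le1 _ 2) ?normc_ge0 // -WG (bigD1 (Ordinal id)) //= lerDl.
  by apply: sumr_ge0 => j _; exact: sqr_ge0.
have c01 : normc c0 <= 1.
  have -> : c0 = G`_0; last exact: Gi.
  rewrite -horner_coef0 GE hornerM hornerC horner_prod big1 ?mulr1 // => b _.
  by rewrite hornerD hornerN hornerM hornerX mulr0 subr0 hornerC.
have [r rE] : exists r : R, r = 1 - tau by exists (1 - tau).
have r0 : 0 <= r by rewrite rE subr_ge0.
have r1 : r <= 1 by rewrite rE lerBlDr lerDl.
pose h1 : {poly C} := (sqrtc c0)%:P * \prod_(b <- bs) (s \Po (b%:P * 'X)).
pose q := h1 ^+ 2; pose e := q - G.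
have eP x : normc x <= 1 -> normc e.[x] <= tau.
  move=> x1.
  have -> : e.[x] = c0 * (\prod_(b <- bs) s.[b * x] ^+ 2 - \prod_(b <- bs) (1 - b * x)).
    rewrite /e /q /h1 GE hornerD hornerN horner_exp !hornerM !hornerC !horner_prod.
    rewrite exprMn sqr_sqrtc mulrBr prodrXl; congr (_ * _ ^+ 2 - _ * _).
      by apply: eq_bigr => b _; rewrite horner_comp_scale.
    by apply: eq_bigr => b _; rewrite !hornerE.
  rewrite normcM -opprB normcN; apply: (@le_trans _ _ (1 * (d%:R * 3 ^+ d * eta))); last first.
    rewrite mul1r /eta mulrA ler_pdivrMr // mulrC ler_pM2l //.
    by rewrite lerDl.
  apply: ler_pM; rewrite ?normc_ge0 //.
  apply: le_trans (prod_diff_le (eta := eta) _ _) _; first by rewrite (ltW e0).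
    apply: sub_all b1 => b b1; have bx : normc (b * x) <= 1.
      by rewrite normcM mulr_ile1 ?normc_ge0.
    rewrite sP // andbT; apply: le_trans (le_normcD _ _) _.
    by rewrite normc1 normcN -[2]/(1 + 1) lerD2l.
  rewrite ler_wpM2r ?(ltW e0) //; apply: ler_pM; rewrite ?ler0n ?exprn_ge0 ?ler_nat //.
  by apply: ler_weXn2l => //; rewrite ler1n.
exists (h1 \Po (r%:C%:P * 'X)); split.
- apply: leq_trans (size_comp_scale _ _) _; rewrite /h1 mul_polyC.
  apply: leq_trans (size_scale_leq _ _) _.
  apply: leq_trans (size_prod_le (S := size s) bs _) _.
    by move=> b; apply: leq_trans (size_comp_scale _ _) (leqnSn _).
  rewrite ltnS; apply: leq_trans (leqnSn _); apply: leq_trans (leq_addl _ _).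
  by rewrite leq_mul2r sbd orbT.
- move=> z z1; rewrite horner_comp_scale -(fG z z1) -(normcX h1.[_]) -horner_exp -/q.
  set x := r%:C * z; have x1 : normc x <= 1 by rewrite normcM z1 mulr1 normc_real.
  have GG : normc (G.[z] - G.[x]) <= d.+1%:R * d%:R * tau.
    rewrite !(horner_coef_wide _ sG) -sumrB; apply: le_trans (normc_sum _ _ _) _.
    have -> : d.+1%:R * d%:R * tau = \sum_(i < d.+1) (d%:R * tau).
      by rewrite sumr_const card_ord -[(d%:R * tau) *+ _]mulr_natl mulrA.
    apply: ler_sum => i _; rewrite -mulrBr normcM.
    apply: (@le_trans _ _ (1 * (d%:R * tau))); last by rewrite mul1r.
    apply: ler_pM; rewrite ?normc_ge0 //.
    have -> : z ^+ i - x ^+ i = (1 - r ^+ i)%:C * z ^+ i.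
      by rewrite /x exprMn rmorphB /= rmorphXn /= mulrBl mul1r.
    have ri : 0 <= 1 - r ^+ i by rewrite subr_ge0 exprn_ile1.
    rewrite normcM normcX z1 expr1n mulr1 normc_real //.
    rewrite rE; apply: le_trans (bernoulli_sub i _) _; first by rewrite t0'.
    by rewrite ler_pM2r // ler_nat -ltnS.
  have Gz : normc G.[z] <= d.+1%:R.
    rewrite (horner_coef_wide _ sG); apply: le_trans (normc_sum _ _ _) _.
    have -> : d.+1%:R = \sum_(i < d.+1) (1 : R) by rewrite sumr_const card_ord.
    apply: ler_sum => i _.
    by rewrite normcM normcX z1 expr1n mulr1.
  have Gq : normc (G.[z] - q.[x]) <= (d.+1%:R * d%:R + 1) * tau.
    have -> : G.[z] - q.[x] = (G.[z] - G.[x]) - e.[x] by rewrite /e hornerD hornerN; ring.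
    apply: le_trans (le_normcD _ _) _; rewrite normcN mulrDl mul1r.
    by apply: lerD => //; exact: eP.
  have tri1 : normc G.[z] <= normc q.[x] + normc (G.[z] - q.[x]).
    by rewrite addrC -{1}(subrK q.[x] G.[z]); exact: le_normcD.
  have tri2 : normc q.[x] <= normc G.[z] + normc (G.[z] - q.[x]).
    rewrite -[normc (_ - _)]normcN opprB addrC -{1}(subrK G.[z] q.[x]); exact: le_normcD.
  have qx0 := normc_ge0 q.[x]; have Gz0 := normc_ge0 G.[z].
  move: tri1 tri2 Gq Gz qx0 Gz0; rewrite /square_approx_factor.
  have B0 : (0 : R) <= d.+1%:R * d%:R + 1 by rewrite addr_ge0 ?mulr_ge0.
  have d1 : (0 : R) <= d.+1%:R by [].
  move: B0 d1; set B := d.+1%:R * d%:R + 1; set D := d.+1%:R.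
  move: (normc (G.[z] - q.[x])) (normc G.[z]) (normc q.[x]) => g a b B0 D0 h2 h3 h4 h5 h6 h7.
  have Bt : B * tau <= B by rewrite ler_piMr.
  rewrite subr_sqr normrM; rewrite [leRHS](_ : _ = (B * tau) * (2 * D + B)); last by ring.
  apply: ler_pM; rewrite ?normr_ge0 //.
    by rewrite ler_norml; apply/andP; split; lra.
  by rewrite ger0_norm; lra.
- move=> N KN; have NE : N = (d.+1 + (N - d.+1))%N.
    by rewrite subnKC // (leq_trans _ KN) // ltnS leqW // leq_addr.
  have hq i : ((h1 \Po (r%:C%:P * 'X)) ^+ 2)`_i = (r ^+ i)%:C * q`_i.
    by rewrite expr2 -comp_polyM -expr2 coef_comp_scale rmorphXn.
  have se : \sum_(n < N) normc e`_n ^+ 2 <= tau ^+ 2.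
    by apply: sum_coef_sqr_le => // z z1; apply: eP; rewrite z1.
  have ei (i : 'I_N) : normc e`_i <= tau.
    rewrite -(@ler_pXn2r _ 2) ?nnegrE ?normc_ge0 //; apply: le_trans se.
    by rewrite (bigD1 i) //= lerDl; apply: sumr_ge0 => j _; exact: sqr_ge0.
  have term (i : 'I_N) : i%:R * normc ((h1 \Po (r%:C%:P * 'X)) ^+ 2)`_i ^+ 2 <=
     (if (i < d.+1)%N then i%:R * normc G`_i ^+ 2 + 3 * d%:R * tau else 0) + tau^-1 * normc e`_i ^+ 2.
    have ri0 : 0 <= r ^+ i by rewrite exprn_ge0.
    rewrite hq normcM normc_real // exprMn mulrA.
    have qE : q`_i = G`_i + e`_i by rewrite /e coefB; ring.
    case: ltnP => idd; last first.
      rewrite add0r qE nth_default ?(leq_trans sG) // add0r ler_wpM2r ?sqr_ge0 //.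
      by rewrite rE; apply: dilation_weight; rewrite t0.
    have e2 : 0 <= tau^-1 * normc e`_i ^+ 2 by rewrite mulr_ge0 ?invr_ge0 ?sqr_ge0.
    apply: (@le_trans _ _ (i%:R * normc G`_i ^+ 2 + 3 * d%:R * tau)); last by rewrite lerDl.
    have nq : normc q`_i <= normc G`_i + normc e`_i by rewrite qE; exact: le_normcD.
    have q2 : normc q`_i ^+ 2 <= normc G`_i ^+ 2 + 3 * tau.
      have := ei i; have := Gi i; have := normc_ge0 q`_i; have := normc_ge0 G`_i; have := normc_ge0 e`_i.
      move: nq; move: (normc q`_i) (normc G`_i) (normc e`_i) => a b g h2 g0 b0 a0 h3 h4.
      have : a ^+ 2 <= (b + g) ^+ 2 by rewrite lerXn2r // nnegrE addr_ge0.
      have : g * g <= 1 * tau by apply: ler_pM => //; exact: le_trans t1.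
      have : b * g <= 1 * tau by apply: ler_pM.
      lra.
    have i0 : (0 : R) <= i%:R by exact: ler0n.
    have idr : (i%:R : R) <= d%:R by rewrite ler_nat -ltnS.
    have r2 : (r ^+ i) ^+ 2 <= 1 by rewrite exprn_ile1 // exprn_ile1.
    apply: (@le_trans _ _ (i%:R * normc q`_i ^+ 2)).
      by rewrite ler_wpM2r ?sqr_ge0 // ler_piMr.
    apply: (@le_trans _ _ (i%:R * (normc G`_i ^+ 2 + 3 * tau))); first by rewrite ler_wpM2l.
    rewrite mulrDr lerD2l.
    have : i%:R * tau <= d%:R * tau by rewrite ler_pM2r.
    lra.
  rewrite /dirichlet; apply: le_trans (ler_sum _ (fun i _ => term i)) _.
  rewrite big_split /= -mulr_sumr.
  have -> : \sum_(i < N) (if (i < d.+1)%N then i%:R * normc G`_i ^+ 2 + 3 * d%:R * tau else 0) =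
      dirichlet d.+1 G + d.+1%:R * (3 * d%:R) * tau.
    rewrite -big_mkcond /= -(big_ord_widen N (fun i => i%:R * normc G`_i ^+ 2 + 3 * d%:R * tau)); last by rewrite NE leq_addr.
    by rewrite big_split /= sumr_const card_ord -[(3 * d%:R * tau) *+ _]mulr_natl /dirichlet; congr (_ + _); ring.
  have : tau^-1 * \sum_(i < N) normc e`_i ^+ 2 <= tau^-1 * tau ^+ 2 by rewrite ler_pM2l ?invr_gt0.
  have -> : tau^-1 * tau ^+ 2 = tau by rewrite expr2 mulKf // gt_eqF.
  rewrite -/(dirichlet d.+1 f); lra.
Qed.

End SquareApproximation.

(** * The logarithmic Sobolev inequality on the circle *)

Section CircleLSI.
Variable R : realType.
Local Notation C := R[i].

Lemma xlnxM (x y : R) : 0 < x -> 0 <= y -> xlnx (x * y) = x * xlnx y + y * xlnx x.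
Proof.
move=> x0; rewrite le_eqVlt /xlnx => /predU1P[<-|y0]; first by rewrite !(mulr0, mul0r) add0r.
by rewrite lnM ?posrE //; ring.
Qed.

(** The inequality for squares is applied to h^2, close to f in modulus.  The errors
    are all at most multiples of rho, where rho^2 bounds the distance of |f|^2 to
    |h|^4: the modulus of continuity of y ln y is a square root. *)
Lemma circle_entropy_normalized d (eps : R) : 0 < eps -> exists N0 : nat, (d < N0)%N /\
  forall N w, N.-primitive_root w -> (N0 <= N)%N ->
  forall f : {poly C}, (size f <= d.+1)%N -> \sum_(i < d.+1) normc f`_i ^+ 2 = 1 ->
  circle_mean N w (fun z => xlnx (normc f.[z] ^+ 2)) <= dirichlet d.+1 f + eps.
Proof.
move=> eps0.
pose B : R := d.+1%:R * (3 * d%:R) + 1.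
have B0 : 0 < B by rewrite ltr_wpDl // !mulr_ge0.
have A0 : 0 <= square_approx_factor R d by rewrite /square_approx_factor; apply: mulr_ge0; rewrite ?addr_ge0 ?mulr_ge0.
pose rho := Num.min 1 (eps / (7 + B)).
have B7 : 0 < 7 + B by rewrite addr_gt0.
have rho0 : 0 < rho by rewrite lt_min ltr01 divr_gt0.
have rho1 : rho <= 1 by rewrite ge_min lexx.
have rhoe : (7 + B) * rho <= eps.
  by rewrite mulrC -ler_pdivlMr // ge_min lexx orbT.
pose tau := rho ^+ 2 / (1 + square_approx_factor R d).
have A1 : 0 < 1 + square_approx_factor R d by rewrite ltr_pwDl.
have tau0 : 0 < tau by rewrite divr_gt0 ?exprn_gt0.
have Atau : square_approx_factor R d * tau <= rho ^+ 2.
  by rewrite /tau mulrCA ger_pMr ?exprn_gt0 // ler_pdivrMr // mul1r lerDr.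
have tau_rho : tau <= rho.
  rewrite /tau ler_pdivrMr //; apply: (@le_trans _ _ (rho * 1)); first by rewrite expr2 ler_pM2l.
  by rewrite ler_pM2l // lerDl.
have tau1 : 0 < tau <= 1 by rewrite tau0 (le_trans tau_rho).
have [K [dK KP]] := exists_square_approx d tau1.
exists (3 * K)%N; split; first by rewrite (leq_trans dK) // leq_pmull.
move=> N w prim_w KN f sf W1.
have [h [sh hf hD]] := KP f sf W1.
have KN' : (K <= N)%N by apply: leq_trans KN; rewrite leq_pmull.
have dN : (d < N)%N by exact: leq_trans dK KN'.
have sfN : (size f <= N)%N by exact: leq_trans dN.
have mf : circle_mean N w (fun z => normc f.[z] ^+ 2) = 1.
  rewrite parseval // -W1; have -> : N = (d.+1 + (N - d.+1))%N by rewrite subnKC.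
  rewrite big_split_ord /= [X in _ + X]big1 ?addr0 // => i _.
  rewrite nth_default ?normc0 ?expr0n //; apply: leq_trans sf _; exact: leq_addr.
set W' := circle_mean N w (fun z => (normc h.[z] ^+ 2) ^+ 2).
have close z : normc z = 1 -> `|normc f.[z] ^+ 2 - (normc h.[z] ^+ 2) ^+ 2| <= rho ^+ 2.
  by move=> z1; exact: le_trans (hf z z1) Atau.
have W'0 : 0 <= W'.
  rewrite -(circle_mean_cst prim_w 0); apply: (ler_circle_mean prim_w) => z _; exact: sqr_ge0.
have W'1 : `|W' - 1| <= rho ^+ 2.
  have up : W' <= 1 + rho ^+ 2.
    rewrite -mf -(circle_mean_cst prim_w (rho ^+ 2)) -circle_meanD.
    by apply: (ler_circle_mean prim_w) => z /close; rewrite ler_norml; lra.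
  have lo : 1 <= W' + rho ^+ 2.
    rewrite -mf -(circle_mean_cst prim_w (rho ^+ 2)) -circle_meanD.
    by apply: (ler_circle_mean prim_w) => z /close; rewrite ler_norml; lra.
  by rewrite ler_norml; apply/andP; split; lra.
have srho : Num.sqrt (rho ^+ 2) = rho by rewrite sqrtr_sqr ger0_norm // ltW.
have pw z : normc z = 1 -> xlnx (normc f.[z] ^+ 2) <=
    xlnx ((normc h.[z] ^+ 2) ^+ 2) + 2 * rho + rho ^+ 2 * normc f.[z] ^+ 2.
  by move=> z1; rewrite -{1}srho; apply: xlnx_continuous; rewrite ?sqr_ge0 ?close.
apply: le_trans (ler_circle_mean prim_w pw) _.
rewrite !circle_meanD !circle_meanZ circle_mean_cst // mf.
have := entropy_square_le sh prim_w KN; rewrite -/W' -/(dirichlet N (h ^+ 2)) => hE.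
have := hD N KN'; rewrite -/B => hD'.
have := xlnx_continuous W'0 ler01 W'1; rewrite srho {2}/xlnx ln1 mulr0 add0r => hW.
have W'2 : W' <= 1 + rho ^+ 2 by move: W'1; rewrite ler_norml; lra.
have r2 : rho ^+ 2 <= rho by rewrite expr2 ger_pMr.
have : rho ^+ 2 * W' <= rho * 2.
  by apply: ler_pM; rewrite ?sqr_ge0 //; lra.
have : B * tau <= B * rho by rewrite ler_pM2l.
lra.
Qed.

(** Both sides scale by the same rule when f is multiplied by a constant, since
    y ln y gains the same term linear in y on both sides. *)
Lemma circle_entropy d (eps : R) : 0 < eps -> exists N0 : nat, (d < N0)%N /\
  forall N w, N.-primitive_root w -> (N0 <= N)%N ->
  forall f : {poly C}, (size f <= d.+1)%N ->
  circle_mean N w (fun z => xlnx (normc f.[z] ^+ 2)) <=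
    xlnx (\sum_(i < d.+1) normc f`_i ^+ 2) +
    \sum_(i < d.+1) (i%:R + eps) * normc f`_i ^+ 2.
Proof.
move=> eps0; have [N0 [dN0 HN0]] := circle_entropy_normalized d eps0.
exists N0; split=> // N w prim_w NN f sf.
have dN : (d < N)%N by exact: leq_trans dN0 NN.
set W := \sum_(i < d.+1) _.
have W0 : 0 <= W by apply: sumr_ge0 => i _; exact: sqr_ge0.
have -> : \sum_(i < d.+1) (i%:R + eps) * normc f`_i ^+ 2 = dirichlet d.+1 f + eps * W.
  by rewrite /dirichlet /W mulr_sumr -big_split; apply: eq_bigr => i _; rewrite mulrDl.
move: W0; rewrite le_eqVlt => /predU1P[W0|Wp].
  have f0 : f = 0.
    apply/polyP => i; rewrite coef0; have [id|di] := ltnP i d.+1; last by rewrite nth_default ?(leq_trans sf).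
    move/esym/eqP: W0; rewrite psumr_eq0; last by move=> j _; exact: sqr_ge0.
    move/allP/(_ (Ordinal id)); rewrite mem_index_enum => /(_ isT).
    by rewrite sqrf_eq0 => /eqP/eq0_normc.
  rewrite -W0 /dirichlet big1 ?mulr0 ?addr0; last first.
    by move=> i _; rewrite f0 coef0 normc0 expr0n mulr0.
  rewrite -(circle_mean_cst prim_w (xlnx 0)); apply: (ler_circle_mean prim_w) => z _.
  by rewrite f0 horner0 normc0 expr0n.
set c := (Num.sqrt W)^-1; have c0 : 0 < c by rewrite invr_gt0 sqrtr_gt0.
have cW : c ^+ 2 * W = 1 by rewrite exprVn sqr_sqrtr ?(ltW Wp) // mulVf // gt_eqF.
have nc y : normc (c%:C * y) ^+ 2 = c ^+ 2 * normc y ^+ 2.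
  by rewrite normcM normc_real ?(ltW c0) // exprMn.
have := HN0 N w prim_w NN (c%:C%:P * f).
have -> : (size (c%:C%:P * f)%R <= d.+1)%N by rewrite mul_polyC (leq_trans (size_scale_leq _ _)).
rewrite (eq_bigr (fun i : 'I_d.+1 => c ^+ 2 * normc f`_i ^+ 2)); last first.
  by move=> i _; rewrite coefCM nc.
rewrite -mulr_sumr cW => /(_ isT (erefl _)).
have -> : dirichlet d.+1 (c%:C%:P * f) = c ^+ 2 * dirichlet d.+1 f.
  by rewrite /dirichlet mulr_sumr; apply: eq_bigr => i _; rewrite coefCM nc mulrCA.
have pw : circle_mean N w (fun z => xlnx (normc f.[z] ^+ 2)) =
   circle_mean N w (fun z => W * xlnx (normc (c%:C%:P * f).[z] ^+ 2) + ln W * normc f.[z] ^+ 2).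
  apply: (eq_circle_mean prim_w) => z _; rewrite hornerM hornerC nc.
  have -> : ln W * normc f.[z] ^+ 2 = c ^+ 2 * normc f.[z] ^+ 2 * xlnx W.
    by rewrite /xlnx; rewrite (_ : _ * _ * (W * _) = (c ^+ 2 * W) * (normc f.[z] ^+ 2 * ln W)); [rewrite cW mul1r mulrC|ring].
  rewrite -(xlnxM Wp); last by apply: mulr_ge0; exact: sqr_ge0.
  by rewrite mulrA (mulrC W) cW mul1r.
rewrite pw circle_meanD !circle_meanZ parseval //; last by exact: leq_trans dN.
have -> : \sum_(i < N) normc f`_i ^+ 2 = W.
  have -> : N = (d.+1 + (N - d.+1))%N by rewrite subnKC.
  rewrite big_split_ord /= [X in _ + X]big1 ?addr0 // => i _.
  rewrite nth_default ?normc0 ?expr0n //; apply: leq_trans sf _; exact: leq_addr.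
rewrite -(ler_pM2l Wp) => h1.
have e1 : W * (c ^+ 2 * dirichlet d.+1 f + eps) = dirichlet d.+1 f + eps * W.
  by rewrite mulrDr mulrA (mulrC W) cW mul1r [W * eps]mulrC.
rewrite e1 in h1; move: h1; rewrite [xlnx W]/xlnx; lra.
Qed.

End CircleLSI.

(** * Hypercontractivity on the torus *)

Section Torus.
Variable R : realType.
Local Notation C := R[i].

Fixpoint torus_mean (N : nat) (w : C) (n : nat) (F : seq C -> R) : R :=
  if n is n'.+1 then circle_mean N w (fun z => torus_mean N w n' (fun s => F (z :: s)))
  else F [::].

Definition unimodular (s : seq C) := all (fun z => normc z == 1) s.

Section Means.
Variables (N : nat) (w : C).
Hypothesis prim_w : N.-primitive_root w.
Local Notation mean := (circle_mean N w).
Local Notation tmean := (torus_mean N w).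

Lemma ler_torus_mean n (F G : seq C -> R) :
  (forall s, size s = n -> unimodular s -> F s <= G s) -> tmean n F <= tmean n G.
Proof.
elim: n F G => [|n IH] F G FG /=; first exact: FG.
apply: (ler_circle_mean prim_w) => z z1; apply: IH => s sn us.
by apply: FG; rewrite /= ?sn ?z1 ?eqxx.
Qed.

Lemma eq_torus_mean n (F G : seq C -> R) :
  (forall s, size s = n -> unimodular s -> F s = G s) -> tmean n F = tmean n G.
Proof.
by move=> FG; apply/eqP; rewrite eq_le !ler_torus_mean // => s sn us; rewrite FG.
Qed.

Lemma torus_meanD n F G : tmean n (fun s => F s + G s) = tmean n F + tmean n G.
Proof.
elim: n F G => [//|n IH] F G /=; rewrite -circle_meanD.
by apply: (eq_circle_mean prim_w) => z _; rewrite IH.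
Qed.

Lemma torus_meanZ n a F : tmean n (fun s => a * F s) = a * tmean n F.
Proof.
elim: n F => [//|n IH] F /=; rewrite -circle_meanZ.
by apply: (eq_circle_mean prim_w) => z _; rewrite IH.
Qed.

Lemma torus_mean_cst n a : tmean n (fun=> a) = a.
Proof.
elim: n => [//|n IH] /=; rewrite -[RHS](circle_mean_cst prim_w).
by apply: (eq_circle_mean prim_w) => z _; rewrite IH.
Qed.

Lemma circle_mean_sum (T : Type) (r : seq T) (F : T -> C -> R) :
  mean (fun z => \sum_(t <- r) F t z) = \sum_(t <- r) mean (F t).
Proof.
elim: r => [|t r IH].
  rewrite big_nil -[RHS](circle_mean_cst prim_w); by apply: (eq_circle_mean prim_w) => z _; rewrite big_nil.
by rewrite big_cons -IH -circle_meanD; apply: (eq_circle_mean prim_w) => z _; rewrite big_cons.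
Qed.

Lemma torus_mean_sum n (T : Type) (r : seq T) (F : T -> seq C -> R) :
  tmean n (fun s => \sum_(t <- r) F t s) = \sum_(t <- r) tmean n (F t).
Proof.
elim: r => [|t r IH].
  rewrite big_nil -[RHS](torus_mean_cst n); by apply: eq_torus_mean => s _ _; rewrite big_nil.
by rewrite big_cons -IH -torus_meanD; apply: eq_torus_mean => s _ _; rewrite big_cons.
Qed.

(** Convexity of the entropy functional: the entropy of a sum of nonnegative
    functions is at most the sum of their entropies.  Pointwise, this is Gibbs'
    inequality for the families G b z and W b, where W b is the mean of G b. *)
Lemma circle_entropy_sum (T : finType) (G : T -> C -> R) :
  (forall b z, 0 <= G b z) -> (forall b z, 0 < G b z -> 0 < mean (G b)) ->
  mean (fun z => xlnx (\sum_b G b z)) <=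
  xlnx (\sum_b mean (G b)) + \sum_b (mean (fun z => xlnx (G b z)) - xlnx (mean (G b))).
Proof.
move=> G0 GW; pose W b := mean (G b); pose W1 := \sum_b W b.
have W0 b : 0 <= W b.
  by rewrite -(circle_mean_cst prim_w 0); apply: (ler_circle_mean prim_w) => z _.
have pw z : normc z = 1 -> xlnx (\sum_b G b z) <=
    (\sum_b xlnx (G b z)) + (\sum_b (- ln (W b)) * G b z) + ln W1 * \sum_b G b z.
  move=> _; set Y := \sum_b G b z.
  have Y0 : 0 <= Y by exact: sumr_ge0.
  have GY b : 0 < G b z -> 0 < Y.
    by move=> h; apply/sumr_gt0P => //; exists b.
  have GW1 b : 0 < G b z -> 0 < W1.
    by move=> /GW h; apply/sumr_gt0P => //; exists b.
  have h b : G b z * (ln Y + ln (W b) - ln W1) <= xlnx (G b z) + Y * W b / W1 - G b z.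
    have := G0 b z; rewrite le_eqVlt => /predU1P[<-|gp].
      by rewrite /xlnx !mul0r add0r subr0 divr_ge0 ?mulr_ge0 // sumr_ge0.
    have h1 : 0 < Y := GY b gp; have h2 : 0 < W b := GW b z gp; have h3 : 0 < W1 := GW1 b gp.
    have -> : ln Y + ln (W b) - ln W1 = ln (Y * W b / W1).
      rewrite ln_div ?posrE; [|exact: mulr_gt0|exact: h3].
      by rewrite lnM ?posrE; [|exact: h1|exact: h2].
    have p : 0 < Y * W b / W1 by rewrite divr_gt0 // mulr_gt0.
    by apply: mul_ln_le; [exact: ltW|exact: ltW|].
  have : \sum_b G b z * (ln Y + ln (W b) - ln W1) <=
     \sum_b (xlnx (G b z) + Y * W b / W1 - G b z) by apply: ler_sum => t _; exact: h.
  rewrite sumrB big_split /=.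
  rewrite -mulr_suml -mulr_sumr -/W1 -/Y.
  have -> : Y * W1 / W1 = Y.
    move: Y0; rewrite le_eqVlt => /predU1P[<-|]; first by rewrite !mul0r.
    move=> /sumr_gt0P[//|b /GW1 h1]; by rewrite mulfK // gt_eqF.
  have -> : \sum_b G b z * (ln Y + ln (W b) - ln W1) =
     xlnx Y - \sum_b (- ln (W b)) * G b z - ln W1 * Y.
    rewrite /xlnx {1}/Y mulr_suml {2}/Y mulr_sumr -!sumrB; apply: eq_bigr => b _; ring.
  lra.
apply: le_trans (ler_circle_mean prim_w pw) _.
rewrite !circle_meanD circle_meanZ !circle_mean_sum -/W1 sumrB.
have -> : \sum_b mean (fun z => - ln (W b) * G b z) = - \sum_b xlnx (W b).
  by rewrite -sumrN; apply: eq_bigr => b _; rewrite circle_meanZ /xlnx -/(W b); ring.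
rewrite [xlnx (\sum_b _)]/xlnx -/W1; lra.
Qed.

End Means.

Section TorusPoly.
Variable d : nat.

Fixpoint torus_char (b : seq 'I_d.+1) (s : seq C) : C :=
  if b is x :: b' then (if s is z :: s' then z ^+ x * torus_char b' s' else 1) else 1.

Definition torus_poly n (q : seq 'I_d.+1 -> C) (s : seq C) : C :=
  \sum_(b : n.-tuple 'I_d.+1) q b * torus_char b s.

(** The one-variable polynomial that collects, in the first variable, the
    coefficients whose other exponents are b. *)
Definition slice (q : seq 'I_d.+1 -> C) (b : seq 'I_d.+1) : {poly C} :=
  \poly_(i < d.+1) q (inord i :: b).

Lemma torus_polyS n q z s : torus_poly n.+1 q (z :: s) = torus_poly n (fun b => (slice q b).[z]) s.
Proof.
rewrite /torus_poly (big_tupleS _ (fun b => q b * torus_char b (z :: s))) exchange_big.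
apply: eq_bigr => b _; rewrite horner_poly mulr_suml; apply: eq_bigr => i _ /=.
by rewrite inord_val mulrA.
Qed.

Lemma size_slice q b : (size (slice q b) <= d.+1)%N.
Proof. exact: size_poly. Qed.

Lemma slice_coef q b (i : 'I_d.+1) : (slice q b)`_i = q (i :: b).
Proof. by rewrite coef_poly ltn_ord inord_val. Qed.

Section Entropy.
Variables (N : nat) (w : C).
Hypothesis prim_w : N.-primitive_root w.
Hypothesis dN : (d < N)%N.

Lemma mean_slice q b : circle_mean N w (fun z => normc (slice q b).[z] ^+ 2) =
  \sum_(i < d.+1) normc (q (i :: b)) ^+ 2.
Proof.
rewrite parseval ?(leq_trans (size_slice _ _)) //.
rewrite [in LHS](_ : N = (d.+1 + (N - d.+1))%N); last by rewrite subnKC.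
rewrite big_split_ord /= [X in _ + X]big1 ?addr0 => [|i _].
  by apply: eq_bigr => i _; rewrite slice_coef.
by rewrite nth_default ?normc0 ?expr0n // (leq_trans (size_slice _ _)) // leq_addr.
Qed.

Lemma torus_parseval n q :
  torus_mean N w n (fun s => normc (torus_poly n q s) ^+ 2) =
  \sum_(b : n.-tuple 'I_d.+1) normc (q b) ^+ 2.
Proof.
elim: n q => [|n IH] q /=.
  rewrite (big_tuple0 (fun b => normc (q b) ^+ 2)).
  by rewrite /torus_poly (big_tuple0 (fun b => q b * torus_char b [::])) mulr1.
rewrite (eq_circle_mean prim_w (G := fun z => \sum_(b : n.-tuple 'I_d.+1) normc (slice q b).[z] ^+ 2)); last first.
  move=> z _; apply: etrans (IH (fun b => (slice q b).[z])).
  apply: (eq_torus_mean prim_w) => s _ _.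
  by rewrite torus_polyS.
rewrite (circle_mean_sum prim_w) (big_tupleS _ (fun b => normc (q b) ^+ 2)) exchange_big.
by apply: eq_bigr => b _; rewrite mean_slice.
Qed.

(** Induction on the number of variables.  With the first variable z fixed, the
    induction hypothesis leaves y ln y at the sum over b of the |slice q b (z)|^2,
    to which circle_entropy_sum and the inequality on the circle apply. *)
Lemma torus_entropy (eps : R) :
  (forall f : {poly C}, (size f <= d.+1)%N ->
  circle_mean N w (fun z => xlnx (normc f.[z] ^+ 2)) <=
    xlnx (\sum_(i < d.+1) normc f`_i ^+ 2) +
    \sum_(i < d.+1) (i%:R + eps) * normc f`_i ^+ 2) ->
  forall n q,
  torus_mean N w n (fun s => xlnx (normc (torus_poly n q s) ^+ 2)) <=
  xlnx (\sum_(b : n.-tuple 'I_d.+1) normc (q b) ^+ 2) +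
  \sum_(b : n.-tuple 'I_d.+1) ((\sum_(x <- b) (x : nat)%:R) + n%:R * eps) * normc (q b) ^+ 2.
Proof.
move=> lsi; elim=> [|n IH] q /=.
  rewrite (big_tuple0 (fun b => normc (q b) ^+ 2)).
  rewrite (big_tuple0 (fun b : seq 'I_d.+1 => ((\sum_(x <- b) (x : nat)%:R) + 0%:R * eps) * normc (q b) ^+ 2)).
  rewrite big_nil mul0r !add0r mul0r addr0.
  by rewrite /torus_poly (big_tuple0 (fun b => q b * torus_char b [::])) mulr1.
pose G (b : n.-tuple 'I_d.+1) z : R := normc (slice q b).[z] ^+ 2.
pose c (b : seq 'I_d.+1) : R := \sum_(x <- b) (x : nat)%:R + n%:R * eps.
apply: (@le_trans _ _ (circle_mean N w (fun z => xlnx (\sum_b G b z) + \sum_(b : n.-tuple 'I_d.+1) c b * G b z))).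
  apply: (ler_circle_mean prim_w) => z _.
  rewrite (eq_torus_mean prim_w (G := fun s => xlnx (normc (torus_poly n (fun b => (slice q b).[z]) s) ^+ 2))).
    exact: IH.
  by move=> s _ _; rewrite torus_polyS.
rewrite circle_meanD (circle_mean_sum prim_w).
have mG b : circle_mean N w (G b) = \sum_(i < d.+1) normc (q (i :: b)) ^+ 2 by exact: mean_slice.
have G0 b z : 0 <= G b z by exact: sqr_ge0.
have GW b z : 0 < G b z -> 0 < circle_mean N w (G b).
  rewrite mG => h; rewrite lt0r sumr_ge0 ?andbT; last by move=> *; exact: sqr_ge0.
  apply: contraTneq h => /eqP; rewrite psumr_eq0 => [/allP h0|*]; last exact: sqr_ge0.
  have s0 : slice q b = 0.
    apply/polyP => i; rewrite coef0 coef_poly; case: ltnP => // id.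
    have := h0 (inord i); rewrite mem_index_enum => /(_ isT).
    by rewrite sqrf_eq0 => /eqP/eq0_normc.
  by rewrite /G s0 horner0 normc0 expr0n ltxx.
apply: (@le_trans _ _ (xlnx (\sum_b circle_mean N w (G b)) +
    \sum_(b : n.-tuple 'I_d.+1) \sum_(i < d.+1) (i%:R + eps) * normc (q (i :: b)) ^+ 2 +
    \sum_(b : n.-tuple 'I_d.+1) c b * \sum_(i < d.+1) normc (q (i :: b)) ^+ 2)).
  apply: lerD; last by apply: ler_sum => b _; rewrite circle_meanZ mG.
  apply: le_trans (circle_entropy_sum prim_w G0 GW) _; rewrite lerD2l.
  apply: ler_sum => b _; rewrite lerBlDl.
  have := lsi _ (size_slice q b).
  rewrite (eq_bigr (fun i : 'I_d.+1 => normc (q (i :: b)) ^+ 2)); last by move=> i _; rewrite slice_coef.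
  rewrite [X in _ <= _ + X -> _](eq_bigr (fun i : 'I_d.+1 => (i%:R + eps) * normc (q (i :: b)) ^+ 2)); last first.
    by move=> i _; rewrite slice_coef.
  by rewrite mG.
have -> : \sum_b circle_mean N w (G b) = \sum_(b : n.+1.-tuple 'I_d.+1) normc (q b) ^+ 2.
  rewrite (big_tupleS _ (fun b => normc (q b) ^+ 2)) exchange_big.
  by apply: eq_bigr => b _; rewrite mG.
rewrite -addrA lerD2l -big_split /=.
rewrite (big_tupleS _ (fun b : seq 'I_d.+1 => ((\sum_(x <- b) (x : nat)%:R) + n.+1%:R * eps) * normc (q b) ^+ 2)) exchange_big.
apply: ler_sum => b _; rewrite mulr_sumr -big_split /=; apply: ler_sum => i _.
by rewrite big_cons /c -natr1 le_eqVlt; apply/orP; left; apply/eqP; ring.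
Qed.

(** An entropy bound says that y = |f|^2 is not too peaked, which bounds its
    moments of order 1 - theta from below: y^{1 - theta} = y exp(- theta ln y), and the
    exponential is bounded below by its tangent at the point ln y = ln W + D. *)
Lemma torus_power_mean_ge n (q : seq 'I_d.+1 -> C) (D theta : R) :
  0 <= theta < 1 ->
  torus_mean N w n (fun s => xlnx (normc (torus_poly n q s) ^+ 2)) <=
    xlnx (\sum_(b : n.-tuple 'I_d.+1) normc (q b) ^+ 2) +
    D * \sum_(b : n.-tuple 'I_d.+1) normc (q b) ^+ 2 ->
  (\sum_(b : n.-tuple 'I_d.+1) normc (q b) ^+ 2) `^ (1 - theta) <=
  expR (theta * D) * torus_mean N w n (fun s => (normc (torus_poly n q s) ^+ 2) `^ (1 - theta)).
Proof.
move=> /andP[th0 th1]; set W := \sum_b _ => ent.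
have mW : torus_mean N w n (fun s => normc (torus_poly n q s) ^+ 2) = W by exact: torus_parseval.
have W0 : 0 <= W by apply: sumr_ge0 => b _; exact: sqr_ge0.
have E0 := expR_gt0 (theta * D).
have thn : 1 - theta != 0 by rewrite subr_eq0 eq_sym lt_eqF.
move: W0; rewrite le_eqVlt => /predU1P[W0|Wp].
  rewrite -W0 powR0 // mulr_ge0 ?(ltW E0) // -(torus_mean_cst prim_w n 0).
  by apply: (ler_torus_mean prim_w) => s _ _; exact: powR_ge0.
rewrite -ler_pdivrMl // -expRN.
set e := expR (- (theta * D)); have e0 : 0 < e by exact: expR_gt0.
pose k := e * W `^ (1 - theta) / W.
have k0 : 0 < k by rewrite divr_gt0 // mulr_gt0 // powR_gt0.
have pw s : size s = n -> unimodular s ->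
   k * (1 + theta * (ln W + D)) * normc (torus_poly n q s) ^+ 2 +
   (- (k * theta)) * xlnx (normc (torus_poly n q s) ^+ 2) <= (normc (torus_poly n q s) ^+ 2) `^ (1 - theta).
  move=> _ _; set y := _ ^+ 2; have y0 : 0 <= y by exact: sqr_ge0.
  move: y0; rewrite le_eqVlt => /predU1P[<-|yp].
    by rewrite /xlnx mul0r !mulr0 addr0 powR0.
  have yE : y `^ (1 - theta) = k * y * expR (- (theta * (ln y - ln W - D))).
    rewrite /k /e /powR !gt_eqF // -{2}[y]lnK ?posrE // -[X in _ / X]lnK ?posrE // -expRN -!expRD.
    by congr expR; ring.
  rewrite yE /xlnx.
  have : k * y * (1 + - (theta * (ln y - ln W - D))) <= k * y * expR (- (theta * (ln y - ln W - D))).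
    by rewrite (ler_pM2l (mulr_gt0 k0 yp)) expR_ge1Dx.
  apply: le_trans; rewrite le_eqVlt; apply/orP; left; apply/eqP; ring.
apply: le_trans (ler_torus_mean prim_w pw); rewrite (torus_meanD prim_w) !(torus_meanZ prim_w) mW.
have : k * theta * torus_mean N w n (fun s => xlnx (normc (torus_poly n q s) ^+ 2)) <=
    k * theta * (xlnx W + D * W) by rewrite ler_wpM2l // mulr_ge0 // ltW.
have -> : e * W `^ (1 - theta) = k * W by rewrite divfK // gt_eqF.
rewrite [xlnx W]/xlnx; lra.
Qed.

End Entropy.
End TorusPoly.
End Torus.

(** * Rearrangements of a tuple *)

Section Arrangements.
Variable I : finType.

Definition arrangements (t : seq I) : nat := size (permutations t).

Lemma sum_count_mem_all (t : seq I) : (\sum_(x : I) count_mem x t = size t)%N.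
Proof.
elim: t => [|y t IH]; first by rewrite big1.
rewrite /= big_split /= IH (bigD1 y) //= eqxx big1 ?addn0 ?add1n // => x xy.
by rewrite eq_sym (negPf xy).
Qed.

(** The number of distinct rearrangements is a multinomial coefficient: sort them by
    their first entry. *)
Lemma arrangements_fact (t : seq I) :
  (arrangements t * \prod_(x : I) (count_mem x t)`! = (size t)`!)%N.
Proof.
have [k] := ubnP (size t); elim: k t => // k IH t; rewrite ltnS => tk.
have [t0|t0] := posnP (size t).
  by rewrite (size0nil t0) /arrangements big1.
rewrite /arrangements (perm_size (permutationsE t0)) size_allpairs_dep.
rewrite sumnE !big_map big_distrl /=.
rewrite (eq_big_seq (fun x => count_mem x t * (size t).-1`!)%N); last first.
  move=> x; rewrite mem_undup => xt.
  have sr : size (rem x t) = (size t).-1 by rewrite size_rem.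
  rewrite -sr -(IH (rem x t)) ?sr; last by apply: leq_trans tk; rewrite ltn_predL.
  rewrite mulnCA; congr (_ * _)%N.
  rewrite (bigD1 x) //= [in RHS](bigD1 x) //= mulnA; congr (_ * _)%N.
    have c0 : (0 < count_mem x t)%N by rewrite -has_count has_pred1.
    by rewrite count_mem_rem eqxx subn1 -[in LHS](prednK c0) factS prednK.
  by apply: eq_bigr => y yx; rewrite count_mem_rem (eq_sym x) (negPf yx) subn0.
rewrite -big_distrl /= (big_uniq _ (undup_uniq t)) /=.
have -> : (\sum_(x in undup t) count_mem x t = size t)%N.
  rewrite -[RHS]sum_count_mem_all big_mkcond; apply: eq_bigr => x _.
  rewrite mem_undup; case: ifPn => //; rewrite -has_pred1 has_count -eqn0Ngt.
  by move=> /eqP.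
by case: (size t) t0.
Qed.

Lemma perm_eq_count_mem (s t : seq I) :
  (forall i, count_mem i s = count_mem i t) -> perm_eq s t.
Proof. by move=> h; apply/allP => i _ /=; rewrite h. Qed.

Lemma arrangements_gt0 t : (0 < arrangements t)%N.
Proof.
by have := arrangements_fact t; case: arrangements => // h; have := fact_gt0 (size t); rewrite -h mul0n.
Qed.

(** The ratio of arrangements (s ++ t) to arrangements t is a ratio of factorials of
    the sizes, divided by factorials of multiplicities that only grow. *)
Lemma arrangements_cat_le (s t : seq I) :
  (arrangements (s ++ t) * (size t)`! <= (size (s ++ t))`! * arrangements t)%N.
Proof.
rewrite -(arrangements_fact (s ++ t)) -(arrangements_fact t).
rewrite -mulnA leq_mul2l; apply/orP; right.
rewrite mulnC leq_mul2r; apply/orP; right.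
by apply: leq_prod => x _; rewrite count_cat leq_fact ?leq_addl.
Qed.

Lemma card_arrangements d (t : d.-tuple I) :
  #|[pred u : d.-tuple I | perm_eq u t]| = arrangements t.
Proof.
rewrite cardE /arrangements -(size_map val); apply: perm_size; apply: uniq_perm.
- by rewrite (map_inj_uniq val_inj) enum_uniq.
- exact: permutations_uniq.
move=> u; rewrite mem_permutations; apply/mapP/idP => [[v]|ut].
  by rewrite mem_enum inE => h ->.
have su : size u == d by rewrite (perm_size ut) size_tuple.
by exists (Tuple su) => //; rewrite mem_enum inE.
Qed.

End Arrangements.

(** * Hypercontractivity for symmetric tensors *)

Section Tensors.
Variable R : realType.
Local Notation C := R[i].

Definition monomial (n : nat) (v : 'I_n -> C) (t : seq 'I_n) : C := \prod_(i <- t) v i.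

Definition tensor_eval (n d : nat) (mu : seq 'I_n -> C) (v : 'I_n -> C) : C :=
  \sum_(t : d.-tuple 'I_n) mu t * monomial v t.

Lemma torus_charE d n (b : seq 'I_d.+1) (s : seq C) : size b = n -> size s = n ->
  torus_char b s = \prod_(i < n) s`_i ^+ nth ord0 b i.
Proof.
elim: b s n => [|x b IH] [|z s] [|n] //=; first by rewrite big_ord0.
by move=> [sb] [ss]; rewrite big_ord_recl /= (IH _ _ sb ss).
Qed.

Lemma monomialE n (v : 'I_n -> C) (t : seq 'I_n) :
  monomial v t = \prod_(i < n) v i ^+ count_mem i t.
Proof.
rewrite /monomial; elim: t => [|i t IH].
  by rewrite big_nil big1 // => i _.
rewrite big_cons IH (bigD1 i) //= [RHS](bigD1 i) //= mulrA eqxx -exprS; congr (_ * _).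
by apply: eq_bigr => j ji; rewrite eq_sym (negPf ji).
Qed.

Lemma tval_eq k (T : eqType) (x y : k.-tuple T) : (tval x == tval y) = (x == y).
Proof. by []. Qed.

Section Exponents.
Variables (n d : nat).

Definition exponent (t : seq 'I_n) : n.-tuple 'I_d.+1 := [tuple inord (count_mem i t) | i < n].

Lemma nth_exponent (t : d.-tuple 'I_n) (i : 'I_n) : nth ord0 (exponent t) i = count_mem i t :> nat.
Proof.
rewrite -tnth_nth tnth_mktuple inordK // ltnS -[X in (_ <= X)%N](size_tuple t).
exact: count_size.
Qed.

Lemma exponent_eq (t u : d.-tuple 'I_n) : (exponent u == exponent t) = perm_eq u t.
Proof.
apply/eqP/idP => [e|h].
  by apply: perm_eq_count_mem => i; rewrite -!nth_exponent e.
by apply/eq_from_tnth => i; rewrite !tnth_mktuple (permP h).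
Qed.

(** The coefficient, of the polynomial tensor_eval d mu, at the monomial of exponent
    b. *)
Definition monomial_coef (mu : seq 'I_n -> C) (b : seq 'I_d.+1) : C :=
  \sum_(t : d.-tuple 'I_n | exponent t == b :> seq _) mu t.

Lemma tensor_eval_torus_poly mu (s : seq C) : size s = n ->
  tensor_eval d mu (fun i : 'I_n => s`_i) = torus_poly n (monomial_coef mu) s.
Proof.
move=> sn; rewrite /tensor_eval (partition_big (fun t : d.-tuple 'I_n => exponent t) xpredT) //=.
apply: eq_bigr => b _; rewrite /monomial_coef mulr_suml.
apply: eq_bigr => t /eqP tb; congr (_ * _).
rewrite (torus_charE (n := n)) ?size_tuple // monomialE.
by apply: eq_bigr => i _; rewrite -tb nth_exponent.
Qed.

(** A coefficient is arrangements t times mu t and its square spreads over the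
    arrangements t tuples with this exponent, which leaves one factor. *)
Lemma monomial_coef_norm mu : (forall s t, perm_eq s t -> mu s = mu t) ->
  \sum_(b : n.-tuple 'I_d.+1) normc (monomial_coef mu b) ^+ 2 =
  \sum_(t : d.-tuple 'I_n) (arrangements t)%:R * normc (mu t) ^+ 2.
Proof.
move=> sym; rewrite [RHS](partition_big (fun t : d.-tuple 'I_n => exponent t) xpredT) //=; apply: eq_bigr => b _.
have fiber (t : d.-tuple 'I_n) : exponent t = b ->
    monomial_coef mu b = (arrangements t)%:R * mu t.
  move=> tb; rewrite /monomial_coef (eq_bigl [pred u : d.-tuple 'I_n | perm_eq u t]); last first.
    by move=> u; rewrite -tb tval_eq exponent_eq.
  rewrite (eq_bigr (fun=> mu t)) => [|u /= /sym //].
  by rewrite sumr_const card_arrangements mulr_natl.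
have nn (k : nat) : normc (k%:R : C) = k%:R.
  by rewrite -(rmorph_nat (real_complex R)) normc_real ?ler0n.
case: (pickP [pred t : d.-tuple 'I_n | exponent t == b]) => [t0 /= /eqP t0b|none]; last first.
  by rewrite /monomial_coef !big_pred0 ?normc0 ?expr0n // => t; rewrite ?tval_eq; exact: none.
rewrite (eq_bigr (fun=> (arrangements t0)%:R * normc (mu t0) ^+ 2)) => [|t /eqP tb].
  rewrite (fiber _ t0b) normcM exprMn nn.
  rewrite (eq_bigl [pred u : d.-tuple 'I_n | perm_eq u t0]); last first.
    by move=> u /=; rewrite -t0b exponent_eq.
  by rewrite sumr_const card_arrangements -[RHS]mulr_natl mulrA expr2.
have tt0 : perm_eq t t0 by rewrite -exponent_eq tb t0b.
rewrite (sym _ _ tt0); congr (_%:R * _).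
by apply: perm_size; exact: perm_permutations.
Qed.

Lemma exponent_sum (t : d.-tuple 'I_n) : \sum_(x <- exponent t) (x : nat)%:R = d%:R :> R.
Proof.
rewrite big_tuple -natr_sum; congr (_%:R).
rewrite (eq_bigr (fun i => count_mem i t)); last first.
  by move=> i _; rewrite (tnth_nth ord0) nth_exponent.
by rewrite sum_count_mem_all size_tuple.
Qed.

(** By homogeneity the energy of the polynomial is d times the square of its L^2
    norm.  The error of the inequality on the circle, committed once per variable,
    is chosen to add up to less than 1.  The same N and w serve for all mu and all
    theta. *)
Lemma tensor_hypercontractive : exists N, exists2 w : C, N.-primitive_root w &
  forall mu (theta : R), (forall s t, perm_eq s t -> mu s = mu t) -> 0 <= theta < 1 ->
  (\sum_(t : d.-tuple 'I_n) (arrangements t)%:R * normc (mu t) ^+ 2) `^ (1 - theta) <=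
  expR (theta * d.+1%:R) *
    torus_mean N w n (fun s => (normc (tensor_eval d mu (fun i : 'I_n => s`_i)) ^+ 2) `^ (1 - theta)).
Proof.
have eps0 : (0 : R) < n.+1%:R^-1 by rewrite invr_gt0 ltr0n.
have [N [dN HN]] := circle_entropy d eps0.
have [w prim_w] := exists_prim_root R (leq_ltn_trans (leq0n d) dN).
exists N, w => // mu theta sym th.
have := torus_entropy prim_w dN (HN N w prim_w (leqnn N)) n (monomial_coef mu) => ent.
rewrite (eq_torus_mean prim_w (G := fun s =>
  (normc (torus_poly n (monomial_coef mu) s) ^+ 2) `^ (1 - theta))); last first.
  by move=> s sn _; rewrite tensor_eval_torus_poly.
rewrite -monomial_coef_norm //; apply: torus_power_mean_ge => //.
apply: le_trans ent _; rewrite lerD2l mulr_sumr; apply: ler_sum => b _.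
case: (pickP [pred t : d.-tuple 'I_n | exponent t == b]) => [t0 /= /eqP t0b|none]; last first.
  have -> : monomial_coef mu b = 0 by apply: big_pred0 => t; rewrite tval_eq; exact: none.
  by rewrite normc0 expr0n !mulr0.
rewrite -{1}t0b exponent_sum ler_wpM2r ?sqr_ge0 // -[d.+1%:R]natr1 lerD2l.
by rewrite ler_pdivrMr ?ltr0n // mul1r ler_nat.
Qed.

End Exponents.
End Tensors.

(** * Polarization *)

Section Polarization.
Variables (R : realType) (n : nat).
Local Notation C := R[i].
Local Notation I := 'I_n.

Definition symmetric_tensor (V : Type) (T : seq I -> V) :=
  forall s t, perm_eq s t -> T s = T t.

Lemma symmetric_cons (V : Type) (T : seq I -> V) c :
  symmetric_tensor T -> symmetric_tensor (fun s => T (c :: s)).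
Proof. by move=> sT s t st; apply: sT; rewrite perm_cons. Qed.

Lemma symmetric_cat (V : Type) (T : seq I -> V) r :
  symmetric_tensor T -> symmetric_tensor (fun s => T (r ++ s)).
Proof. by move=> sT s t st; apply: sT; rewrite perm_cat2l. Qed.

Lemma monomial_cons (v : I -> C) c s : monomial v (c :: s) = v c * monomial v s.
Proof. by rewrite /monomial big_cons. Qed.

Lemma monomialZ (x : C) (v : I -> C) (t : seq I) :
  monomial (fun i => x * v i) t = x ^+ size t * monomial v t.
Proof.
elim: t => [|c t IH]; first by rewrite /monomial !big_nil mulr1.
by rewrite !monomial_cons IH /= exprS; ring.
Qed.

(** The value of the multilinear form T with a in j slots and b in the other l. *)
Definition polar_eval j l (T : seq I -> C) (a b : I -> C) : C :=
  tensor_eval j (fun s => tensor_eval l (fun t => T (s ++ t)) b) a.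

Lemma tensor_evalS k (T : seq I -> C) (v : I -> C) :
  tensor_eval k.+1 T v = \sum_c v c * tensor_eval k (fun s => T (c :: s)) v.
Proof.
rewrite /tensor_eval (big_tupleS _ (fun t => T t * monomial v t)); apply: eq_bigr => c _.
by rewrite mulr_sumr; apply: eq_bigr => t _; rewrite monomial_cons mulrCA.
Qed.

Lemma polar_evalSl j l (T : seq I -> C) a b :
  polar_eval j.+1 l T a b = \sum_c a c * polar_eval j l (fun s => T (c :: s)) a b.
Proof. by rewrite /polar_eval tensor_evalS. Qed.

Lemma polar_evalSr j l (T : seq I -> C) a b : symmetric_tensor T ->
  polar_eval j l.+1 T a b = \sum_c b c * polar_eval j l (fun s => T (c :: s)) a b.
Proof.
move=> sT; rewrite /polar_eval {1}/tensor_eval.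
rewrite (eq_bigr (fun s : j.-tuple I => \sum_c b c *
   (tensor_eval l (fun t => T (c :: s ++ t)) b * monomial a s))); last first.
  move=> s _; rewrite tensor_evalS mulr_suml; apply: eq_bigr => c _.
  rewrite mulrA; congr (_ * _ * _); apply: eq_bigr => t _; congr (_ * _).
  exact: sT (permEl (perm_catCA s [:: c] t)).
by rewrite exchange_big; apply: eq_bigr => c _; rewrite -mulr_sumr.
Qed.

Lemma tensor_eval_binomial k (T : seq I -> C) a b : symmetric_tensor T ->
  tensor_eval k T (fun i => a i + b i) =
  \sum_(i < k.+1) 'C(k, i)%:R * polar_eval i (k - i) T a b.
Proof.
elim: k T => [|k IH] T sT.
  rewrite big_ord1 bin0 mul1r /polar_eval /tensor_eval.
  rewrite (big_tuple0 (fun t => T t * monomial (fun i => a i + b i) t)).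
  rewrite (big_tuple0 (fun s => (\sum_(t : 0.-tuple I) T (s ++ t) * monomial b t) * monomial a s)).
  by rewrite (big_tuple0 (fun t => T t * monomial b t)) /monomial !big_nil !mulr1.
rewrite tensor_evalS.
have -> : \sum_c (a c + b c) * tensor_eval k (fun s => T (c :: s)) (fun i => a i + b i) =
    \sum_(i < k.+1) 'C(k, i)%:R * (polar_eval i.+1 (k - i) T a b + polar_eval i (k - i).+1 T a b).
  rewrite (eq_bigr (fun c => \sum_(i < k.+1) 'C(k, i)%:R *
     ((a c * polar_eval i (k - i) (fun s => T (c :: s)) a b) +
      (b c * polar_eval i (k - i) (fun s => T (c :: s)) a b)))); last first.
    move=> c _; rewrite IH; last exact: symmetric_cons.
    by rewrite mulr_sumr; apply: eq_bigr => i _; rewrite -mulrDl mulrCA.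
  rewrite exchange_big; apply: eq_bigr => i _; rewrite -mulr_sumr big_split /=.
  by rewrite polar_evalSl polar_evalSr.
rewrite (eq_bigr (fun i : 'I_k.+1 => 'C(k, i)%:R * polar_eval i.+1 (k - i) T a b +
   'C(k, i)%:R * polar_eval i (k - i).+1 T a b)); last by move=> i _; rewrite mulrDr.
rewrite big_split /= [RHS]big_ord_recl /= bin0 mul1r subn0.
rewrite [in RHS](eq_bigr (fun i : 'I_k.+1 => 'C(k, i)%:R * polar_eval i.+1 (k - i) T a b +
   'C(k, i.+1)%:R * polar_eval i.+1 (k - i) T a b)); last first.
  by move=> i _; rewrite /bump /= add1n binS subSS natrD mulrDl addrC.
rewrite big_split /= [RHS]addrCA; congr (_ + _).
rewrite big_ord_recl /= bin0 mul1r subn0 big_ord_recr /= bin_small // mul0r addr0.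
by congr (_ + _); apply: eq_bigr => i _; rewrite /bump /= add1n -subSn // subSS.
Qed.

Lemma polar_evalZ j l (T : seq I -> C) x y a b :
  polar_eval j l T (fun i => x * a i) (fun i => y * b i) = x ^+ j * y ^+ l * polar_eval j l T a b.
Proof.
rewrite /polar_eval /tensor_eval mulr_sumr; apply: eq_bigr => s _.
rewrite mulr_suml [in RHS]mulr_suml mulr_sumr; apply: eq_bigr => t _.
by rewrite !monomialZ !size_tuple; ring.
Qed.

(** With k = j + l, rho = j / k and sig = l / k, the term with a in j slots is the
    coefficient of z^j in the polynomial z |-> T(z rho a + sig b), bounded by M on the
    circle since rho + sig = 1.  This choice of rho maximizes rho^j sig^l. *)
Lemma polarization j l (T : seq I -> C) (M : R) : symmetric_tensor T -> 0 <= M -> (0 < j + l)%N ->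
  (forall v, (forall i, normc (v i) <= 1) -> normc (tensor_eval (j + l) T v) <= M) ->
  forall a b, (forall i, normc (a i) <= 1) -> (forall i, normc (b i) <= 1) ->
  'C(j + l, j)%:R * ((j%:R / (j + l)%:R) ^+ j * (l%:R / (j + l)%:R) ^+ l) *
    normc (polar_eval j l T a b) <= M.
Proof.
move=> sT M0 k0 TM a b a1 b1; set k := (j + l)%N; set rho := j%:R / k%:R; set sig := l%:R / k%:R.
have kR : (0 : R) < k%:R by rewrite ltr0n.
have rho0 : 0 <= rho by rewrite divr_ge0 ?ler0n.
have sig0 : 0 <= sig by rewrite divr_ge0 ?ler0n.
have rs1 : rho + sig = 1 by rewrite -mulrDl -natrD divff ?gt_eqF.
pose E i : C := 'C(k, i)%:R * (rho%:C ^+ i * sig%:C ^+ (k - i) * polar_eval i (k - i) T a b).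
pose p : {poly C} := \poly_(i < k.+1) E i.
have pz z : p.[z] = tensor_eval k T (fun i => z * rho%:C * a i + sig%:C * b i).
  rewrite tensor_eval_binomial // horner_poly; apply: eq_bigr => i _.
  by rewrite polar_evalZ /E exprMn; ring.
have pM z : normc z = 1 -> normc p.[z] <= M.
  move=> z1; rewrite pz; apply: TM => i; apply: le_trans (le_normcD _ _) _.
  rewrite !normcM z1 mul1r !normc_real // -rs1; apply: lerD; exact: ler_piMr.
have := sum_coef_sqr_le (e := p) (M := M) k.+1 M0 pM => sM.
have jk : (j < k.+1)%N by rewrite ltnS leq_addr.
have : normc p`_j ^+ 2 <= M ^+ 2.
  by apply: le_trans sM; rewrite (bigD1 (Ordinal jk)) //= lerDl sumr_ge0 // => *; exact: sqr_ge0.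
rewrite ler_pXn2r ?nnegrE ?normc_ge0 // coef_poly jk /E addKn !normcM !normcX !normc_real //.
by rewrite -(rmorph_nat (real_complex R)) normc_real ?ler0n // !mulrA.
Qed.

End Polarization.

(** * The inequality for symmetric tensors *)

Section TensorBH.
Variables (R : realType) (n : nat).
Local Notation C := R[i].
Local Notation I := 'I_n.

Lemma sqr_powR (x e : R) : 0 <= x -> (x ^+ 2) `^ e = x `^ (2 * e).
Proof. by move=> x0; rewrite -(powR_mulrn 2 x0) -powRrM. Qed.

Lemma powR_le_of_root (X Y e : R) : 0 <= X -> 0 < e -> X `^ e <= Y -> X <= Y `^ e^-1.
Proof.
move=> X0 e0 h; rewrite -[X]powRr1 // -(divff (lt0r_neq0 e0)) powRrM.
have Y0 : 0 <= Y by apply: le_trans h; exact: powR_ge0.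
by apply: ge0_ler_powR => //; rewrite ?nnegrE ?powR_ge0 // invr_ge0 ltW.
Qed.

Lemma torus_mean_le N w d (F : seq C -> R) (B : R) : N.-primitive_root w ->
  (forall s, size s = d -> unimodular s -> F s <= B) -> torus_mean N w d F <= B.
Proof.
by move=> pw FB; rewrite -[leRHS](torus_mean_cst pw d); apply: ler_torus_mean.
Qed.

Lemma unimodular_le s i : unimodular s -> normc ((s : seq C)`_i) <= 1.
Proof.
move=> us; have [si|si] := ltnP i (size s); last by rewrite nth_default // normc0.
by have /(all_nthP 0)/(_ i si)/eqP -> := us.
Qed.

Lemma expR_bound_linear k : expR (-1) <= (k%:R / k.+1%:R) ^+ k :> R.
Proof.
have [->|k0] := posnP k; first by rewrite expr0 expR_le1; lra.
have kR : (0 : R) < k%:R by rewrite ltr0n.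
have k1R : (0 : R) < k.+1%:R by rewrite ltr0n.
rewrite expRN -[leRHS]invrK lef_pV2 ?posrE ?expR_gt0 ?invr_gt0 ?exprn_gt0 ?divr_gt0 //.
rewrite -exprVn invf_div.
have -> : k.+1%:R / k%:R = 1 + k%:R^-1 :> R by rewrite -natr1 mulrDl divff ?gt_eqF // mul1r.
apply: (@le_trans _ _ (expR k%:R^-1 ^+ k)).
  by rewrite lerXn2r ?nnegrE ?expR_ge0 ?expR_ge1Dx // addr_ge0 ?invr_ge0 ?ltW.
by rewrite -expRM_natl mulfV ?gt_eqF.
Qed.

(** The split of the order as 1 + k' needs the l^1 norm, over the first index c, of
    the forms S c evaluated at a point of the torus.  It is the value of T with, in
    the first slot, the vector u of phases that turn each S c into its modulus, and
    polarization with j = 1 bounds it.  The constant e^{k/2 + 1} is crude but is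
    used with k much smaller than the degree of the polynomial. *)
Lemma symmetric_tensor_BH k (T : seq I -> C) (M : R) : (0 < k)%N ->
  symmetric_tensor T -> 0 <= M ->
  (forall v, (forall i, normc (v i) <= 1) -> normc (tensor_eval k T v) <= M) ->
  \sum_(t : k.-tuple I) (normc (T t) ^+ 2) `^ (k%:R / k.+1%:R) <=
  (expR (k%:R / 2 + 1) * M) `^ (2 * (k%:R / k.+1%:R)).
Proof.
case: k => // k' _ sT M0 TM; set k := k'.+1.
pose b s := normc (T s).
have := symmetric_mixed_norm_le (k := 1) k' (a := b) (ltn0Sn 0)
  (fun s => normc_ge0 (T s)) (fun s t st => congr1 (@normc R) (sT s t st)).
rewrite add1n -/k.
set e := (k.+1%:R / _ : R); set X := \sum_(s : k.-tuple I) b s `^ _; set Y := \sum_(t : 1.-tuple I) _.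
have Y0 : 0 <= Y by apply: sumr_ge0 => *; exact: powR_ge0.
rewrite muln1 divff ?pnatr_eq0 //.
rewrite powRr1 // => XY.
have e0 : 0 < e by rewrite divr_gt0 ?ltr0n.
have X0 : 0 <= X by apply: sumr_ge0 => *; exact: powR_ge0.
have -> : \sum_(t : k.-tuple I) (normc (T t) ^+ 2) `^ (k%:R / k.+1%:R) = X.
  by apply: eq_bigr => t _; rewrite sqr_powR ?normc_ge0 // natrM mulrA.
have -> : 2 * (k%:R / k.+1%:R) = e^-1 by rewrite /e invf_div natrM mulrA.
apply: le_trans (powR_le_of_root X0 e0 XY) _.
have B0 : 0 <= expR (k%:R / 2 + 1) * M by rewrite mulr_ge0 ?expR_ge0.
apply: ge0_ler_powR; rewrite ?invr_ge0 ?nnegrE ?(ltW e0) //.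
have [N [w prim_w HC]] := tensor_hypercontractive R n k'.
pose S c (s : seq C) := tensor_eval k' (fun r => T (c :: r)) (fun i : I => s`_i).
have YE : Y <= expR (k%:R / 2) * \sum_c torus_mean N w n (fun s => normc (S c s)).
  rewrite /Y (big_tupleS _ (fun t => (\sum_(r : k'.-tuple I) b (t ++ r) ^+ 2) `^ (1 / 2))).
  rewrite mulr_sumr; apply: ler_sum => c _.
  rewrite (big_tuple0 (fun t => (\sum_(r : k'.-tuple I) b ((c :: t) ++ r) ^+ 2) `^ (1 / 2))) /=.
  have th : 0 <= (1 / 2 : R) < 1 by lra.
  have := HC (fun r => T (c :: r)) (1 / 2) (symmetric_cons c sT) th.
  rewrite (_ : 1 - 1 / 2 = 1 / 2); last by field.
  rewrite (eq_torus_mean prim_w (G := fun s => normc (S c s))); last first.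
    by move=> s _ _; rewrite sqr_powR ?normc_ge0 // mul1r divff ?pnatr_eq0 // powRr1 ?normc_ge0.
  rewrite (_ : 1 / 2 * k'.+1%:R = k%:R / 2); last by rewrite mulrC mul1r.
  apply: le_trans; apply: ge0_ler_powR; rewrite ?nnegrE ?divr_ge0 //.
  - by apply: sumr_ge0 => *; exact: sqr_ge0.
  - by apply: sumr_ge0 => *; rewrite mulr_ge0 ?ler0n ?sqr_ge0.
  - apply: ler_sum => r _; rewrite /b -[leLHS]mul1r ler_wpM2r ?sqr_ge0 //.
    by rewrite (ler_nat R 1) arrangements_gt0.
apply: le_trans YE _; rewrite expRD -mulrA ler_pM2l ?expR_gt0 //.
rewrite -(torus_mean_sum prim_w); apply: (torus_mean_le prim_w) => s _ us.
pose u c : C := if S c s == 0 then 0 else conjc (S c s) / (normc (S c s))%:C.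
have nS c : S c s != 0 -> normc (S c s) != 0 by apply: contraNneq => /eq0_normc ->.
have uS c : u c * S c s = (normc (S c s))%:C.
  rewrite /u; case: eqVneq => [->|S0]; first by rewrite mulr0 normc0.
  rewrite mulrAC [conjc _ * _]mulrC mulcJ expr2 rmorphM mulfK //.
  by apply: contra (nS c S0) => /eqP/(congr1 (@normc R)); rewrite normc0 normc_real ?normc_ge0 // => ->.
have u1 c : normc (u c) <= 1.
  rewrite /u; case: eqVneq => [_|S0]; first by rewrite normc0.
  by rewrite normcM normcJ_real normcV normc_real ?normc_ge0 // divff // nS.
have -> : \sum_c normc (S c s) = normc (polar_eval 1 k' T u (fun i : I => s`_i)).
  rewrite polar_evalSl -[LHS]normc_real; last by apply: sumr_ge0 => *; exact: normc_ge0.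
  congr normc; rewrite rmorph_sum; apply: eq_bigr => c _.
  rewrite -[LHS]uS; congr (_ * _); rewrite /S /polar_eval {2}/tensor_eval.
  rewrite (big_tuple0 (fun r => tensor_eval k' (fun t => T (c :: r ++ t)) (fun i : I => s`_i) * monomial u r)).
  by rewrite /monomial big_nil mulr1.
have := polarization (j := 1) (l := k') sT M0 (ltn0Sn _) TM u1 (fun i => unimodular_le i us).
rewrite bin1 add1n expr1 -/k [k%:R * (_ * _)]mulrA [k%:R * _]mulrC divfK ?pnatr_eq0 //.
rewrite mul1r; set Q := normc _ => hQ.
have Q0 : 0 <= Q by exact: normc_ge0.
have : expR (-1) * Q <= M by apply: le_trans hQ; rewrite ler_wpM2r // expR_bound_linear.
by rewrite expRN -ler_pdivlMl ?invr_gt0 ?expR_gt0 // invrK.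
Qed.

(** The mixed norm inequality is applied to sqrt(arrangements) |T|, the weights for
    which the inner sums are L^2 norms on the torus.  Replacing arrangements of the
    whole tuple by those of its last l entries costs (k+l)! / l!.  Then the means over
    the torus of the k-th order tensors Q are bounded at each point of the torus by
    symmetric_tensor_BH, and their suprema by polarization. *)
Lemma tensor_BH k l (T : seq I -> C) (M : R) : (0 < k)%N ->
  symmetric_tensor T -> 0 <= M ->
  (forall v, (forall i, normc (v i) <= 1) -> normc (tensor_eval (k + l) T v) <= M) ->
  (\sum_(s : (k + l).-tuple I) (Num.sqrt (arrangements s)%:R * normc (T s))
      `^ ((2 * (k + l))%:R / (k + l).+1%:R)) `^ ((k + l).+1%:R / (2 * (k + l))%:R) <=
  Num.sqrt ((k + l)`!%:R / l`!%:R) * expR (l.+1%:R / (2 * k)%:R + k%:R / 2 + 1) *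
   (M / ('C(k + l, k)%:R * ((k%:R / (k + l)%:R) ^+ k * (l%:R / (k + l)%:R) ^+ l))).
Proof.
move=> k0 sT M0 TM.
set A : R := _ / l`!%:R; set c0 : R := 'C(_, _)%:R * _; set M1 := M / c0.
have lf0 : (0 : R) < l`!%:R by rewrite ltr0n fact_gt0.
have A0 : 0 <= A by rewrite divr_ge0 ?ler0n.
have kR : (0 : R) < k%:R by rewrite ltr0n.
have klR : (0 : R) < (k + l)%:R by rewrite ltr0n addn_gt0 k0.
have k1R : (0 : R) < k.+1%:R by rewrite ltr0n.
have c00 : 0 < c0.
  have r1 : (0 : R) < (k%:R / (k + l)%:R) ^+ k by rewrite exprn_gt0 ?divr_gt0.
  have r2 : (0 : R) < (l%:R / (k + l)%:R) ^+ l.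
    have [l0|l0] := posnP l; first by rewrite [X in _ ^+ X]l0 expr0.
    by rewrite exprn_gt0 // divr_gt0 // ltr0n.
  by rewrite mulr_gt0 ?ltr0n ?bin_gt0 ?leq_addr // mulr_gt0.
have M10 : 0 <= M1 by rewrite divr_ge0 // ltW.
set P := k%:R / k.+1%:R : R.
have P0 : 0 < P by rewrite divr_gt0.
have P1 : P < 1 by rewrite ltr_pdivrMr // mul1r ltr_nat.
pose a s := Num.sqrt (arrangements s)%:R * normc (T s).
have a0 s : 0 <= a s by rewrite mulr_ge0 ?sqrtr_ge0 ?normc_ge0.
have asym s t : perm_eq s t -> a s = a t.
  by move=> st; rewrite /a (sT _ _ st) /arrangements (perm_size (perm_permutations st)).
have blei := symmetric_mixed_norm_le l k0 a0 asym.
apply: (le_trans blei).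
have a2 s : a s ^+ 2 = (arrangements s)%:R * normc (T s) ^+ 2.
  by rewrite /a exprMn sqr_sqrtr ?ler0n.
have [N [w prim_w HC]] := tensor_hypercontractive R n l.
pose Q (t : seq I) (s : seq C) := tensor_eval l (fun r => T (t ++ r)) (fun i : I => s`_i).
(* The moment of order 1 - theta = P of |Q|^2 is the p-th moment of |Q| for
   p = 2k/(k+1). *)
have step (t : k.-tuple I) : (\sum_(r : l.-tuple I) a (t ++ r) ^+ 2) `^ P <=
    A `^ P * (expR ((1 - P) * l.+1%:R) * torus_mean N w n (fun s => (normc (Q t s) ^+ 2) `^ P)).
  have th : 0 <= 1 - P < 1 by rewrite subr_ge0 (ltW P1) /= ltrBlDr ltrDl.
  have := HC (fun r => T (t ++ r)) (1 - P) (symmetric_cat t sT) th.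
  rewrite subKr => h; apply: le_trans (ler_wpM2l (powR_ge0 A P) h).
  rewrite -powRM //; last by apply: sumr_ge0 => *; rewrite mulr_ge0 ?ler0n ?sqr_ge0.
  apply: ge0_ler_powR; rewrite ?nnegrE ?(ltW P0) //.
  - by apply: sumr_ge0 => *; exact: sqr_ge0.
  - by rewrite mulr_ge0 // sumr_ge0 // => *; rewrite mulr_ge0 ?ler0n ?sqr_ge0.
  rewrite mulr_sumr; apply: ler_sum => r _; rewrite a2 [leRHS]mulrA ler_wpM2r ?sqr_ge0 //.
  rewrite /A mulrAC ler_pdivlMr // -!natrM ler_nat.
  by have := arrangements_cat_le t r; rewrite size_cat !size_tuple.
set H := expR (k%:R / 2 + 1) * M1.
have H0 : 0 <= H by rewrite mulr_ge0 ?expR_ge0.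
have tot : \sum_(t : k.-tuple I) (\sum_(r : l.-tuple I) a (t ++ r) ^+ 2) `^ P <=
    A `^ P * (expR ((1 - P) * l.+1%:R) * H `^ (2 * P)).
  apply: le_trans (ler_sum _ (fun t _ => step t)) _.
  rewrite -!mulr_sumr ler_wpM2l ?powR_ge0 // ler_pM2l ?expR_gt0 //.
  rewrite -(torus_mean_sum prim_w); apply: (torus_mean_le prim_w) => s _ us.
  apply: (symmetric_tensor_BH (T := fun t => Q t s)) => //.
    by move=> t t' tt'; apply: eq_bigr => r _; rewrite (sT (t ++ r) (t' ++ r)) // perm_cat2r.
  move=> v v1; rewrite /M1 ler_pdivlMr // mulrC.
  exact: (polarization sT M0 (ltn_addr l k0) TM v1 (fun i => unimodular_le i us)).
have e0 : 0 < k.+1%:R / (2 * k)%:R :> R by rewrite divr_gt0 // ltr0n muln_gt0.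
apply: (le_trans (ge0_ler_powR (ltW e0) _ _ tot)).
- by rewrite nnegrE sumr_ge0 // => *; exact: powR_ge0.
- by rewrite nnegrE !mulr_ge0 ?powR_ge0 ?expR_ge0.
have PE : P * (k.+1%:R / (2 * k)%:R) = 2^-1.
  by rewrite /P natrM; field; rewrite !gt_eqF.
have E1 : (1 - P) * l.+1%:R * (k.+1%:R / (2 * k)%:R) = l.+1%:R / (2 * k)%:R.
  have -> : 1 - P = k.+1%:R^-1.
    by rewrite /P -natr1; field; rewrite natr1 gt_eqF.
  by rewrite natrM; field; rewrite !gt_eqF.
rewrite powRM; [|exact: powR_ge0|by rewrite mulr_ge0 ?expR_ge0 ?powR_ge0].
rewrite [(expR _ * _) `^ _]powRM ?expR_ge0 ?powR_ge0 //.
rewrite -!powRrM PE -expRM E1 -[2 * P * _]mulrA PE mulfV ?pnatr_eq0 // powRr1 // powR12_sqrt //.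
by rewrite /H !expRD !mulrA.
Qed.

End TensorBH.

(** * From polynomials to tensors *)

Section Multinomials.
Variables (n m : nat).
Local Notation I := 'I_n.

Definition content (t : seq I) : 'X_{1..n} := [multinom count_mem i t | i < n].

Lemma mdeg_content t : mdeg (content t) = size t.
Proof.
by rewrite mdegE (eq_bigr (fun i => count_mem i t)) ?sum_count_mem_all // => i _; rewrite mnmE.
Qed.

Lemma content_bound (t : m.-tuple I) : (mdeg (content t) < m.+1)%N.
Proof. by rewrite mdeg_content size_tuple. Qed.

(** The same exponent in the index type of the sum that defines BH_coef_norm. *)
Definition bcontent (t : m.-tuple I) : 'X_{1..n < m.+1} := BMultinom (content_bound t).

Lemma content_eq (t u : seq I) : (content u == content t) = perm_eq u t.
Proof.
apply/eqP/idP => [e|h].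
  by apply: perm_eq_count_mem => i; have /mnmP/(_ i) := e; rewrite !mnmE.
by apply/mnmP => i; rewrite !mnmE (permP h).
Qed.

Lemma bcontent_eq (t u : m.-tuple I) : (bcontent u == bcontent t) = perm_eq u t.
Proof. by rewrite -content_eq. Qed.

Lemma exists_content (a : 'X_{1..n < m.+1}) : mdeg a = m -> exists t, bcontent t = a.
Proof.
move=> am; pose s := flatten [seq nseq (bmnm a i) i | i <- enum 'I_n].
have cs i : count_mem i s = bmnm a i.
  rewrite count_flatten -map_comp sumnE big_map big_enum /= (bigD1 i) //=.
  rewrite count_nseq /= eqxx mul1n big1 ?addn0 // => j ji.
  by rewrite count_nseq /= (negPf ji).
have ss : size s == m.
  by rewrite -sum_count_mem_all -[X in _ == X]am mdegE; apply/eqP; apply: eq_bigr => i _.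
exists (Tuple ss); apply: val_inj; apply/mnmP => i /=.
by rewrite mnmE cs.
Qed.

End Multinomials.

Section CoefficientTensor.
Variables (R : realType) (n m : nat) (P : {mpoly R[i][n]}).
Hypothesis homP : P \is m.-homog.
Local Notation C := R[i].
Local Notation I := 'I_n.

(** The symmetric tensor of P: its coefficients, shared evenly among the
    rearrangements. *)
Definition coef_tensor (t : seq I) : C := P@_(content t) / (arrangements t)%:R.

Lemma coef_tensor_sym : symmetric_tensor coef_tensor.
Proof.
move=> s t st; rewrite /coef_tensor /arrangements (perm_size (perm_permutations st)).
by move: st; rewrite -content_eq => /eqP ->.
Qed.

Lemma coef_off_degree (a : 'X_{1..n < m.+1}) : mdeg a != m -> P@_a = 0.
Proof. exact: dhomog_nemf_coeff. Qed.

Lemma tensor_eval_coef (v : I -> C) : tensor_eval m coef_tensor v = P.@[v].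
Proof.
have sP : (msize P <= m.+1)%N.
  rewrite msizeE; apply/bigmax_leqP_seq => a aP _.
  by rewrite (dhomog_mf homP aP).
rewrite [in RHS](mpolywE sP) raddf_sum /= /tensor_eval.
rewrite (partition_big (@bcontent n m) xpredT) //=; apply: eq_bigr => a _.
rewrite mevalZ mevalX.
have [am|am] := eqVneq (mdeg a) m; last first.
  rewrite coef_off_degree // mul0r big1 // => t /eqP ta.
  by move: am; rewrite -ta /= mdeg_content size_tuple eqxx.
have [t0 t0a] := exists_content am.
rewrite -t0a (eq_bigl [pred u : m.-tuple I | perm_eq u t0]); last first.
  by move=> u; rewrite bcontent_eq.
rewrite (eq_bigr (fun=> P@_(content t0) / (arrangements t0)%:R * monomial v t0)); last first.
  move=> u /= ut; rewrite -/(coef_tensor t0) (coef_tensor_sym ut); congr (_ * _).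
  by rewrite !monomialE; apply: eq_bigr => i _; rewrite (permP ut).
rewrite sumr_const card_arrangements -[LHS]mulr_natl mulrA mulrCA divff ?mulr1; last first.
  by rewrite pnatr_eq0 -lt0n arrangements_gt0.
by rewrite monomialE; congr (_ * _); apply: eq_bigr => i _; rewrite mnmE.
Qed.

(** The exponent of a monomial is shared by r = arrangements t tuples, which
    contribute r (r^{-1/2} |a|)^q = r^{1 - q/2} |a|^q >= |a|^q, as q <= 2. *)
Lemma coef_norm_le : (0 < m)%N ->
  BH_coef_norm m P <=
  (\sum_(s : m.-tuple I) (Num.sqrt (arrangements s)%:R * normc (coef_tensor s))
      `^ ((2 * m)%:R / m.+1%:R)) `^ (m.+1%:R / (2 * m)%:R).
Proof.
move=> m0; rewrite /BH_coef_norm; set q := (2 * m)%:R / m.+1%:R.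
have m1 : (0 : R) < m.+1%:R by rewrite ltr0n.
have q0 : 0 < q by rewrite divr_gt0 // ltr0n muln_gt0.
have q2 : q <= 2 by rewrite ler_pdivrMr // -natrM ler_nat; lia.
apply: ge0_ler_powR; rewrite ?nnegrE.
- by rewrite divr_ge0 ?ler0n.
- by apply: sumr_ge0 => *; exact: powR_ge0.
- by apply: sumr_ge0 => *; exact: powR_ge0.
rewrite [leRHS](partition_big (@bcontent n m) xpredT) //= big_mkcond /=.
apply: ler_sum => a _; case: eqP => [am|_]; last first.
  by apply: sumr_ge0 => *; exact: powR_ge0.
have [t0 t0a] := exists_content am; set r : R := (arrangements t0)%:R.
have r1 : 1 <= r by rewrite /r (ler_nat R 1) arrangements_gt0.
have r0 : 0 < r by apply: lt_le_trans r1.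
rewrite (eq_bigl [pred u : m.-tuple I | perm_eq u t0]); last first.
  by move=> u; rewrite -t0a bcontent_eq.
rewrite (eq_bigr (fun=> (Num.sqrt r * normc (coef_tensor t0)) `^ q)); last first.
  move=> u /= ut; rewrite (coef_tensor_sym ut) /r /arrangements.
  by rewrite (perm_size (perm_permutations ut)).
rewrite sumr_const card_arrangements -mulr_natl -/r.
have -> : normc (coef_tensor t0) = normc P@_a / r.
  rewrite -t0a /coef_tensor normcM normcV; congr (_ / _).
  by rewrite -(rmorph_nat (real_complex R)) normc_real ?ler0n.
set x := normc P@_a; have x0 : 0 <= x by exact: normc_ge0.
have -> : Num.sqrt r * (x / r) = r `^ (- 2^-1) * x.
  rewrite powRN powR12_sqrt ?(ltW r0) // mulrCA mulrC; congr (_ * _).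
  rewrite -{2}[r]sqr_sqrtr ?(ltW r0) // expr2 invfM mulVKf // gt_eqF ?sqrtr_gt0 //.
rewrite powRM ?powR_ge0 // mulrA -powRrM -{1}[r]powRr1 ?(ltW r0) //.
rewrite -powRD; last by rewrite (gt_eqF r0) implybT.
rewrite ler_peMl ?powR_ge0 // -[leLHS](powRr0 r) ler_powR //; lra.
Qed.

End CoefficientTensor.

Section ConstantBound.
Variable R : realType.
Local Notation C := R[i].

(** By homogeneity P(v) = (1 - tau)^{-m} P((1 - tau) v), where the dilated point lies
    in the open polydisk; a small tau contradicts P(v) > r. *)
Lemma polydisk_closed_le n m (P : {mpoly C[n]}) (r : R) : P \is m.-homog ->
  (forall v, polydisk v -> normc P.@[v] <= r) ->
  forall v, (forall i, normc (v i) <= 1) -> normc P.@[v] <= r.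
Proof.
move=> hP Pr v v1; rewrite leNgt; apply/negP => rX; set X := normc _ in rX.
have r0 : 0 <= r.
  apply: le_trans (normc_ge0 _) (Pr (fun=> 0) _) => i.
  by rewrite normc0.
have X0 : 0 < X by exact: le_lt_trans rX.
pose tau := Num.min 1 ((X - r) / (m.+1%:R * X)).
have mX : 0 < m.+1%:R * X by rewrite mulr_gt0 ?ltr0n.
have t0 : 0 < tau by rewrite lt_min ltr01 divr_gt0 // subr_gt0.
have t1 : tau <= 1 by rewrite ge_min lexx.
have tX : m.+1%:R * X * tau <= X - r.
  by rewrite mulrC -ler_pdivlMr // ge_min lexx orbT.
have rho0 : 0 <= 1 - tau by rewrite subr_ge0.
have h : (1 - tau) ^+ m * X <= r.
  have := Pr (fun i => (1 - tau)%:C * v i); rewrite -!(tensor_eval_coef hP).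
  have -> : tensor_eval m (coef_tensor P) (fun i => (1 - tau)%:C * v i) =
     (1 - tau)%:C ^+ m * P.@[v].
    rewrite -(tensor_eval_coef hP) /tensor_eval mulr_sumr; apply: eq_bigr => t _.
    by rewrite monomialZ size_tuple mulrCA.
  rewrite normcM normcX normc_real //; apply => i.
  rewrite normcM normc_real //; apply: (@le_lt_trans _ _ (1 - tau)); last by rewrite ltrBlDr ltrDl.
  exact: ler_piMr.
have := bernoulli_sub m (_ : 0 <= tau <= 1); rewrite t1 ltW // => /(_ isT) hb.
have : (1 - m%:R * tau) * X <= (1 - tau) ^+ m * X by rewrite ler_pM2r //; lra.
have : 0 < tau * X by rewrite mulr_gt0.
move: tX; rewrite -natr1; lra.
Qed.

Definition BH_bound (k l : nat) : R :=
  Num.sqrt ((k + l)`!%:R / l`!%:R) * expR (l.+1%:R / (2 * k)%:R + k%:R / 2 + 1) /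
   ('C(k + l, k)%:R * ((k%:R / (k + l)%:R) ^+ k * (l%:R / (k + l)%:R) ^+ l)).

(** The polydisk norm may be infinite only formally: in that case the bound is
    trivial since 0 < D. *)
Lemma B_pol_le k l (D : R) : (0 < k)%N -> 1 <= D -> BH_bound k l <= D ->
  (B_pol R (k + l) <= D%:E)%E.
Proof.
move=> k0 D1 BD; apply: ereal_inf_lbound; exists D => //; split=> // n P n0 hP.
have D0 : 0 < D by apply: lt_le_trans D1.
have ub v : polydisk v -> ((normc P.@[v])%:E <= polydisk_norm P)%E.
  by move=> v1; apply: ereal_sup_ubound; exists v.
have p0 : @polydisk R n (fun=> 0) by move=> i; rewrite normc0.
case E : (polydisk_norm P) => [r| |].
- have Pr v : polydisk v -> normc P.@[v] <= r by move/ub; rewrite E lee_fin.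
  have r0 : 0 <= r by apply: le_trans (normc_ge0 _) (Pr _ p0).
  have kl0 : (0 < k + l)%N by rewrite addn_gt0 k0.
  rewrite -EFinM lee_fin; apply: le_trans (coef_norm_le hP kl0) _.
  apply: le_trans (tensor_BH (M := r) k0 (coef_tensor_sym P) r0 _) _.
    by move=> v v1; rewrite tensor_eval_coef //; exact: (polydisk_closed_le hP Pr).
  have -> (a b c : R) : a * (b / c) = a / c * b by rewrite mulrA mulrAC.
  exact: (ler_wpM2r r0 BD).
- by rewrite gt0_muley ?leey // lte_fin.
- by have := ub _ p0; rewrite E leeNy_eq.
Qed.

End ConstantBound.

(** * Choice of the splitting *)

Section Asymptotics.
Variable R : realType.

Lemma fact_le_exp k n : (k <= n)%N -> (k`! <= n ^ k)%N.
Proof.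
elim: k => // k IH kn; rewrite factS expnS.
by apply: leq_mul => //; apply: IH; exact: ltnW.
Qed.

Lemma fact_add_ge k l : (l`! * l.+1 ^ k <= (k + l)`!)%N.
Proof.
elim: k => [|k IH]; first by rewrite muln1.
rewrite addSn factS expnS mulnCA; apply: leq_mul => //.
by rewrite ltnS leq_addl.
Qed.

(** With A = m! / l!, one has 'C(m, k) = A / k!, so that the factor in front of the
    exponential is k! / (sqrt A rho^k sig^l).  Here A >= (m/2)^k >= (m/e)^k since
    2k <= m, k! / rho^k <= m^k, and sig^{-l} = (1 + k/l)^l <= e^k. *)
Lemma BH_bound_le k l : (0 < k)%N -> (k <= l)%N ->
  BH_bound R k l <= expR (k%:R / 2 * ln (k + l)%:R + 2 * k%:R + (k + l)%:R / (2 * k)%:R + 1).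
Proof.
move=> k0 kl; have l0 : (0 < l)%N by apply: leq_trans kl.
have kR : (0 : R) < k%:R by rewrite ltr0n.
have lR : (0 : R) < l%:R by rewrite ltr0n.
have m0 : (0 : R) < (k + l)%:R by rewrite ltr0n addn_gt0 k0.
set L := ln _; have eL : expR L = (k + l)%:R by rewrite lnK.
set A : R := (k + l)`!%:R / l`!%:R.
have f0 (i : nat) : (0 : R) < i`!%:R by rewrite ltr0n fact_gt0.
have C0 : (0 : R) < 'C(k + l, k)%:R by rewrite ltr0n bin_gt0 leq_addr.
have Age : expR (L - 1) ^+ k <= A.
  rewrite ler_pdivlMr // mulrC.
  apply: (@le_trans _ _ (l`!%:R * l.+1%:R ^+ k)).
    rewrite ler_pM2l // lerXn2r ?nnegrE ?expR_ge0 ?ler0n //.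
    rewrite expRD expRN eL ler_pdivrMr ?expR_gt0 //.
    have e2 : (2 : R) <= expR 1 by have := expR_ge1Dx (1 : R); lra.
    apply: (@le_trans _ _ (l.+1%:R * 2)); last by rewrite ler_wpM2l.
    by rewrite -natrM ler_nat muln2 -addnn leq_add // (leq_trans kl).
  by rewrite -natrX -natrM ler_nat fact_add_ge.
have A0 : 0 < A by apply: lt_le_trans Age; rewrite exprn_gt0 ?expR_gt0.
have CA : 'C(k + l, k)%:R * k`!%:R = A.
  have := bin_fact (leq_addr l k); rewrite addKn => h.
  by rewrite /A -h !natrM mulrA mulfK // gt_eqF.
have sA : expR (k%:R / 2 * (L - 1)) <= Num.sqrt A.
  rewrite -(@ler_pXn2r _ 2) ?nnegrE ?expR_ge0 ?sqrtr_ge0 // sqr_sqrtr ?(ltW A0) //.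
  apply: le_trans Age; rewrite -!expRM_natl ler_expR; lra.
have rk : k`!%:R * expR (- (k%:R * L)) <= (k%:R / (k + l)%:R) ^+ k.
  rewrite expRN expRM_natl eL expr_div_n ler_pM2r ?invr_gt0 ?exprn_gt0 //.
  by rewrite -natrX ler_nat fact_le_exp.
have sl : expR (- (k%:R : R)) <= (l%:R / (k + l)%:R) ^+ l.
  have -> : - (k%:R : R) = l%:R * - (k%:R / l%:R) by rewrite mulrN mulrC divfK // gt_eqF.
  rewrite expRM_natl lerXn2r ?nnegrE ?expR_ge0 ?divr_ge0 ?ler0n //.
  rewrite expRN -[leRHS]invrK lef_pV2 ?posrE ?expR_gt0 ?invr_gt0 ?divr_gt0 //.
  rewrite invf_div natrD mulrDl divff ?(gt_eqF lR) // addrC; exact: expR_ge1Dx.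
set rho := _ ^+ k in rk *; set sig := _ ^+ l in sl *.
have rho0 : 0 < rho by rewrite exprn_gt0 ?divr_gt0.
have sig0 : 0 < sig by rewrite exprn_gt0 ?divr_gt0.
have sA0 : 0 < Num.sqrt A by rewrite sqrtr_gt0.
have key : k`!%:R <= expR (k%:R / 2 * L + k%:R * (3 / 2)) * (rho * sig * Num.sqrt A).
  have -> : k`!%:R = expR (k%:R / 2 * L + k%:R * (3 / 2)) *
     (k`!%:R * expR (- (k%:R * L)) * expR (- k%:R) * expR (k%:R / 2 * (L - 1))) :> R.
    rewrite -!mulrA mulrCA -!expRD -[LHS]mulr1; congr (_ * _).
    by rewrite -[LHS]expR0; congr expR; field.
  by rewrite ler_pM2l ?expR_gt0 // !ler_pM ?mulr_ge0 ?expR_ge0 ?ler0n.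
rewrite /BH_bound -/A -/rho -/sig.
rewrite ler_pdivrMr; last by rewrite !mulr_gt0.
apply: (@le_trans _ _ (expR (k%:R / 2 * L + k%:R * (3 / 2)) * ('C(k + l, k)%:R * (rho * sig)) *
   expR (l.+1%:R / (2 * k)%:R + k%:R / 2 + 1))).
  rewrite ler_pM2r ?expR_gt0 // -(ler_pM2r sA0) -expr2 sqr_sqrtr ?(ltW A0) // -[leLHS]CA.
  have -> (a b c : R) : a * (b * c) * Num.sqrt A = b * (a * (c * Num.sqrt A)) by ring.
  by rewrite ler_pM2l.
rewrite mulrAC -expRD ler_pM2r ?mulr_gt0 // ler_expR.
have : l.+1%:R / (2 * k)%:R <= (k + l)%:R / (2 * k)%:R :> R.
  rewrite ler_pM2r ?invr_gt0 ?ltr0n ?muln_gt0 // ler_nat -add1n leq_add2r //.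
move: (_ / (2 * k)%:R) (_ / (2 * k)%:R) => u v; lra.
Qed.

(** With L = ln m and S = sqrt (m L), take k between q = S / L = sqrt (m / L) and
    q + 1.  Then the terms (k/2) L and m / (2k) are at most S/2 + L/2 and S/2, and the
    hypothesis makes L and 2q, which control all that is left, at most delta S / 2. *)
Lemma BH_bound_asymptotic (delta : R) (m : nat) : 0 < delta ->
  6 + 4 / delta + 16 / delta ^+ 2 <= ln m%:R ->
  exists2 k, (0 < k <= m)%N &
    BH_bound R k (m - k) <= expR ((1 + delta) * Num.sqrt (m%:R * ln m%:R)).
Proof.
move=> d0; set L := ln _; set S := Num.sqrt _ => hL.
have d1 : 0 < 4 / delta by rewrite divr_gt0.
have d2 : 0 < 16 / delta ^+ 2 by rewrite divr_gt0 ?exprn_gt0.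
have L6 : 6 <= L by lra.
have L0 : 0 < L by lra.
have m0 : (0 : R) < m%:R.
  by rewrite ltr0n; case: (posnP m) L0 => // m0; rewrite /L m0 ln0 // ltxx.
have eL : expR L = m%:R by rewrite lnK.
have mL : 1 + L <= m%:R by rewrite -eL expR_ge1Dx.
have mL2 : L ^+ 2 / 4 <= m%:R.
  have e : expR (L / 2) ^+ 2 = m%:R by rewrite -expRM_natl -eL; congr expR; field.
  rewrite -e; have h := expR_ge1Dx (L / 2).
  have -> : L ^+ 2 / 4 = (L / 2) ^+ 2 by field.
  rewrite lerXn2r ?nnegrE ?expR_ge0 //; lra.
have SS : S ^+ 2 = m%:R * L by rewrite sqr_sqrtr // mulr_ge0 // ltW.
have S0 : 0 < S by rewrite sqrtr_gt0 mulr_gt0.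
have Sm : S <= m%:R.
  rewrite -(@ler_pXn2r _ 2) ?nnegrE ?(ltW S0) ?ler0n // SS expr2 ler_pM2l //; lra.
have SL : L <= delta * S / 2.
  have h : 2 * L / delta <= S.
    rewrite -(@ler_pXn2r _ 2) ?nnegrE ?(ltW S0) //; last by rewrite divr_ge0 ?mulr_ge0 // ltW.
    rewrite SS; apply: (@le_trans _ _ (L ^+ 2 / 4 * L)); last by rewrite ler_pM2r.
    have -> : (2 * L / delta) ^+ 2 = L ^+ 2 / 4 * (16 / delta ^+ 2) by field; rewrite gt_eqF.
    rewrite ler_pM2l; first by lra.
    by rewrite divr_gt0 // exprn_gt0.
  by move: h; rewrite ler_pdivrMr //; lra.
pose q := S / L; have q0 : 0 < q by rewrite divr_gt0.
have qd : 2 * q <= delta * S / 2.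
  have h : 4 <= L * delta by rewrite -ler_pdivrMr //; lra.
  have {}h : 4 * q <= L * delta * q by rewrite ler_pM2r.
  have e : L * q = S by rewrite /q mulrC divfK // gt_eqF.
  have {}e : L * delta * q = delta * S by rewrite -e; ring.
  by move: h; rewrite e; clear; move: q (delta * S) => u v; lra.
have [k k0 [qk kq]] : exists2 k : nat, (0 < k)%N & q <= k%:R /\ k%:R <= q + 1.
  exists (Num.truncn q).+1 => //; have /andP[h1 h2] := truncn_itv (ltW q0).
  by rewrite ltW //; split=> //; rewrite -natr1 lerD2r.
have qm : q <= m%:R / 6.
  rewrite /q ler_pdivrMr //; apply: (le_trans Sm).
  have -> : m%:R / 6 * L = m%:R * (L / 6) by ring.
  by rewrite ler_peMr ?ler0n //; lra.
have k2m : (k + k <= m)%N.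
  by rewrite -(ler_nat R) natrD; lra.
have km : (k <= m)%N by apply: leq_trans k2m; exact: leq_addr.
exists k; first by rewrite k0.
have kl : (k <= m - k)%N by rewrite leq_subRL.
apply: (le_trans (BH_bound_le k0 kl)); rewrite subnKC // -/L ler_expR.
have kR : (0 : R) < k%:R by rewrite ltr0n.
have h1 : m%:R / (2 * k)%:R <= S / 2.
  rewrite ler_pdivrMr ?ltr0n ?muln_gt0 // natrM.
  have -> : S / 2 * (2%:R * k%:R) = S * k%:R by field.
  apply: (@le_trans _ _ (S * q)); last by rewrite ler_pM2l.
  by rewrite /q mulrA -expr2 SS mulfK // gt_eqF.
have h2 : k%:R * L <= S + L.
  have -> : S + L = (q + 1) * L by rewrite mulrDl mul1r /q divfK // gt_eqF.
  by rewrite ler_pM2r.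
have -> : (1 + delta) * S = S + delta * S by rewrite mulrDl mul1r.
have -> : k%:R / 2 * L = k%:R * L / 2 by rewrite mulrAC.
clearbody q; move: h1 h2 kq qd SL L6; clear.
move: (m%:R / _) (k%:R * L) (k%:R : R) (delta * S) q => u v w x y. lra.
Qed.

End Asymptotics.

Theorem theorem1p1 (R : realType) (kappa2 : R) :
  (1 < kappa2)%R ->
  exists2 kappa1 : R, (0 < kappa1)%R &
    forall m : nat, (1 <= m)%N ->
      (B_pol R m <=
        (kappa1 * expR (kappa2 * Num.sqrt (m%:R * ln m%:R))%R)%R%:E)%E.
Proof.
move=> k2; set delta := kappa2 - 1.
have d0 : 0 < delta by rewrite subr_gt0.
pose T := 6 + 4 / delta + 16 / delta ^+ 2.
pose N := (Num.truncn (expR T)).+1.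
pose kappa1 := 1 + \sum_(i < N) `|BH_bound R 1 i|.
have k1 : 1 <= kappa1 by rewrite lerDl sumr_ge0.
exists kappa1; first exact: lt_le_trans k1.
move=> m m0; set E := expR _.
have E1 : 1 <= E.
  by rewrite -expR0 ler_expR mulr_ge0 ?sqrtr_ge0 // ltW // (lt_trans _ k2).
have D1 : 1 <= kappa1 * E by rewrite mulr_ege1.
have kappa0 : 0 <= kappa1 by apply: le_trans k1.
have [mT|mT] := leP T (ln m%:R).
  have [k /andP[k0 km] h] := BH_bound_asymptotic d0 mT.
  rewrite -[in B_pol _ _](subnKC km); apply: B_pol_le => //.
  apply: (le_trans h); rewrite /delta addrCA subrr addr0.
  by rewrite ler_peMl ?expR_ge0.
have mN : (m.-1 < N)%N.
  rewrite prednK // /N leqW // truncn_ge_nat ?expR_ge0 //.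
  by rewrite -[leLHS]lnK ?posrE ?ltr0n // ler_expR ltW.
(* For small m any split will do; k = 1 always exists. *)
rewrite -(prednK m0) -add1n; apply: B_pol_le => //.
apply: (@le_trans _ _ kappa1); last by rewrite ler_peMr.
rewrite /kappa1 (bigD1 (Ordinal mN)) //=.
have := ler_norm (BH_bound R 1 m.-1).
have : 0 <= \sum_(i < N | i != Ordinal mN) `|BH_bound R 1 i| by exact: sumr_ge0.
lra.
Qed.
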